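(* Let $M$ be a smooth manifold, $w\in\Gamma(\Lambda^2(TM))$ a bivector field and $\nabla$ a torsion-free connection on $TM$ which preserves $w$ (i.e. $\nabla w=0$). Then the operator $d_h:\Omega(M)\to\Omega(M)[h]$, $d_h\alpha=e^i\wedge_h\nabla_{e_i}\alpha$, can be extended to operators $$d_h:\Omega(M)[h]\to\Omega(M)[h],\qquad d_h:\Omega(M)[h,h^{-1}]\to\Omega(M)[h,h^{-1}]$$ as derivations, i.e. $$d_h(\alpha\wedge_h\beta)=(d_h\alpha)\wedge_h\beta+(-1)^{|\alpha|}\alpha\wedge_h(d_h\beta)$$ for $\alpha,\beta$ both in $\Omega(M)[h]$ or both in $\Omega(M)[h,h^{-1}]$ ($\alpha$ homogeneous). Furthermore, $d_h^2=0$.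
   Context: $\Omega(M)$ is the algebra of differential forms on $M$; forms of degree $p$ have degree $p$ and $h$ is an indeterminate of degree $2$; $|\alpha|$ is the degree. $\{e_i\}$ is a local frame of $TM$ with dual frame $\{e^i\}$, $w^{ij}=w(e^i,e^j)$ (antisymmetric), and repeated indices are summed; $d_h$ does not depend on the frame. For a vector $v$ and a form $\alpha$, $v\vdash\alpha$ is contraction of $v$ into the first slot and $\alpha\dashv v$ contraction of $v$ into the last slot. The quantum exterior product is defined fiberwise by $$\alpha\wedge_h\beta=\sum_{n\ge0}\frac{h^n}{n!}w^{i_1j_1}\cdots w^{i_nj_n}(\alpha\dashv e_{i_1}\dashv\cdots\dashv e_{i_n})\wedge(e_{j_n}\vdash\cdots\vdash e_{j_1}\vdash\beta)$$ (contractions on $\alpha$ by $e_{i_1}$ first, on $\beta$ by $e_{j_1}$ first), extended bilinearly over $\mathbb{R}[h]$, resp. $\mathbb{R}[h,h^{-1}]$. The connection $\nabla$ acts on forms by the induced connection. The extensions of $d_h$ are the $\mathbb{R}[h]$-linear, resp. $\mathbb{R}[h,h^{-1}]$-linear ones. *)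

(* Defs.v *)
From HB Require Import structures.
From mathcomp Require Import all_boot all_order all_algebra.
From mathcomp Require Import all_classical all_reals all_analysis.

Set Implicit Arguments.
Unset Strict Implicit.
Unset Printing Implicit Defensive.

Import Order.TTheory GRing.Theory Num.Theory.
Import numFieldNormedType.Exports.

Local Open Scope classical_set_scope.
Local Open Scope ring_scope.

(** * Smooth functions on open subsets of R^n *)

Definition partial (R : realType) n (i : 'I_n) (f : 'rV[R]_n -> R^o) :
  'rV[R]_n -> R^o := fun x => 'D_(delta_mx 0 i) f x.

(* f is C^oo on the open set U: its partial derivatives of all orders are
   (Frechet) differentiable at every point of U.  Values of f outside U are
   irrelevant. *)
Definition Csmooth (R : realType) n (U : set 'rV[R]_n) (f : 'rV[R]_n -> R^o) :=
  forall (s : seq 'I_n) (x : 'rV[R]_n), U x -> differentiable (foldr (@partial R n) f s) x.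

(** * Smooth manifolds *)

(* A smooth n-manifold structure on a topological space M, given by a smooth
   atlas.  [chart c] and [chart_inv c] are total functions of which only the
   restrictions to [dom c] and [chart c @` dom c] matter.  A chart [chart_at p]
   around every point is chosen once and for all; the tangent space at p is
   then R^n, a vector being identified with its components in that chart. *)
Record manifold (R : realType) (n : nat) (M : topologicalType) := Manifold {
  atlas : Type;
  dom : atlas -> set M;
  chart : atlas -> M -> 'rV[R]_n;
  chart_inv : atlas -> 'rV[R]_n -> M;
  chart_at : M -> atlas;
  dom_open : forall c, open (dom c);
  codom_open : forall c, open (chart c @` dom c);
  chartK : forall c p, dom c p -> chart_inv c (chart c p) = p;
  chart_continuous : forall c p, dom c p -> {for p, continuous (chart c)};
  chart_inv_continuous :
    forall c x, (chart c @` dom c) x -> {for x, continuous (chart_inv c)};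
  dom_chart_at : forall p, dom (chart_at p) p;
  transition_smooth : forall c c' i,
    Csmooth (chart c @` (dom c `&` dom c'))
            (fun x => chart c' (chart_inv c x) 0 i);
  manifold_hausdorff : hausdorff_space M;
  manifold_second_countable : @second_countable M }.

Section Geometry.
Context (R : realType) (n : nat) (M : topologicalType) (A : manifold R n M).

Local Notation V := 'rV[R]_n.

Definition std (i : 'I_n) : V := delta_mx 0 i.

(* Row vectors act on the left: if v has components v in the chart c, its
   components in the chart c' are v *m jac c c' p. *)
Definition jac (c c' : atlas A) (p : M) : 'M[R]_n :=
  jacobian (chart (m := A) c' \o chart_inv (m := A) c) (chart c p).

Definition smooth_fun (U : set M) (f : M -> R) : Prop :=
  forall c : atlas A, Csmooth (chart c @` (dom c `&` U)) (f \o chart_inv c).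

(* The derivative v(f) of f along the tangent vector v at p. *)
Definition dir_deriv (p : M) (v : V) (f : M -> R) : R :=
  'D_v (f \o chart_inv (chart_at A p) : V -> R^o) (chart (chart_at A p) p).

(** ** Vector fields *)

(* X p is a tangent vector at p, i.e. it is expressed in [chart_at p], which
   varies with p; smoothness is smoothness of its components in each fixed
   chart. *)
Definition smooth_vf (U : set M) (X : M -> V) : Prop :=
  forall (c : atlas A) (i : 'I_n),
    smooth_fun (dom c `&` U) (fun p => (X p *m jac (chart_at A p) c p) 0 i).

Definition local_frame (U : set M) (e : 'I_n -> M -> V) : Prop :=
  (forall i, smooth_vf U (e i)) /\
  (forall p, U p -> \matrix_i e i p \in unitmx).

(* The field extending the tangent vector u at p with constant components in
   [chart_at p]. *)
Definition ext_vec (p : M) (u : V) : M -> V :=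
  fun q => u *m jac (chart_at A p) (chart_at A q) q.

(** ** Exterior algebra of a cotangent space *)

(* A (not necessarily homogeneous) exterior form on V: its degree p component
   is its restriction to lists of length p. *)
Definition exterior (a : seq V -> R) : Prop :=
  (forall s t (x : R) (u v : V),
     a (s ++ (x *: u + v) :: t) = x * a (s ++ u :: t) + a (s ++ v :: t)) /\
  (forall s t r (u : V), a (s ++ u :: t ++ u :: r) = 0).

Definition covector (l : V -> R) : seq V -> R :=
  fun s => if s is [:: v] then l v else 0.

(* v |- a *)
Definition lcontract (a : seq V -> R) (v : V) : seq V -> R := fun s => a (v :: s).

(* a -| v *)
Definition rcontract (a : seq V -> R) (v : V) : seq V -> R := fun s => a (rcons s v).

(* The number of inversions of the shuffle listing first the positions where m
   is true, then those where it is false. *)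
Fixpoint shuffle_inv (m : seq bool) : nat :=
  if m is b :: m' then ((if b then 0 else count id m') + shuffle_inv m')%N
  else 0%N.

Definition wedge (a b : seq V -> R) : seq V -> R := fun s =>
  \sum_(m : (size s).-tuple bool)
     (-1) ^+ shuffle_inv m * a (mask m s) * b (mask (map negb m) s).

(* w(a, b), for a bivector w at p with components w i j in the standard basis;
   only the degree 1 parts of a and b matter. *)
Definition bivector_eval (w : 'M[R]_n) (a b : seq V -> R) : R :=
  \sum_i \sum_j w i j * a [:: std i] * b [:: std j].

(* The coefficient of h^k in the quantum exterior product, computed in the
   standard basis of the tangent space (the result does not depend on the
   basis); it vanishes for negative k. *)
Definition qwedge_coef (w : 'M[R]_n) (k : int) (a b : seq V -> R) : seq V -> R :=
  if k is Posz m then fun s =>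
    (m`!%:R)^-1 *
    \sum_(I : m.-tuple 'I_n) \sum_(J : m.-tuple 'I_n)
      (\prod_(r < m) w (tnth I r) (tnth J r)) *
      wedge (foldl rcontract a [seq std i | i <- I])
            (foldl lcontract b [seq std j | j <- J]) s
  else fun=> 0.

(** ** Differential forms, bivector fields *)

Definition smooth_form (U : set M) (a : M -> seq V -> R) : Prop :=
  (forall p, U p -> exterior (a p)) /\
  (forall (c : atlas A) (s : seq 'I_n),
     smooth_fun (dom c `&` U)
       (fun p => a p [seq std i *m jac c (chart_at A p) p | i <- s])).

Definition one_form (U : set M) (a : M -> seq V -> R) : Prop :=
  smooth_form U a /\ (forall p s, U p -> size s != 1%N -> a p s = 0).

(* The i-th element of the coframe dual to the frame e, at p. *)
Definition dual_frame (e : 'I_n -> M -> V) (i : 'I_n) (p : M) : seq V -> R :=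
  covector (fun v => (v *m invmx (\matrix_j e j p)) 0 i).

Definition bivector_field (w : M -> 'M[R]_n) : Prop :=
  (forall p, (w p)^T = - w p) /\
  (forall (c : atlas A) (i j : 'I_n),
     smooth_fun (dom c) (fun p =>
       ((jac (chart_at A p) c p)^T *m w p *m jac (chart_at A p) c p) i j)).

(** ** Connections *)

(* [nabla p v Y] is the covariant derivative at p along the tangent vector v of
   a vector field Y defined and smooth near p. *)
Record connection := Connection {
  nabla :> M -> V -> (M -> V) -> V;
  nabla_linear : forall U Y p (x : R) u v, open U -> smooth_vf U Y -> U p ->
    nabla p (x *: u + v) Y = x *: nabla p u Y + nabla p v Y;
  nabla_additive : forall U Y Z p v, open U -> smooth_vf U Y -> smooth_vf U Z ->
    U p -> nabla p v (Y \+ Z) = nabla p v Y + nabla p v Z;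
  nabla_leibniz : forall U f Y p v, open U -> smooth_fun U f -> smooth_vf U Y ->
    U p -> nabla p v (fun q => f q *: Y q) =
           dir_deriv p v f *: Y p + f p *: nabla p v Y;
  nabla_local : forall U Y Z p v, open U -> smooth_vf U Y ->
    (forall q, U q -> Y q = Z q) -> U p -> nabla p v Y = nabla p v Z;
  nabla_smooth : forall U X Y, open U -> smooth_vf U X -> smooth_vf U Y ->
    smooth_vf U (fun p => nabla p (X p) Y) }.

(* nabla_X Y - nabla_Y X = [X, Y], both sides acting on functions. *)
Definition torsion_free (D : connection) : Prop :=
  forall U (X Y : M -> V) (f : M -> R) p, open U ->
    smooth_vf U X -> smooth_vf U Y -> smooth_fun U f -> U p ->
    dir_deriv p (D p (X p) Y - D p (Y p) X) f =
    dir_deriv p (X p) (fun q => dir_deriv q (Y q) f) -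
    dir_deriv p (Y p) (fun q => dir_deriv q (X q) f).

(* The induced connection on forms,
   (nabla_v a)(u_1, .., u_k) =
     v(a(u_1, .., u_k)) - \sum_i a(u_1, .., nabla_v u_i, .., u_k),
   where the tangent vectors u_i are extended to vector fields near p; the
   result does not depend on the extension. *)
Definition nabla_form (D : connection) (p : M) (v : V) (a : M -> seq V -> R) :
  seq V -> R := fun s =>
  dir_deriv p v (fun q => a q [seq ext_vec p u q | u <- s]) -
  \sum_(i < size s) a p (set_nth 0 s i (D p v (ext_vec p (nth 0 s i)))).

(* nabla w = 0, where
   (nabla_v w)(a, b) = v(w(a, b)) - w(nabla_v a, b) - w(a, nabla_v b). *)
Definition preserves (D : connection) (w : M -> 'M[R]_n) : Prop :=
  forall U (a b : M -> seq V -> R) p v, open U ->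
    one_form U a -> one_form U b -> U p ->
    dir_deriv p v (fun q => bivector_eval (w q) (a q) (b q)) -
    bivector_eval (w p) (nabla_form D p v a) (b p) -
    bivector_eval (w p) (a p) (nabla_form D p v b) = 0.

(** ** Forms with coefficients in R[h] and R[h, h^-1] *)

(* a k is the coefficient of h^k. *)
Definition hform := int -> M -> seq V -> R^o.

Definition Omega_laurent (a : hform) : Prop :=
  (forall k, smooth_form setT (a k)) /\
  (exists N : nat, forall k : int, (N < `|k|)%N -> a k = 0).

Definition Omega_poly (a : hform) : Prop :=
  Omega_laurent a /\ (forall k : int, k < 0 -> a k = 0).

Definition hconst (a : M -> seq V -> R) : hform := fun k => if k == 0 then a else 0.

(* h^m a *)
Definition hmul (m : int) (a : hform) : hform := fun k => a (k - m).

(* Total degree d, where h has degree 2. *)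
Definition hdegree (d : int) (a : hform) : Prop :=
  forall k p s, (size s)%:Z != d - 2 * k -> a k p s = 0.

(* The bilinear extension of the quantum exterior product; the sum, over pairs
   of exponents, has finite support for a, b in Omega(M)[h, h^-1]. *)
Definition hwedge (w : M -> 'M[R]_n) (a b : hform) : hform := fun k p s =>
  \sum_(x \in [set: int * int])
    qwedge_coef (w p) (k - x.1 - x.2) (a x.1 p) (b x.2 p) s.

(* D extends the operator a |-> e^i /\_h nabla_(e_i) a on Omega(M). *)
Definition extends_dh (nab : connection) (w : M -> 'M[R]_n)
  (D : hform -> hform) : Prop :=
  forall a : M -> seq V -> R, smooth_form setT a ->
  forall U (e : 'I_n -> M -> V), open U -> local_frame U e ->
  forall k p s, U p ->
    D (hconst a) k p s =
    \sum_i qwedge_coef (w p) k (dual_frame e i p) (nabla_form nab p (e i p) a) s.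

(* Linearity on S over the algebra spanned by the h^m, m in K. *)
Definition hlinear (K : set int) (S : set hform) (D : hform -> hform) : Prop :=
  (forall (x : R) a b, S a -> S b -> D (x *: a + b) = x *: D a + D b) /\
  (forall m a, K m -> S a -> D (hmul m a) = hmul m (D a)).

Definition hderivation (w : M -> 'M[R]_n) (S : set hform)
  (D : hform -> hform) : Prop :=
  forall (d : int) a b, S a -> S b -> hdegree d a ->
    D (hwedge w a b) = hwedge w (D a) b + (-1 : R) ^ d *: hwedge w a (D b).

End Geometry.

(* Main.v *)
Require Import Defs.
From HB Require Import structures.
From mathcomp Require Import all_boot all_order all_algebra.
From mathcomp Require Import all_classical all_reals all_analysis.
From mathcomp Require Import ring lra zify.

(** Write L_i for the quantum product by e^i from the left.  As e^i is a
covector only two terms of the series survive: L_i = e^i /\ + h iota_i, where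
iota_i is the contraction by the vector w(e^i, .) = \sum_j w^{ij} e_j.  Hence
d_h = \sum_i L_i nabla_i, and this formula, applied to each coefficient of a
series in h ([qmul], [dh]), is already the h-linear extension; both operators of
the theorem are restrictions of the same [dh].  It agrees with the given d_h
in every frame because \sum_i e^i (x) e_i does not depend on the frame
([frame_covmul], [dh_extends]).

Algebra of a fibre.  A form is a function on finite sequences of vectors, and
the signed shuffle product satisfies the Leibniz rule
iota_v (a /\ b) = iota_v a /\ b + a' /\ iota_v b, with a' = (-1)^{|a|} a
([contr_wdg]).  Since a form is known once its value on the empty sequence and
its contractions are known, this rule turns identities of forms into
inductions on the length of the argument.  The quantum product is the iterate
of contracting the two factors along w, divided by n! ([cwedge], [qcoef],
[qwedge_coefE]).  Moving e^i inside the n-th iterate produces n times a term of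
the (n-1)-st one, which the n! and the contraction in L_i absorb, so that
L_i (a /\_h b) = (L_i a) /\_h b = a' /\_h (L_i b); the second equality uses the
antisymmetry of w ([qmul_qcoef_left],
[qmul_qcoef_right]).

Derivation property.  Because w is parallel, nabla_i is a derivation of /\_h
([conn_qcoef], [nabla_hwedge]).  Composing with the two rules for L_i and
summing over i gives d_h (a /\_h b) = d_h a /\_h b + a' /\_h d_h b
([dh_derivation]).

Square.  In a chart let Gamma_i be the matrix of nabla_i on the coordinate
fields.  As w is parallel, [nabla_i, L_k] = - \sum_l Gamma_i(l, k) L_l
([conn_qmul]), so
  d_h^2 = \sum_{i,k} L_i L_k nabla_i nabla_k
          - \sum_{i,k,l} Gamma_i(l, k) L_i L_l nabla_k.
The L_i anticommute, again because w is antisymmetric ([qmul_anti]).  The second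
sum therefore vanishes by the symmetry Gamma_i(l, k) = Gamma_l(i, k)
([qmul2_sym_eq0]), and the first is 1/2 \sum L_i L_k [nabla_i, nabla_k]
([qmul2_sum_eq0]).  The commutator is minus the derivation of forms induced by
the curvature R_ik ([conn_comm]).  As R_ik preserves w, the matrix w R_ik is
symmetric, and the derivation is \sum_l L_l iota_(R_ik e_l): the extra
h-terms cancel because contractions anticommute ([der_qmul]).  So d_h^2 is
-1/2 \sum L_i L_k L_l iota_(R_ik e_l); the triple product is invariant under
cyclic permutations, and the first Bianchi identity makes the sum zero
([curvature_qmul_eq0], [local_dh_sq]).

From the manifold to a chart.  The covariant derivative of a form may be
computed with any fields extending its arguments ([nabla_fields_tensorial]), in
particular with coordinate fields, which turns it into d/dx^i - Gamma_i
([local_form_nabla]).  The hypotheses are then evaluated on well chosen objects.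
Torsion-freeness for coordinate fields acting on coordinate functions gives
the symmetry of Gamma ([christoffel_sym]); acting on arbitrary functions it
then gives the symmetry of second derivatives ([schwarz_chart]).
Parallelism of w tested on the coordinate coframe gives the matrix equation
d_k w + w Gamma_k + Gamma_k^T w = 0 ([parallel_chart]). *)

Set Implicit Arguments.
Unset Strict Implicit.
Unset Printing Implicit Defensive.
Import Order.TTheory GRing.Theory Num.Theory.
Import numFieldNormedType.Exports.
Local Open Scope classical_set_scope.
Local Open Scope ring_scope.

(** * Contraction, exterior multiplication and wedge of exterior forms *)

Section Fiber.
Context (R : realType) (n : nat).
Local Notation V := 'rV[R]_n.
Local Notation form := (seq V -> R^o).
Implicit Types (a b : form) (u v : V) (l : V -> R) (s t : seq V).

Lemma formD a b s : (a + b) s = a s + b s. Proof. by []. Qed.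
Lemma formN a s : (- a) s = - a s. Proof. by []. Qed.
Lemma formZ x a s : (x *: a) s = x * a s. Proof. by []. Qed.
Lemma form0 s : (0 : form) s = 0. Proof. by []. Qed.
Lemma form_sum I (r : seq I) (P : pred I) (F : I -> form) s :
  (\sum_(i <- r | P i) F i) s = \sum_(i <- r | P i) F i s.
Proof. by rewrite fct_sumE. Qed.
Definition formE := (formD, formN, formZ, form0, form_sum).

Definition contr v a : form := fun s => a (v :: s).

(** The grading involution, (-1)^p on forms of degree p. *)
Definition grinv a : form := fun s => (-1) ^+ size s * a s.

(** The product l /\ a ([wdg_covector]), defined by its contractions
iota_v (l /\ a) = l(v) a - l /\ iota_v a. *)
Fixpoint covmul l a s : R^o :=
  if s is v :: s' then l v * a s' - covmul l (contr v a) s' else 0.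

(** [wedge] with values in a type carrying a vector space structure, so that linear
algebra applies to it. *)
Definition wdg a b : form := wedge a b.

Lemma wdg_nil a b : wdg a b [::] = a [::] * b [::].
Proof.
rewrite /wdg /wedge /= (bigD1 [tuple]) //= big1 => [|m]; last by rewrite tuple0.
by rewrite /= addr0 expr0 mul1r.
Qed.

Lemma big_tuple_cons (S : finType) (m : nat) (F : m.+1.-tuple S -> R) :
  \sum_(t : m.+1.-tuple S) F t =
  \sum_(x : S) \sum_(t : m.-tuple S) F (cons_tuple x t).
Proof.
rewrite pair_big /= (reindex (fun p : S * m.-tuple S => cons_tuple p.1 p.2)) //=.
exists (fun t : m.+1.-tuple S => (thead t, [tuple of behead t])) => [[x t] _|t _] /=.
  by congr pair; apply: val_inj.
by rewrite [RHS]tuple_eta; apply: val_inj.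
Qed.

(** The first bit of a shuffle tells which factor receives v.  If it is the right
one, v has jumped over all the arguments of the left factor; this is the sign of
[grinv]. *)
Lemma contr_wdg a b v :
  contr v (wdg a b) = wdg (contr v a) b + wdg (grinv a) (contr v b).
Proof.
apply/funext => s; rewrite /contr {1}/wdg /wedge /= big_tuple_cons /= big_bool /=.
rewrite formE /wdg /wedge; congr (_ + _).
apply: eq_bigr => t _; rewrite /= exprD /grinv size_mask ?size_map ?size_tuple//.
by ring.
Qed.

Lemma covmul_is_linear l : linear (covmul l : form -> form).
Proof.
move=> x a b; apply/funext => s.
elim: s a b => [|v s IHs] a b /=; first by rewrite !formE /= mulr0 addr0.
have -> : contr v (x *: a + b) = x *: contr v a + contr v b by [].
rewrite IHs !formE /=; ring.
Qed.
HB.instance Definition _ l :=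
  GRing.isLinear.Build R form form *:%R (covmul l) (covmul_is_linear l).

HB.instance Definition _ v :=
  GRing.isLinear.Build R form form *:%R (contr v) (fun _ _ _ => erefl).

Lemma grinv_is_linear : linear (grinv : form -> form).
Proof. by move=> x a b; apply/funext => s; rewrite /grinv !formE /= mulrDr mulrCA. Qed.
HB.instance Definition _ :=
  GRing.isLinear.Build R form form *:%R grinv grinv_is_linear.

Lemma covmul0 l : covmul l 0 = 0. Proof. exact: linear0. Qed.
Lemma covmulD l a b : covmul l (a + b) = covmul l a + covmul l b. Proof. exact: linearD. Qed.
Lemma covmulN l a : covmul l (- a) = - covmul l a. Proof. exact: linearN. Qed.
Lemma covmulZ l x a : covmul l (x *: a) = x *: covmul l a. Proof. exact: linearZ. Qed.
Lemma covmul_sum l I (r : seq I) (P : pred I) (F : I -> form) :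
  covmul l (\sum_(i <- r | P i) F i) = \sum_(i <- r | P i) covmul l (F i).
Proof. exact: linear_sum. Qed.

Lemma grinv0 : grinv 0 = 0. Proof. exact: linear0. Qed.
Lemma grinvD a b : grinv (a + b) = grinv a + grinv b. Proof. exact: linearD. Qed.
Lemma grinvN a : grinv (- a) = - grinv a. Proof. exact: linearN. Qed.
Lemma grinvZ x a : grinv (x *: a) = x *: grinv a. Proof. exact: linearZ. Qed.
Lemma grinv_sum I (r : seq I) (P : pred I) (F : I -> form) :
  grinv (\sum_(i <- r | P i) F i) = \sum_(i <- r | P i) grinv (F i).
Proof. exact: linear_sum. Qed.

Lemma contr0 v : contr v 0 = 0. Proof. exact: linear0. Qed.
Lemma contrD v a b : contr v (a + b) = contr v a + contr v b. Proof. exact: linearD. Qed.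
Lemma contrN v a : contr v (- a) = - contr v a. Proof. exact: linearN. Qed.
Lemma contrZ v x a : contr v (x *: a) = x *: contr v a. Proof. exact: linearZ. Qed.
Lemma contr_sum v I (r : seq I) (P : pred I) (F : I -> form) :
  contr v (\sum_(i <- r | P i) F i) = \sum_(i <- r | P i) contr v (F i).
Proof. exact: linear_sum. Qed.

Definition linE := (covmul0, covmulD, covmulN, covmulZ, grinv0, grinvD, grinvN, grinvZ, contr0, contrD, contrN, contrZ).

Lemma grinvK a : grinv (grinv a) = a.
Proof. by apply/funext => s; rewrite /grinv mulrA -expr2 sqrr_sign mul1r. Qed.

Lemma contr_grinv v a : contr v (grinv a) = - grinv (contr v a).
Proof. by apply/funext => s; rewrite /grinv /contr /= exprS mulN1r mulNr. Qed.

Lemma contr_covmul v l a : contr v (covmul l a) = l v *: a - covmul l (contr v a).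
Proof. by []. Qed.

Lemma grinv_covmul l a : grinv (covmul l a) = - covmul l (grinv a).
Proof.
apply/funext => s; elim: s a => [|v s IHs] a; first by rewrite formE /grinv /= mulr0 oppr0.
rewrite -[LHS]/(contr v (grinv (covmul l a)) s) -[RHS]/(contr v (- covmul l (grinv a)) s).
rewrite contr_grinv contrN !contr_covmul contr_grinv !linE.
by rewrite !formE IHs formE; ring.
Qed.

Lemma covmul_anti l l' a : covmul l (covmul l' a) = - covmul l' (covmul l a).
Proof.
apply/funext => s; elim: s a => [|v s IHs] a; first by rewrite formE /= oppr0.
rewrite !formE /= !contr_covmul !linE !formE IHs formE; ring.
Qed.

Lemma wdgDl a a' b : wdg (a + a') b = wdg a b + wdg a' b.
Proof.
by apply/funext => s; rewrite !formE /wdg /wedge -big_split/=; apply: eq_bigr => t _;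
  rewrite !formE; ring.
Qed.
Lemma wdgDr a b b' : wdg a (b + b') = wdg a b + wdg a b'.
Proof.
by apply/funext => s; rewrite !formE /wdg /wedge -big_split/=; apply: eq_bigr => t _;
  rewrite !formE; ring.
Qed.
Lemma wdgZl x a b : wdg (x *: a) b = x *: (wdg a b : form).
Proof.
by apply/funext => s; rewrite !formE /wdg /wedge mulr_sumr; apply: eq_bigr => t _;
  rewrite !formE; ring.
Qed.
Lemma wdgZr x a b : wdg a (x *: b) = x *: (wdg a b : form).
Proof.
by apply/funext => s; rewrite !formE /wdg /wedge mulr_sumr; apply: eq_bigr => t _;
  rewrite !formE; ring.
Qed.

Lemma wdg_covector l a : wdg (covector l) a = covmul l a.
Proof.
apply/funext => s; elim: s a => [|v s IHs] a; first by rewrite wdg_nil mul0r.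
rewrite -[wdg _ _ _]/(contr v (wdg (covector l) a) s) contr_wdg.
have -> : grinv (covector l) = (-1) *: covector l.
  by apply/funext => -[|x [|y t]]; rewrite /grinv !formE /= ?mulr0 // expr1.
rewrite wdgZl scaleN1r !formE IHs /=; congr (_ - _).
elim: s {IHs} (a) => [|u s IH] c; first by rewrite wdg_nil.
rewrite -[wdg _ _ _]/(contr u (wdg (contr v (covector l)) c) s) contr_wdg.
have -> : contr u (contr v (covector l)) = 0 *: 0 by apply/funext => x; rewrite formE mul0r.
have -> : grinv (contr v (covector l)) = contr v (covector l).
  by apply/funext => -[|x t]; rewrite /grinv /contr /= ?mul1r ?mulr0.
by rewrite wdgZl scale0r add0r.
Qed.

Lemma contr_exterior v a : exterior a -> exterior (contr v a).
Proof.
by move=> [lin alt]; split=> [s t x u u'|s t r u]; [apply: (lin (v :: s))|apply: (alt (v :: s))].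
Qed.

Lemma contr_lin x u v a : exterior a -> contr (x *: u + v) a = x *: contr u a + contr v a.
Proof. by move=> [lin _]; apply/funext => s; rewrite !formE; apply: (lin [::]). Qed.

Lemma contr_vsum I (r : seq I) (P : pred I) (c : I -> R) (F : I -> V) a :
  exterior a ->
  contr (\sum_(i <- r | P i) c i *: F i) a = \sum_(i <- r | P i) c i *: contr (F i) a.
Proof.
move=> ea; elim/big_rec2: _ => [|i y1 y2 _ <-]; last exact: contr_lin.
by have := contr_lin (-1) 0 0 ea; rewrite scaler0 addr0 scaleN1r addNr.
Qed.

Lemma vec_std v : v = \sum_i v 0 i *: std R i.
Proof. exact: row_sum_delta. Qed.

Lemma contr_std v a : exterior a -> contr v a = \sum_i v 0 i *: contr (std R i) a.
Proof. by move=> ea; rewrite {1}[v]vec_std contr_vsum. Qed.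

Lemma contr_alt u a : exterior a -> contr u (contr u a) = 0.
Proof. by move=> [_ alt]; apply/funext => s; apply: (alt [::] [::]). Qed.

Lemma contr_anti u v a : exterior a -> contr u (contr v a) = - contr v (contr u a).
Proof.
move=> ea; have eu := contr_exterior u ea; have ev := contr_exterior v ea.
have := contr_alt (1 *: u + v) ea; rewrite (contr_lin _ _ _ ea) contrD contrZ.
rewrite !(contr_lin _ _ _ eu) !(contr_lin _ _ _ ev).
rewrite !contr_alt // !scale1r addr0 add0r => /eqP; rewrite addrC addr_eq0 => /eqP; apply.
Qed.

Lemma exterior_lin x a b : exterior a -> exterior b -> exterior (x *: a + b).
Proof.
move=> [la aa] [lb ab]; split=> [s t y u v|s t r u]; rewrite !formE.
  by rewrite la lb; ring.
by rewrite aa ab mulr0 addr0.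
Qed.

Lemma exterior0 : exterior (0 : form).
Proof. by split=> *; rewrite !formE // mulr0 addr0. Qed.

Lemma exteriorZ x a : exterior a -> exterior (x *: a).
Proof. by move=> ea; rewrite -[_ *: _]addr0; apply/exterior_lin/exterior0. Qed.

Lemma exteriorD a b : exterior a -> exterior b -> exterior (a + b).
Proof. by move=> ea; rewrite -[a]scale1r; apply/exterior_lin. Qed.

Lemma exteriorN a : exterior a -> exterior (- a).
Proof. by rewrite -scaleN1r; apply: exteriorZ. Qed.

Lemma exterior_sum I (r : seq I) (P : pred I) (F : I -> form) :
  (forall i, P i -> exterior (F i)) -> exterior (\sum_(i <- r | P i) F i).
Proof. by move=> h; elim/big_ind: _ => //; [apply: exterior0|apply: exteriorD]. Qed.

Lemma exterior_grinv a : exterior a -> exterior (grinv a).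
Proof.
move=> [la aa]; split=> [s t x u v|s t r u]; rewrite /grinv ?aa ?mulr0//.
by rewrite la !size_cat /=; ring.
Qed.

Definition scal_lin l := forall x u v, l (x *: u + v) = x * l u + l v.

(** Alternation is proved by moving the first of the two equal vectors to
the right, one place at a time, until they are adjacent. *)
Lemma exterior_covmul l a : scal_lin l -> exterior a -> exterior (covmul l a).
Proof.
move=> ll; split=> s.
  elim: s a H => [|v s IHs] a ea t x u v'; last first.
    by rewrite /= IHs ?(proj1 ea); [ring|apply: contr_exterior].
  by rewrite /= ll contr_lin // !linE !formE; ring.
elim: s a H => [|v s IHs] a ea t r u; last first.
  by rewrite /= IHs ?(proj2 ea) ?mulr0 ?subr0 //; apply: contr_exterior.
elim: t a ea => [|v t IHt] a ea.
  rewrite -[LHS]/(contr u (contr u (covmul l a)) r) !contr_covmul !linE !contr_covmul contr_alt //.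
  by rewrite !linE subr0 subrr.
rewrite -[LHS]/(contr v (contr u (covmul l a)) (t ++ u :: r)).
have -> : contr v (contr u (covmul l a)) = - contr u (contr v (covmul l a)).
  rewrite !contr_covmul !linE !contr_covmul contr_anti // !linE.
  by rewrite opprK opprB opprD addrA addrAC.
rewrite formN -[contr _ _ _]/(contr v (covmul l a) (u :: t ++ u :: r)) contr_covmul.
rewrite !formE IHt; last exact: contr_exterior.
by rewrite (proj2 ea [::] t) mulr0 subr0 oppr0.
Qed.
End Fiber.

(** * The derivation of forms induced by an endomorphism *)

Section FiberDerivation.
Context (R : realType) (n : nat).
Local Notation V := 'rV[R]_n.
Local Notation form := (seq V -> R^o).
Local Notation e_ := (std R).
Implicit Types (a b : form) (u v : V) (l : V -> R) (s t : seq V).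
Implicit Types (g : V -> V).

Lemma wdg0l b : wdg 0 b = 0.
Proof. by have := wdgZl 0 0 b; rewrite !scale0r. Qed.
(** The derivation of forms induced by g, without the sign of the dual action:
g acts on each argument in turn. *)
Definition der g a : form := fun s =>
  \sum_(i < size s) a (set_nth 0 s i (g (nth 0 s i))).

Lemma der_nil g a : der g a [::] = 0.
Proof. by rewrite /der big_ord0. Qed.

Lemma contr_der g v a : contr v (der g a) = contr (g v) a + der g (contr v a).
Proof. by apply/funext => s; rewrite formD /contr /der /= big_ord_recl. Qed.

Lemma der_cons g v a s : der g a (v :: s) = a (g v :: s) + der g (contr v a) s.
Proof. by rewrite -[LHS]/(contr v (der g a) s) contr_der. Qed.

Lemma der_is_linear g : linear (der g : form -> form).
Proof.
move=> x a b; apply/funext => s; rewrite !formE /der mulr_sumr -big_split.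
by apply: eq_bigr => i _; rewrite !formE.
Qed.
HB.instance Definition _ g :=
  GRing.isLinear.Build R form form *:%R (der g) (der_is_linear g).

Lemma der0 g : der g 0 = 0. Proof. exact: linear0. Qed.
Lemma derD g a b : der g (a + b) = der g a + der g b. Proof. exact: linearD. Qed.
Lemma derN g a : der g (- a) = - der g a. Proof. exact: linearN. Qed.
Lemma derZ g x a : der g (x *: a) = x *: der g a. Proof. exact: linearZ. Qed.
Lemma der_sum g I (r : seq I) (P : pred I) (F : I -> form) :
  der g (\sum_(i <- r | P i) F i) = \sum_(i <- r | P i) der g (F i).
Proof. exact: linear_sum. Qed.

Lemma grinv_der g a : grinv (der g a) = der g (grinv a).
Proof.
apply/funext => s; elim: s a => [|v s IHs] a; first by rewrite /grinv !der_nil mulr0.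
by rewrite -[LHS]/(contr v (grinv (der g a)) s) contr_grinv contr_der linE formN formD IHs
  der_cons contr_grinv derN formN opprD /grinv /= exprS; congr (_ + _); rewrite mulN1r mulNr.
Qed.

Lemma der_wdg g a b : der g (wdg a b) = wdg (der g a) b + wdg a (der g b).
Proof.
apply/funext => s; elim: s a b => [|v s IHs] a b.
  by rewrite formD !wdg_nil !der_nil mul0r mulr0 addr0.
rewrite -[LHS]/(contr v (der g (wdg a b)) s) -[RHS]/(contr v (_ + _) s).
rewrite contr_der contrD !contr_wdg derD !contr_der wdgDl wdgDr !formD !IHs grinv_der.
by rewrite !formD; ring.
Qed.

(** The coordinate p is sent to its composition with g, which is
\sum_l G l p times the coordinate l. *)
Lemma der_covmul_crd g G p a : (forall u, g u = u *m G) ->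
  der g (covmul (fun v => v 0 p) a) =
  covmul (fun v => v 0 p) (der g a) + \sum_l G l p *: covmul (fun v => v 0 l) a.
Proof.
move=> gG; apply/funext => s; elim: s a => [|v s IHs] a.
  rewrite formD der_nil /= form_sum big1 ?addr0 // => i _.
  by rewrite formZ /= mulr0.
rewrite der_cons contr_covmul derD derN derZ formD formD formN formZ IHs formD.
rewrite [X in _ = X + _]/= contr_der covmulD formD [X in X + _ = _]/= gG mxE !form_sum.
have -> : \sum_i (G i p *: covmul (fun u => u 0 i) a) (v :: s) =
  (\sum_i v 0 i * G i p) * a s - \sum_i (G i p *: covmul (fun u => u 0 i) (contr v a)) s.
  by rewrite mulr_suml -sumrB; apply: eq_bigr => i _; rewrite !formZ /=; ring.
by ring.
Qed.

Lemma vec_mul v (G : 'M[R]_n) : v *m G = \sum_i v 0 i *: (e_ i *m G).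
Proof.
by rewrite {1}[v]vec_std mulmx_suml; apply: eq_bigr => i _; rewrite scalemxAl.
Qed.

(** G is \sum_l (e^l) (x) (e_l G), and a rank one endomorphism l (x) u acts as
l /\ iota_u. *)
Lemma der_expand G a : exterior a ->
  der (mulmx^~ G) a = \sum_l covmul (fun v => v 0 l) (contr (e_ l *m G) a).
Proof.
move=> ea; apply/funext => s; elim: s a ea => [|v s IHs] a ea.
  by rewrite der_nil form_sum big1.
rewrite der_cons form_sum IHs; last exact: contr_exterior.
under [RHS]eq_bigr => i _ do rewrite /= contr_anti // linE formN opprK.
rewrite big_split /= form_sum; congr (_ + _).
by rewrite -[LHS]/(contr (v *m G) a s) vec_mul contr_vsum // form_sum; apply: eq_bigr.
Qed.

Lemma scal_lin_crd (i : 'I_n) : scal_lin (fun v : V => v 0 i).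
Proof. by move=> x u v; rewrite !mxE. Qed.

Lemma exterior_der G a : exterior a -> exterior (der (mulmx^~ G) a).
Proof.
move=> ea; rewrite der_expand //; apply: exterior_sum => i _.
by apply: exterior_covmul; [apply: scal_lin_crd|apply: contr_exterior].
Qed.

(** Terms in which G and H act on different arguments cancel.  Row vectors are
acted on from the right, hence the order of the matrices. *)
Lemma der_comm G H a : exterior a ->
  der (mulmx^~ G) (der (mulmx^~ H) a) - der (mulmx^~ H) (der (mulmx^~ G) a) =
  der (mulmx^~ (G *m H - H *m G)) a.
Proof.
move=> ea; apply/funext => s; elim: s a ea => [|v s IHs] a ea.
  by rewrite formD formN !der_nil subr0.
rewrite formD formN !der_cons !contr_der !derD !formD -(IHs (contr v a)); last exact: contr_exterior.
have -> : a (v *m (G *m H - H *m G) :: s) = a (v *m G *m H :: s) - a (v *m H *m G :: s).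
  rewrite mulmxBr !mulmxA -[LHS]/(contr (_ - _) a s) -scaleN1r addrC contr_lin //.
  by rewrite !formE /contr; ring.
by rewrite !formE; ring.
Qed.

End FiberDerivation.

(** * The wedge product contracted along a bivector *)

Section ContractedWedge.
Context (R : realType) (n : nat).
Local Notation V := 'rV[R]_n.
Local Notation form := (seq V -> R^o).
Local Notation e_ := (std R).
Implicit Types (a b : form) (u v : V) (l : V -> R) (s t : seq V).
Implicit Types (g : V -> V).

(** The sum over m index pairs, unfolded by its first pair, without the factor 1/m!.
On exterior forms the contraction into the last slot is [grinv] of the contraction
into the first ([rcontractE]). *)
Fixpoint cwedge (w : 'M[R]_n) (m : nat) a b : form :=
  if m is m'.+1 then
    \sum_i \sum_j w i j *: cwedge w m' (grinv (contr (e_ i) a)) (contr (e_ j) b)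
  else wdg a b.

Lemma cwedge_linl w m x a a' b : cwedge w m (x *: a + a') b = x *: cwedge w m a b + cwedge w m a' b.
Proof.
elim: m a a' b => [|m IHm] a a' b /=; first by rewrite wdgDl wdgZl.
rewrite scaler_sumr -big_split /=; apply: eq_bigr => i _.
rewrite scaler_sumr -big_split /=; apply: eq_bigr => j _.
by rewrite !linE IHm scalerDr !scalerA mulrC.
Qed.

Lemma cwedge_linr w m x a b b' : cwedge w m a (x *: b + b') = x *: cwedge w m a b + cwedge w m a b'.
Proof.
elim: m a b b' => [|m IHm] a b b' /=; first by rewrite wdgDr wdgZr.
rewrite scaler_sumr -big_split /=; apply: eq_bigr => i _.
rewrite scaler_sumr -big_split /=; apply: eq_bigr => j _.
by rewrite !linE IHm scalerDr !scalerA mulrC.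
Qed.

Lemma cwedge0l w m b : cwedge w m 0 b = 0.
Proof. by have := cwedge_linl w m (-1) 0 0 b; rewrite scaler0 addr0 scaleN1r addNr. Qed.
Lemma cwedge0r w m a : cwedge w m a 0 = 0.
Proof. by have := cwedge_linr w m (-1) a 0 0; rewrite scaler0 addr0 scaleN1r addNr. Qed.
Lemma cwedgeDl w m a a' b : cwedge w m (a + a') b = cwedge w m a b + cwedge w m a' b.
Proof. by have := cwedge_linl w m 1 a a' b; rewrite !scale1r. Qed.
Lemma cwedgeDr w m a b b' : cwedge w m a (b + b') = cwedge w m a b + cwedge w m a b'.
Proof. by have := cwedge_linr w m 1 a b b'; rewrite !scale1r. Qed.
Lemma cwedgeZl w m x a b : cwedge w m (x *: a) b = x *: cwedge w m a b.
Proof. by have := cwedge_linl w m x a 0 b; rewrite cwedge0l !addr0. Qed.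
Lemma cwedgeZr w m x a b : cwedge w m a (x *: b) = x *: cwedge w m a b.
Proof. by have := cwedge_linr w m x a b 0; rewrite cwedge0r !addr0. Qed.
Lemma cwedgeNl w m a b : cwedge w m (- a) b = - cwedge w m a b.
Proof. by rewrite -scaleN1r cwedgeZl scaleN1r. Qed.
Lemma cwedgeNr w m a b : cwedge w m a (- b) = - cwedge w m a b.
Proof. by rewrite -scaleN1r cwedgeZr scaleN1r. Qed.
Lemma cwedge_suml w m I (r : seq I) (P : pred I) (F : I -> form) b :
  cwedge w m (\sum_(i <- r | P i) F i) b = \sum_(i <- r | P i) cwedge w m (F i) b.
Proof. by elim/big_rec2: _ => [|i y1 y2 _ <-]; rewrite ?cwedge0l ?cwedgeDl. Qed.
Lemma cwedge_sumr w m I (r : seq I) (P : pred I) (F : I -> form) a :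
  cwedge w m a (\sum_(i <- r | P i) F i) = \sum_(i <- r | P i) cwedge w m a (F i).
Proof. by elim/big_rec2: _ => [|i y1 y2 _ <-]; rewrite ?cwedge0r ?cwedgeDr. Qed.

(** Contractions anticommute and [grinv] anticommutes with them, so each pair
w^{ij} iota_i (x) iota_j passes through the Leibniz rule of [contr_wdg]. *)
Lemma contr_cwedge w m u a b : exterior a -> exterior b ->
  contr u (cwedge w m a b) = cwedge w m (contr u a) b + cwedge w m (grinv a) (contr u b).
Proof.
elim: m a b => [|m IHm] a b ea eb /=; first by rewrite contr_wdg.
rewrite contr_sum -big_split /=; apply: eq_bigr => i _.
rewrite contr_sum -big_split /=; apply: eq_bigr => j _.
rewrite contrZ IHm; [|exact/exterior_grinv/contr_exterior|exact: contr_exterior].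
rewrite contr_grinv contr_anti // grinvN opprK scalerDr; congr (_ + _ *: _).
by rewrite (contr_anti _ _ eb) contr_grinv grinvN cwedgeNl cwedgeNr.
Qed.

(** Exterior multiplication by the coordinate covector e^p. *)
Definition emul (p : 'I_n) a := covmul (fun v => v 0 p) a.

Lemma wdgNl a b : wdg (- a) b = - wdg a b.
Proof. by rewrite -scaleN1r wdgZl scaleN1r. Qed.
Lemma wdgNr a b : wdg a (- b) = - wdg a b.
Proof. by rewrite -scaleN1r wdgZr scaleN1r. Qed.

Lemma covmul_wdgl l a b : covmul l (wdg a b) = wdg (covmul l a) b.
Proof.
apply/funext => s; elim: s a b => [|v s IHs] a b; first by rewrite wdg_nil /= mul0r.
rewrite -[RHS]/(contr v (wdg (covmul l a) b) s) contr_wdg contr_covmul grinv_covmul /= contr_wdg.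
by rewrite wdgDl wdgZl !wdgNl covmulD !formE !IHs; ring.
Qed.

Lemma covmul_wdgr l a b : covmul l (wdg a b) = wdg (grinv a) (covmul l b).
Proof.
apply/funext => s; elim: s a b => [|v s IHs] a b; first by rewrite wdg_nil /= mulr0.
rewrite -[RHS]/(contr v (wdg _ _) s) contr_wdg contr_covmul contr_grinv grinvK /= contr_wdg.
by rewrite wdgDr wdgZr !wdgNr wdgNl covmulD !formE !IHs grinvK; ring.
Qed.

Lemma std_crd (i p : 'I_n) : e_ i 0 p = (i == p)%:R.
Proof. by rewrite /std mxE eqxx eq_sym. Qed.

Lemma emul_contr (p i : 'I_n) a : emul p (contr (e_ i) a) = (i == p)%:R *: a - contr (e_ i) (emul p a).
Proof.
by rewrite /emul contr_covmul std_crd opprB addrC subrK.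
Qed.

Lemma sum2B (w : 'M[R]_n) (A B : 'I_n -> 'I_n -> form) :
  \sum_i \sum_j w i j *: (A i j - B i j) =
  \sum_i \sum_j w i j *: A i j - \sum_i \sum_j w i j *: B i j.
Proof.
rewrite -sumrB; apply: eq_bigr => i _; rewrite -sumrB; apply: eq_bigr => j _.
exact: scalerBr.
Qed.

Lemma sum2D (w : 'M[R]_n) (A B : 'I_n -> 'I_n -> form) :
  \sum_i \sum_j w i j *: (A i j + B i j) =
  \sum_i \sum_j w i j *: A i j + \sum_i \sum_j w i j *: B i j.
Proof.
rewrite -big_split; apply: eq_bigr => i _; rewrite -big_split; apply: eq_bigr => j _.
exact: scalerDr.
Qed.

Lemma sum2Z (w : 'M[R]_n) x (A : 'I_n -> 'I_n -> form) :
  \sum_i \sum_j w i j *: (x *: A i j) = x *: \sum_i \sum_j w i j *: A i j.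
Proof.
rewrite scaler_sumr; apply: eq_bigr => i _; rewrite scaler_sumr; apply: eq_bigr => j _.
by rewrite !scalerA mulrC.
Qed.

Lemma sum2_exchange (w : 'M[R]_n) (c : 'I_n -> R) (A : 'I_n -> 'I_n -> 'I_n -> form) :
  \sum_i \sum_j w i j *: (\sum_k c k *: A k i j) =
  \sum_k c k *: \sum_i \sum_j w i j *: A k i j.
Proof.
transitivity (\sum_k \sum_i \sum_j w i j *: (c k *: A k i j)); last first.
  by apply: eq_bigr => k _; rewrite sum2Z.
rewrite [RHS]exchange_big; apply: eq_bigr => i _.
rewrite [RHS]exchange_big; apply: eq_bigr => j _; exact: scaler_sumr.
Qed.

(** Commuting e^p with the contraction iota_i of one index pair leaves
delta_{ip}, that is, a row of w contracted into b; each of the m pairs contributes the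
same term. *)
Lemma emul_cwedgel w m p a b : exterior b ->
  emul p (cwedge w m a b) = cwedge w m (emul p a) b -
    m%:R *: \sum_j w p j *: cwedge w m.-1 (grinv a) (contr (e_ j) b).
Proof.
elim: m a b => [|m IHm] a b eb /=; first by rewrite scale0r subr0 -covmul_wdgl.
rewrite /emul covmul_sum -/(emul p a).
have Eb i : emul p (grinv (contr (e_ i) a)) = grinv (contr (e_ i) (emul p a)) - (i == p)%:R *: grinv a.
  by rewrite /emul -[LHS]opprK -grinv_covmul -/(emul p _) emul_contr !linE opprB.
transitivity (\sum_i \sum_j w i j *: (cwedge w m (grinv (contr (e_ i) (emul p a))) (contr (e_ j) b)
   - (i == p)%:R *: cwedge w m (grinv a) (contr (e_ j) b)
   - m%:R *: \sum_k w p k *: cwedge w m.-1 (contr (e_ i) a) (contr (e_ k) (contr (e_ j) b)))).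
  apply: eq_bigr => i _; rewrite covmul_sum; apply: eq_bigr => j _.
  rewrite covmulZ -/(emul p _) IHm; last exact: contr_exterior.
  by rewrite Eb grinvK cwedgeDl cwedgeNl cwedgeZl.
(* the commutators of e^p with the split off pair *)
have delta (F : 'I_n -> form) : \sum_i (i == p)%:R *: F i = F p.
  rewrite (bigD1 p) //= eqxx scale1r big1 ?addr0 // => i /negbTE ->.
  by rewrite scale0r.
have {}delta : \sum_i \sum_j w i j *: ((i == p)%:R *: cwedge w m (grinv a) (contr (e_ j) b)) =
    \sum_j w p j *: cwedge w m (grinv a) (contr (e_ j) b).
  rewrite -[RHS](delta (fun i => \sum_j w i j *: cwedge w m (grinv a) (contr (e_ j) b))).
  apply: eq_bigr => i _; rewrite scaler_sumr; apply: eq_bigr => j _.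
  by rewrite !scalerA mulrC.
(* the m error terms of the inner product have the form of the one just found *)
have swap : \sum_i \sum_j w i j *: (m%:R *: \sum_k w p k *:
      cwedge w m.-1 (contr (e_ i) a) (contr (e_ k) (contr (e_ j) b))) =
    m%:R *: \sum_k w p k *: cwedge w m (grinv a) (contr (e_ k) b).
  case: m {IHm delta} => [|m].
    by rewrite sum2Z !scale0r.
  rewrite sum2Z sum2_exchange /=; congr (_ *: _); apply: eq_bigr => k _.
  congr (_ *: _); apply: eq_bigr => i _; apply: eq_bigr => j _.
  by rewrite contr_grinv grinvN grinvK (contr_anti _ _ eb) cwedgeNr cwedgeNl.
rewrite !sum2B delta swap -addrA -opprD -[X in _ - (X + _)]scale1r -scalerDl.
by rewrite nat1r.
Qed.

(** As in [emul_cwedgel], but the commutator now arises on the right factor and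
selects a column of w; antisymmetry turns it into a row. *)
Lemma emul_cwedger w m p a b : w^T = - w -> exterior a -> exterior b ->
  emul p (cwedge w m a b) = cwedge w m (grinv a) (emul p b) -
    m%:R *: \sum_j w p j *: cwedge w m.-1 (contr (e_ j) a) b.
Proof.
move=> wT; elim: m a b => [|m IHm] a b ea eb /=; first by rewrite scale0r subr0 -covmul_wdgr.
have w_anti i : w i p = - w p i by have /matrixP/(_ p i) := wT; rewrite !mxE.
rewrite /emul covmul_sum -/(emul p b).
transitivity (\sum_i \sum_j w i j *: (cwedge w m (grinv (contr (e_ i) (grinv a))) (contr (e_ j) (emul p b))
   + (j == p)%:R *: cwedge w m (contr (e_ i) a) b
   - m%:R *: \sum_k w p k *: cwedge w m.-1 (grinv (contr (e_ i) (contr (e_ k) a))) (contr (e_ j) b))).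
  apply: eq_bigr => i _; rewrite covmul_sum; apply: eq_bigr => j _.
  rewrite covmulZ -/(emul p _) IHm; [|exact/exterior_grinv/contr_exterior|exact: contr_exterior].
  rewrite emul_contr cwedgeDr cwedgeNr cwedgeZr grinvK contr_grinv grinvN cwedgeNl grinvK.
  under eq_bigr do rewrite contr_grinv contr_anti // grinvN opprK.
  by rewrite [X in _ *: (X - _)]addrC.
have delta (F : 'I_n -> form) : \sum_j (j == p)%:R *: F j = F p.
  rewrite (bigD1 p) //= eqxx scale1r big1 ?addr0 // => i /negbTE ->.
  by rewrite scale0r.
have {}delta : \sum_i \sum_j w i j *: ((j == p)%:R *: cwedge w m (contr (e_ i) a) b) =
    - \sum_i w p i *: cwedge w m (contr (e_ i) a) b.
  rewrite -sumrN; apply: eq_bigr => i _.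
  under eq_bigr do rewrite scalerA mulrC -scalerA.
  by rewrite (delta (fun j => w i j *: cwedge w m (contr (e_ i) a) b)) w_anti scaleNr.
have swap : \sum_i \sum_j w i j *: (m%:R *: \sum_k w p k *:
      cwedge w m.-1 (grinv (contr (e_ i) (contr (e_ k) a))) (contr (e_ j) b)) =
    m%:R *: \sum_k w p k *: cwedge w m (contr (e_ k) a) b.
  case: m {IHm delta} => [|m].
    by rewrite sum2Z !scale0r.
  by rewrite sum2Z sum2_exchange.
rewrite sum2B sum2D delta swap -addrA -opprD -[X in _ - (X + _)]scale1r -scalerDl.
by rewrite nat1r.
Qed.

End ContractedWedge.

(** * Coefficients of the quantum product and their naturality *)

Section QuantumCoefficient.
Context (R : realType) (n : nat).
Local Notation V := 'rV[R]_n.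
Local Notation form := (seq V -> R^o).
Local Notation e_ := (std R).
Implicit Types (a b : form) (u v : V) (l : V -> R) (s t : seq V).
Implicit Types (g : V -> V) (w : 'M[R]_n).

(** The coefficient of h^k as an iterated contraction; it agrees with [qwedge_coef] on
exterior forms ([qwedge_coefE]). *)
Definition qcoef w (k : int) a b : form :=
  if k is Posz m then (m`!%:R)^-1 *: cwedge w m a b else 0.

Lemma invfact_step (m : nat) : (m`!%:R : R)^-1 = (m.+1)`!%:R^-1 * m.+1%:R.
Proof.
rewrite factS natrM invfM mulrC mulrA divff ?mul1r //.
Qed.

(** The contraction of /\_h by the row of w obeys the Leibniz rule; its part
acting on b cancels the error term of [emul_cwedgel], since m / m! = 1 / (m-1)!. *)
Lemma emul_qcoef_left w k p a b : exterior a -> exterior b ->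
  emul p (qcoef w k a b) + \sum_j w p j *: contr (e_ j) (qcoef w (k - 1) a b) =
  qcoef w k (emul p a) b + \sum_j w p j *: qcoef w (k - 1) (contr (e_ j) a) b.
Proof.
move=> ea eb; case: k => [[|m]|m] /=.
- by rewrite invr1 !scale1r -covmul_wdgl !big1 // => j _; rewrite ?linE scaler0.
- rewrite subSS subn0 /= {1}/emul covmulZ -/(emul p _) (emul_cwedgel w m.+1 p a eb) scalerBr.
  rewrite -addrA; congr (_ + _); rewrite scalerA -invfact_step -scalerN -sumrN scaler_sumr.
  rewrite -big_split /=; apply: eq_bigr => j _.
  by rewrite contrZ contr_cwedge // scalerN !scalerDr !scalerA mulrC addrC addrK.
- by rewrite /emul linE !big1 // => j _; rewrite ?linE scaler0.
Qed.

(** Here it is the part of the contraction acting on a that cancels the error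
term of [emul_cwedger]. *)
Lemma emul_qcoef_right w k p a b : w^T = - w -> exterior a -> exterior b ->
  emul p (qcoef w k a b) + \sum_j w p j *: contr (e_ j) (qcoef w (k - 1) a b) =
  qcoef w k (grinv a) (emul p b) + \sum_j w p j *: qcoef w (k - 1) (grinv a) (contr (e_ j) b).
Proof.
move=> wT ea eb; case: k => [[|m]|m] /=.
- by rewrite invr1 !scale1r -covmul_wdgr !big1 // => j _; rewrite ?linE scaler0.
- rewrite subSS subn0 /= {1}/emul covmulZ -/(emul p _) (emul_cwedger m.+1 p wT ea eb) scalerBr.
  rewrite -addrA; congr (_ + _); rewrite scalerA -invfact_step -scalerN -sumrN scaler_sumr.
  rewrite -big_split /=; apply: eq_bigr => j _.
  by rewrite contrZ contr_cwedge // scalerN !scalerDr !scalerA mulrC addKr.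
- by rewrite /emul linE !big1 // => j _; rewrite ?linE scaler0.
Qed.

Lemma rcontractE a v : exterior a -> rcontract a v = grinv (contr v a).
Proof.
move=> ea; apply/funext => s; rewrite /rcontract.
elim: s a ea => [|u s IHs] a ea; first by rewrite /grinv /= mul1r.
rewrite -[LHS]/(contr u a (rcons s v)) IHs; last exact: contr_exterior.
by rewrite -[RHS]/(contr u (grinv (contr v a)) s) contr_grinv contr_anti // grinvN.
Qed.

(** Splitting off the first entries of the two multi-indices matches the recursion of
[cwedge]. *)
Lemma qwedge_coefE w k a b : exterior a -> exterior b -> qwedge_coef w k a b = qcoef w k a b.
Proof.
move=> ea eb; case: k => [m|//]; apply/funext => s; rewrite /qcoef formZ /qwedge_coef; congr (_ * _).
elim: m a b ea eb => [|m IHm] a b ea eb /=.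
  rewrite (bigD1 [tuple]) //= [X in _ + X]big1 => [|m]; last by rewrite tuple0.
  rewrite (bigD1 [tuple]) //= [X in _ + X + _]big1 => [|m]; last by rewrite tuple0.
  by rewrite big_ord0 mul1r !addr0.
rewrite big_tuple_cons form_sum; apply: eq_bigr => i _.
rewrite form_sum.
under eq_bigr do rewrite big_tuple_cons.
rewrite exchange_big; apply: eq_bigr => j _ /=.
rewrite formZ -IHm; [|exact/exterior_grinv/contr_exterior|exact: contr_exterior].
rewrite mulr_sumr; apply: eq_bigr => I _.
rewrite mulr_sumr; apply: eq_bigr => G _.
rewrite big_ord_recl mulrA /= rcontractE //; congr (_ * _ * _).
by apply: eq_bigr => r _; rewrite !tnthS.
Qed.

Lemma qcoef_linl w k x a a' b : qcoef w k (x *: a + a') b = x *: qcoef w k a b + qcoef w k a' b.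
Proof.
case: k => [m|m] /=; last by rewrite scaler0 addr0.
by rewrite cwedge_linl scalerDr !scalerA mulrC.
Qed.
Lemma qcoef_linr w k x a b b' : qcoef w k a (x *: b + b') = x *: qcoef w k a b + qcoef w k a b'.
Proof.
case: k => [m|m] /=; last by rewrite scaler0 addr0.
by rewrite cwedge_linr scalerDr !scalerA mulrC.
Qed.
Lemma qcoef0l w k b : qcoef w k 0 b = 0.
Proof. by case: k => [m|m] //=; rewrite cwedge0l scaler0. Qed.
Lemma qcoef0r w k a : qcoef w k a 0 = 0.
Proof. by case: k => [m|m] //=; rewrite cwedge0r scaler0. Qed.
Lemma qcoefDl w k a a' b : qcoef w k (a + a') b = qcoef w k a b + qcoef w k a' b.
Proof. by have := qcoef_linl w k 1 a a' b; rewrite !scale1r. Qed.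
Lemma qcoefDr w k a b b' : qcoef w k a (b + b') = qcoef w k a b + qcoef w k a b'.
Proof. by have := qcoef_linr w k 1 a b b'; rewrite !scale1r. Qed.
Lemma qcoefZl w k x a b : qcoef w k (x *: a) b = x *: qcoef w k a b.
Proof. by have := qcoef_linl w k x a 0 b; rewrite qcoef0l !addr0. Qed.
Lemma qcoefZr w k x a b : qcoef w k a (x *: b) = x *: qcoef w k a b.
Proof. by have := qcoef_linr w k x a b 0; rewrite qcoef0r !addr0. Qed.
Lemma qcoef_suml w m I (r : seq I) (P : pred I) (F : I -> form) b :
  qcoef w m (\sum_(i <- r | P i) F i) b = \sum_(i <- r | P i) qcoef w m (F i) b.
Proof. by elim/big_rec2: _ => [|i y1 y2 _ <-]; rewrite ?qcoef0l ?qcoefDl. Qed.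
Lemma qcoef_sumr w m I (r : seq I) (P : pred I) (F : I -> form) a :
  qcoef w m a (\sum_(i <- r | P i) F i) = \sum_(i <- r | P i) qcoef w m a (F i).
Proof. by elim/big_rec2: _ => [|i y1 y2 _ <-]; rewrite ?qcoef0r ?qcoefDr. Qed.

Definition pullback (G : 'M[R]_n) a : form := fun s => a [seq u *m G | u <- s].

Lemma contr_pullback G v a : contr v (pullback G a) = pullback G (contr (v *m G) a).
Proof. by []. Qed.

Lemma pullback_is_linear G : linear (pullback G : form -> form).
Proof. by []. Qed.
HB.instance Definition _ G :=
  GRing.isLinear.Build R form form *:%R (pullback G) (pullback_is_linear G).
Lemma pullbackD G a b : pullback G (a + b) = pullback G a + pullback G b. Proof. by []. Qed.
Lemma pullbackN G a : pullback G (- a) = - pullback G a. Proof. by []. Qed.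
Lemma pullbackZ G x a : pullback G (x *: a) = x *: pullback G a. Proof. by []. Qed.
Lemma pullback_sum G I (r : seq I) (P : pred I) (F : I -> form) :
  pullback G (\sum_(i <- r | P i) F i) = \sum_(i <- r | P i) pullback G (F i).
Proof. exact: linear_sum. Qed.

Lemma pullback_grinv G a : pullback G (grinv a) = grinv (pullback G a).
Proof. by apply/funext => s; rewrite /pullback /grinv size_map. Qed.

Lemma pullback_exterior G a : exterior a -> exterior (pullback G a).
Proof.
move=> [la aa]; split=> [s t x u v|s t r u]; rewrite /pullback !map_cat /=.
  by rewrite mulmxDl -scalemxAl la.
by rewrite map_cat aa.
Qed.

Lemma pullback_wdg G a b : pullback G (wdg a b) = wdg (pullback G a) (pullback G b).
Proof.
apply/funext => s; elim: s a b => [|v s IHs] a b; first by rewrite /pullback !wdg_nil.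
rewrite -[LHS]/(contr v (pullback G (wdg a b)) s) -[RHS]/(contr v (wdg _ _) s).
by rewrite contr_wdg contr_pullback contr_wdg pullbackD !formD !IHs -!pullback_grinv !contr_pullback.
Qed.

Lemma pullback_covmul G l a : pullback G (covmul l a) = covmul (fun v => l (v *m G)) (pullback G a).
Proof.
apply/funext => s; elim: s a => [//|v s IHs] a.
by rewrite -[RHS]/(contr v (covmul _ _) s) contr_covmul formD formN -[LHS]/(contr v (pullback G _) s)
 contr_pullback contr_covmul pullbackD pullbackN formD formN IHs.
Qed.

(** The bivector is covariant, the forms contravariant: writing the vectors e_k G in
the standard basis redistributes the two factors G from w to the contractions. *)
Lemma pullback_cwedge G w w' m a b : w = G^T *m w' *m G -> exterior a -> exterior b ->
  pullback G (cwedge w m a b) = cwedge w' m (pullback G a) (pullback G b).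
Proof.
move=> wJ; elim: m a b => [|m IHm] a b ea eb /=; first by rewrite pullback_wdg.
rewrite pullback_sum.
under [LHS]eq_bigr do rewrite pullback_sum.
transitivity (\sum_k \sum_l \sum_i \sum_j (G i k * w' i j * G j l) *:
    pullback G (cwedge w m (grinv (contr (e_ k) a)) (contr (e_ l) b))).
  apply: eq_bigr => k _; apply: eq_bigr => l _; rewrite pullbackZ.
  under [RHS]eq_bigr do rewrite -scaler_suml.
  rewrite -scaler_suml wJ; congr (_ *: _); rewrite mxE exchange_big; apply: eq_bigr => j _.
  by rewrite mxE mulr_suml; apply: eq_bigr => i _; rewrite !mxE.
transitivity (\sum_i \sum_j \sum_k \sum_l (G i k * w' i j * G j l) *:
    pullback G (cwedge w m (grinv (contr (e_ k) a)) (contr (e_ l) b))).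
  under [LHS]eq_bigr do rewrite exchange_big /=.
  rewrite exchange_big /=; apply: eq_bigr => i _.
  under [LHS]eq_bigr do rewrite exchange_big /=.
  by rewrite exchange_big /=.
apply: eq_bigr => i _; apply: eq_bigr => j _.
rewrite contr_pullback -pullback_grinv [contr (e_ j) (pullback _ _)]contr_pullback -IHm; last 2 first.
- exact/exterior_grinv/contr_exterior.
- exact/contr_exterior.
rewrite !(contr_std (e_ _ *m G)) // grinv_sum cwedge_suml pullback_sum scaler_sumr; apply: eq_bigr => k _.
rewrite cwedge_sumr pullback_sum scaler_sumr; apply: eq_bigr => l _.
rewrite grinvZ cwedgeZl cwedgeZr !pullbackZ !scalerA; congr (_ *: _).
have Jrow i' k' : (e_ i' *m G) 0 k' = G i' k' by rewrite -rowE mxE.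
by rewrite !Jrow; ring.
Qed.

Lemma pullback_qcoef G w w' m a b : w = G^T *m w' *m G -> exterior a -> exterior b ->
  pullback G (qcoef w m a b) = qcoef w' m (pullback G a) (pullback G b).
Proof. by move=> wJ ea eb; case: m => [m|m] //=; rewrite pullbackZ (pullback_cwedge _ wJ). Qed.

End QuantumCoefficient.

(** * Quantum multiplication by a covector *)

Section QuantumMultiplication.
Context (R : realType) (n : nat).
Local Notation V := 'rV[R]_n.
Local Notation form := (seq V -> R^o).
Local Notation H := (int -> form).
Local Notation e_ := (std R).
Implicit Types (a b : form) (u v : V) (l : V -> R) (s t : seq V).
Implicit Types (g : V -> V) (w : 'M[R]_n) (A : H).

Lemma emul0 (p : 'I_n) : emul p (0 : form) = 0. Proof. exact: covmul0. Qed.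
Lemma emulD (p : 'I_n) a b : emul p (a + b) = emul p a + emul p b. Proof. exact: covmulD. Qed.
Lemma emulZ (p : 'I_n) x a : emul p (x *: a) = x *: emul p a. Proof. exact: covmulZ. Qed.
Lemma emul_sum (p : 'I_n) I (r : seq I) (P : pred I) (F : I -> form) :
  emul p (\sum_(i <- r | P i) F i) = \sum_(i <- r | P i) emul p (F i).
Proof. exact: covmul_sum. Qed.
Lemma contr_emul v (p : 'I_n) a : contr v (emul p a) = v 0 p *: a - emul p (contr v a).
Proof. exact: contr_covmul. Qed.
Lemma exterior_emul (p : 'I_n) a : exterior a -> exterior (emul p a).
Proof. by apply: exterior_covmul; apply: scal_lin_crd. Qed.

Definition exteriorH A := forall k, exterior (A k).

(** The quantum product by the coordinate covector e^i on series in h; A k is the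
coefficient of h^k, so that the factor h of the contraction shifts the index. *)
Definition qmul w (i : 'I_n) A : H := fun k => emul i (A k) + contr (row i w) (A (k - 1)).

Lemma qmul_is_linear w i : linear (qmul w i : H -> H).
Proof.
move=> x A B; apply/funext => k; rewrite /qmul -[(x *: A + B) k]/(x *: A k + B k).
rewrite -[(x *: A + B) (k - 1)]/(x *: A (k - 1) + B (k - 1)).
rewrite emulD emulZ contrD contrZ.
rewrite -[RHS]/(x *: (emul i (A k) + _) + (emul i (B k) + _)) scalerDr.
by rewrite addrACA.
Qed.
HB.instance Definition _ w i :=
  GRing.isLinear.Build R H H *:%R (qmul w i) (qmul_is_linear w i).

Lemma qmulD w i A B : qmul w i (A + B) = qmul w i A + qmul w i B. Proof. exact: linearD. Qed.
Lemma qmulN w i A : qmul w i (- A) = - qmul w i A. Proof. exact: linearN. Qed.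
Lemma qmul0 w i : qmul w i 0 = 0. Proof. exact: linear0. Qed.
Lemma qmul_sum w i I (r : seq I) (P : pred I) (F : I -> H) :
  qmul w i (\sum_(i <- r | P i) F i) = \sum_(j <- r | P j) qmul w i (F j).
Proof. exact: linear_sum. Qed.

Lemma exteriorH_qmul w i A : exteriorH A -> exteriorH (qmul w i A).
Proof.
by move=> eA k; apply: exteriorD; [exact: exterior_emul|exact: contr_exterior].
Qed.

(** Exterior multiplications anticommute, contractions anticommute, and the mixed terms give
h (w^{ik} + w^{ki}) = 0. *)
Lemma qmul_anti w i k A : w^T = - w -> exteriorH A -> qmul w i (qmul w k A) = - qmul w k (qmul w i A).
Proof.
move=> wT eA; apply/funext => m.
rewrite -[(- _) m]/(- qmul w k (qmul w i A) m) /qmul !emulD !contrD !contr_emul.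
rewrite (contr_anti (row i w)) // /emul covmul_anti -/(emul _ _) -/(emul _ _).
have -> : row k w 0 i = - row i w 0 k.
  by have /matrixP/(_ k i) := wT; rewrite !mxE => ->; rewrite opprK.
by rewrite scaleNr; apply/funext => s; rewrite !formE; ring.
Qed.

Definition derH g A : H := fun k => der g (A k).
Definition contrH v A : H := fun k => contr v (A k).

Lemma exteriorH_contrH v A : exteriorH A -> exteriorH (contrH v A).
Proof. by move=> eA k; apply: contr_exterior. Qed.

(** A symmetric matrix is paired with anticommuting contractions. *)
Lemma sym_contr (S : 'M[R]_n) a : exterior a -> S^T = S ->
  \sum_p \sum_q S p q *: contr (e_ p) (contr (e_ q) a) = 0.
Proof.
move=> ea sS; set X := LHS.
have : X = - X.
  rewrite {1}/X exchange_big /= -sumrN; apply: eq_bigr => p _.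
  rewrite -sumrN; apply: eq_bigr => q _.
  by rewrite contr_anti // scalerN -{1}sS mxE.
move/eqP; rewrite -addr_eq0 -mulr2n => /eqP X2; apply/funext => s.
have /funeqP/(_ s) := X2; rewrite mulr2n !formE => /eqP.
by rewrite -mulr2n mulrn_eq0 /= => /eqP.
Qed.

Lemma hseries_sum I (r : seq I) (P : pred I) (F : I -> H) k :
  (\sum_(i <- r | P i) F i) k = \sum_(i <- r | P i) F i k.
Proof. by rewrite fct_sumE. Qed.

(** By [der_expand] the derivation is \sum_l e^l /\ iota_(e_l G).  Replacing e^l /\
by its quantum version adds h \sum_l iota_(row l w) iota_(row l G), the contraction
along - w G, which is symmetric. *)
Lemma der_qmul w (G : 'M[R]_n) A : w^T = - w -> (w *m G)^T = w *m G -> exteriorH A ->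
  derH (mulmx^~ G) A = \sum_l qmul w l (contrH (row l G) A).
Proof.
move=> wT wG eA; apply/funext => k; rewrite /derH der_expand // hseries_sum.
rewrite /qmul /contrH big_split /= [X in _ = _ + X](_ : _ = 0) ?addr0.
  by apply: eq_bigr => l _; rewrite rowE.
have eAk := eA (k - 1); rewrite -[RHS](sym_contr eAk wG).
transitivity (\sum_l \sum_p \sum_q (w l p * G l q) *: contr (e_ p) (contr (e_ q) (A (k - 1)))).
  apply: eq_bigr => l _; rewrite contr_std; last exact: contr_exterior.
  apply: eq_bigr => p _; rewrite [contr (row l G) _]contr_std // contr_sum scaler_sumr.
  by apply: eq_bigr => q _; rewrite contrZ scalerA !mxE.
rewrite exchange_big /=; under [LHS]eq_bigr do rewrite exchange_big /=.
rewrite -[LHS]opprK -sumrN.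
under [in LHS]eq_bigr do rewrite -sumrN.
transitivity (- \sum_p \sum_q (w *m G) p q *: contr (e_ p) (contr (e_ q) (A (k - 1)))).
  congr (- _); apply: eq_bigr => p _; apply: eq_bigr => q _.
  rewrite -sumrN mxE scaler_suml; apply: eq_bigr => l _.
  have /matrixP/(_ l p) := wT; rewrite !mxE => ->.
  by rewrite mulNr scaleNr.
by rewrite (sym_contr eAk wG) oppr0.
Qed.

Lemma contrHD u v A : exteriorH A -> contrH (u + v) A = contrH u A + contrH v A.
Proof.
move=> eA; apply/funext => k; rewrite -[RHS]/(contr u (A k) + contr v (A k)).
by rewrite -[u]scale1r /contrH contr_lin // !scale1r.
Qed.

(** By [der_qmul] the sum is \sum L_i L_k L_l iota_(C_ik e_l).  A cyclic
permutation of three anticommuting factors is even, so the vector can be averaged over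
the cyclic permutations of (i, k, l), where it becomes zero. *)
Lemma curvature_qmul_eq0 w (C : 'I_n -> 'I_n -> 'M[R]_n) A : w^T = - w -> exteriorH A ->
  (forall i k, (w *m C i k)^T = w *m C i k) ->
  (forall i k l : 'I_n, row l (C i k) + row i (C k l) + row k (C l i) = 0) ->
  \sum_i \sum_k qmul w i (qmul w k (derH (mulmx^~ (C i k)) A)) = 0.
Proof.
move=> wT eA wC bianchi.
(* the cubic expression L_i L_k L_l iota_v, cyclic in (i, k, l) *)
pose F (i k l : 'I_n) (v : V) := qmul w i (qmul w k (qmul w l (contrH v A))).
have Frot (i k l : 'I_n) v : F k l i v = F i k l v.
  have ev := exteriorH_contrH v eA.
  rewrite /F (qmul_anti l i wT ev) qmulN (qmul_anti k i wT) ?qmulN ?opprK //.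
  exact: exteriorH_qmul.
set X := LHS.
have XF : X = \sum_i \sum_k \sum_l F i k l (row l (C i k)).
  apply: eq_bigr => i _; apply: eq_bigr => k _.
  by rewrite (der_qmul wT (wC i k) eA) !qmul_sum.
(* the same sum with the summation indices renamed cyclically *)
have XF2 : X = \sum_i \sum_k \sum_l F i k l (row i (C k l)).
  rewrite XF; under [LHS]eq_bigr do rewrite exchange_big /=.
  rewrite exchange_big /=; apply: eq_bigr => i _; apply: eq_bigr => k _.
  by apply: eq_bigr => l _; rewrite Frot.
have XF3 : X = \sum_i \sum_k \sum_l F i k l (row k (C l i)).
  rewrite XF exchange_big /=; apply: eq_bigr => i _; rewrite exchange_big /=.
  by apply: eq_bigr => k _; apply: eq_bigr => l _; rewrite (Frot k l i) (Frot i k l).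
have FD (i k l : 'I_n) u v : F i k l (u + v) = F i k l u + F i k l v.
  by rewrite /F contrHD // !qmulD.
have F0 (i k l : 'I_n) : F i k l 0 = 0.
  by have /esym/eqP := FD i k l 0 0; rewrite addr0 -subr_eq0 addrK => /eqP.
have : X + X + X = 0.
  rewrite {1}XF {1}XF2 XF3 -!big_split big1 // => i _.
  rewrite -!big_split big1 // => k _; rewrite -!big_split big1 // => l _.
  by rewrite [LHS]/= -!FD bianchi F0.
(* characteristic zero *)
have -> : X + X + X = 3%:R *: X by rewrite scaler_nat !mulrS mulr0n addr0 addrA.
by move/eqP; rewrite scaler_eq0 pnatr_eq0 /= => /eqP.
Qed.

(** L_i L_k is antisymmetric in i and k and sees only the antisymmetric part of M. *)
Lemma qmul2_sum_eq0 w (M M' : 'I_n -> 'I_n -> H) : w^T = - w ->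
  (forall i k, exteriorH (M i k)) ->
  (forall i k, M i k - M k i = M' i k) ->
  \sum_i \sum_k qmul w i (qmul w k (M' i k)) = 0 ->
  \sum_i \sum_k qmul w i (qmul w k (M i k)) = 0.
Proof.
move=> wT eM MM' S0; set X := LHS.
have : X + X = 0.
  rewrite -S0 {1}/X /X [X in _ + X = _]exchange_big -big_split; apply: eq_bigr => i _.
  rewrite -big_split; apply: eq_bigr => k _ /=.
  by rewrite (qmul_anti k i) // -!qmulN -!qmulD MM'.
rewrite -mulr2n -scaler_nat => /eqP; rewrite scaler_eq0 pnatr_eq0 /= => /eqP //.
Qed.

Lemma covmul_lsum I (r : seq I) (c : I -> R) (l : I -> V -> R) a :
  covmul (fun v => \sum_(k <- r) l k v * c k) a = \sum_(k <- r) c k *: covmul (l k) a.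
Proof.
apply/funext => s; rewrite form_sum; elim: s a => [|v s IHs] a.
  by rewrite big1 // => k _; rewrite formZ mulr0.
rewrite /= IHs mulr_suml -sumrB; apply: eq_bigr => k _.
by rewrite !formZ /=; ring.
Qed.

Definition form_lin (B : V -> form) := forall x u v, B (x *: u + v) = x *: B u + B v.

Lemma form_lin_sum (B : V -> form) I (r : seq I) (c : I -> R) (F : I -> V) :
  form_lin B -> B (\sum_(i <- r) c i *: F i) = \sum_(i <- r) c i *: B (F i).
Proof.
move=> Bl; elim/big_rec2: _ => [|i y1 y2 _ <-]; last exact: Bl.
by have := Bl (-1) 0 0; rewrite scaler0 addr0 scaleN1r addNr.
Qed.

(** \sum_i f^i (x) f_i is the identity endomorphism for every frame f with dual
coframe f^i. *)
Lemma frame_covmul (F : 'M[R]_n) (B : V -> form) : F \in unitmx -> form_lin B ->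
  \sum_i covmul (fun v => (v *m invmx F) 0 i) (B (row i F)) = \sum_i emul i (B (e_ i)).
Proof.
move=> uF Bl.
transitivity (\sum_i \sum_k \sum_j (invmx F k i * F i j) *: emul k (B (e_ j))).
  apply: eq_bigr => i _.
  have -> : (fun v : V => (v *m invmx F) 0 i) = (fun v => \sum_k v 0 k * invmx F k i).
    by apply/funext => v; rewrite mxE.
  rewrite covmul_lsum; apply: eq_bigr => k _.
  rewrite [row i F]vec_std form_lin_sum // covmul_sum scaler_sumr; apply: eq_bigr => j _.
  by rewrite covmulZ scalerA mxE.
rewrite exchange_big; apply: eq_bigr => k _; rewrite exchange_big /=.
rewrite (bigD1 k) //= [X in _ + X]big1 => [|j jk]; rewrite -scaler_suml.
  have := mulVmx uF => /matrixP/(_ k k); rewrite !mxE eqxx => ->.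
  by rewrite scale1r addr0.
have := mulVmx uF => /matrixP/(_ k j); rewrite !mxE eq_sym (negbTE jk) => ->.
by rewrite scale0r.
Qed.

Lemma frame_vec (F : 'M[R]_n) v : F \in unitmx ->
  \sum_i (v *m invmx F) 0 i *: row i F = v.
Proof. by move=> uF; rewrite -mulmx_sum_row mulmxKV. Qed.
End QuantumMultiplication.

(** * Smooth functions on open subsets of R^n *)

Section Calculus.
Context (R : realType) (n : nat).
Local Notation V := 'rV[R]_n.
Implicit Types (f g : V -> R^o) (U W : set V) (x v : V).

Lemma near_eq_differentiable (V1 V2 : normedModType R) (f g : V1 -> V2) (x : V1) :
  (\forall y \near x, f y = g y) -> differentiable f x -> differentiable g x.
Proof.
move=> fg df; have fgx := nbhs_singleton fg.
have dg : g \o shift x = cst (g x) + 'd f x +o_ 0 id.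
  have /eqaddoP fo := diff_locally df.
  apply/eqaddoP => e e0; have := fo e e0.
  have : \forall h \near (0 : V1), f (h + x) = g (h + x).
    by move: fg; rewrite (near_shift 0); apply: filterS => h /=; rewrite subr0.
  apply: filterS2 => h /= fgh.
  by rewrite -[(f \o shift x - _) h]/(f (h + x) - (f x + 'd f x h)) fgh fgx.
apply/diff_locallyP; rewrite (diff_unique _ dg) //; last exact: diff_continuous.
by split=> //; apply: diff_continuous.
Qed.

Lemma open_near U x : open U -> U x -> \forall y \near x, U y.
Proof. by move=> oU Ux; apply: open_nbhs_nbhs; split. Qed.

Lemma derive_on U f g v x : open U -> (forall y, U y -> f y = g y) -> U x ->
  'D_v f x = 'D_v g x.
Proof.
move=> oU fg Ux; apply: near_eq_derive.
by apply: filterS (open_near oU Ux) => y; apply: fg.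
Qed.

Lemma differentiable_on U f g x : open U -> (forall y, U y -> f y = g y) -> U x ->
  differentiable f x -> differentiable g x.
Proof.
move=> oU fg Ux; apply: near_eq_differentiable.
by apply: filterS (open_near oU Ux) => y; apply: fg.
Qed.

(** Smoothness as differentiability of order k + 1 for all k ([CkP]); the recursion on k is what
makes products and compositions provable by induction. *)
Fixpoint Ck (k : nat) U f :=
  (forall x, U x -> differentiable f x) /\
  if k is k'.+1 then forall i, Ck k' U (partial i f) else True.

Lemma CkP U f : Csmooth U f <-> forall k, Ck k U f.
Proof.
split=> [sf k|].
  elim: k f sf => [|k IHk] f sf; (split; first exact: (sf [::])) => // i.
  by apply: IHk => s x Ux; have := sf (rcons s i) x Ux; rewrite foldr_rcons.
move=> sf s; elim/last_ind: s f sf => [|s i IHs] f sf x Ux.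
  by have [df _] := sf 0%N; exact: df.
rewrite foldr_rcons; apply: IHs => // k.
by have [_ pf] := sf k.+1; exact: pf.
Qed.

Lemma Ck_pred k U f : Ck k.+1 U f -> Ck k U f.
Proof.
elim: k f => [|k IHk] f [df pf]; first by split.
by split=> // i; apply: IHk.
Qed.

Lemma Ck_diff k U f x : Ck k U f -> U x -> differentiable f x.
Proof. by case: k => [|k] [df _]; apply: df. Qed.

Lemma Ck_ext k U f g : open U -> (forall y, U y -> f y = g y) -> Ck k U f -> Ck k U g.
Proof.
move=> oU; elim: k f g => [|k IHk] f g fg [df pf]; split => //.
- by move=> x Ux; exact: (differentiable_on oU fg Ux (df x Ux)).
- by move=> x Ux; exact: (differentiable_on oU fg Ux (df x Ux)).
- move=> i; apply: (IHk _ _ _ (pf i)) => y Uy; exact: (derive_on _ oU fg Uy).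
Qed.

Lemma Ck_cst k U c : Ck k U (cst c).
Proof.
have p0 i d : partial i (cst d : V -> R^o) = cst 0.
  by apply/funext => y; rewrite /partial derive_cst.
elim: k c => [|k IHk] c; (split; first by move=> x _; exact: differentiable_cst) => // i.
by rewrite p0.
Qed.

Lemma Ck_add k U f g : open U -> Ck k U f -> Ck k U g -> Ck k U (f + g).
Proof.
move=> oU; elim: k f g => [|k IHk] f g.
  by move=> [df _] [dg _]; split=> // x Ux; apply: differentiableD; [apply: df|apply: dg].
move=> [df pf] [dg pg]; split=> [x Ux|i].
  by apply: differentiableD; [apply: df|apply: dg].
apply: (Ck_ext oU _ (IHk _ _ (pf i) (pg i))) => x Ux.
by rewrite /partial deriveD //; apply: diff_derivable; [apply: df|apply: dg].
Qed.

Lemma Ck_sum k U I (r : seq I) (F : I -> V -> R^o) : open U ->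
  (forall i, Ck k U (F i)) -> Ck k U (\sum_(i <- r) F i).
Proof.
move=> oU CF; elim: r => [|i r IHr]; first by rewrite big_nil; apply: Ck_cst.
by rewrite big_cons; apply: Ck_add.
Qed.

Lemma Ck_mul k U f g : open U -> Ck k U f -> Ck k U g -> Ck k U (f * g : V -> R^o).
Proof.
move=> oU; elim: k f g => [|k IHk] f g.
  by move=> [df _] [dg _]; split=> // x Ux; apply: differentiableM; [apply: df|apply: dg].
move=> Cf Cg; have [df pf] := Cf; have [dg pg] := Cg; split=> [x Ux|i].
  by apply: differentiableM; [apply: df|apply: dg].
apply: (Ck_ext oU _ (Ck_add oU (IHk _ _ (Ck_pred Cf) (pg i)) (IHk _ _ (Ck_pred Cg) (pf i)))).
by move=> x Ux; rewrite /partial deriveM //; apply: diff_derivable; [apply: df|apply: dg].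
Qed.

Lemma differentiable_rV (phi : V -> V) x :
  (forall j, differentiable (fun y => phi y 0 j : R^o) x) -> differentiable phi x.
Proof.
move=> dphi; have -> : phi = \sum_j (fun y => phi y 0 j *: std R j).
  by apply/funext => y; rewrite fct_sumE [LHS]row_sum_delta.
by apply: differentiable_sum => j; apply: differentiableZl.
Qed.

Lemma derive_lin f x c u v : differentiable f x ->
  'D_(c *: u + v) f x = c *: 'D_u f x + 'D_v f x.
Proof. by move=> df; rewrite !deriveE // linearP. Qed.

Lemma derive_std f x v : differentiable f x ->
  'D_v f x = \sum_j v 0 j * 'D_(std R j) f x.
Proof.
move=> df; rewrite {1}[v]row_sum_delta deriveE // linear_sum.
by apply: eq_bigr => j _; rewrite linearZ deriveE.
Qed.

Lemma derive_rV (phi : V -> V) x v j : differentiable phi x ->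
  ('D_v phi x) 0 j = 'D_v (fun y => phi y 0 j : R^o) x.
Proof. by move=> dphi; rewrite derive_mx ?mxE //; apply: diff_derivable. Qed.

Lemma derive_chain (phi : V -> V) f x v :
  differentiable phi x -> differentiable f (phi x) ->
  'D_v (f \o phi) x = 'D_('D_v phi x) f (phi x).
Proof.
move=> dphi df; rewrite !deriveE //; last exact: differentiable_comp.
by have /funeqP/(_ v) := diff_comp dphi df; exact.
Qed.

(** By the chain rule a partial derivative of f o phi is a sum of products of
functions of class k, to which the induction hypothesis applies. *)
Lemma Ck_comp k U W f (phi : V -> V) : open U ->
  (forall j, Ck k U (fun y => phi y 0 j)) -> (forall x, U x -> W (phi x)) ->
  Ck k W f -> Ck k U (f \o phi).
Proof.
move=> oU; elim: k f => [|k IHk] f Cphi UW Cf.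
  split=> // x Ux; apply: differentiable_comp; last exact: Ck_diff Cf (UW _ Ux).
  by apply: differentiable_rV => j; apply: Ck_diff (Cphi j) Ux.
have dphi x : U x -> differentiable phi x.
  by move=> Ux; apply: differentiable_rV => j; apply: Ck_diff (Cphi j) Ux.
split=> [x Ux|i].
  by apply: differentiable_comp; [apply: dphi|apply: Ck_diff Cf (UW _ Ux)].
have eqE x : U x -> (\sum_j (partial i (fun y => phi y 0 j : R^o)) * (partial j f \o phi)) x =
    partial i (f \o phi) x.
  move=> Ux; rewrite /partial derive_chain //; [|exact: dphi|exact: Ck_diff Cf (UW _ Ux)].
  rewrite derive_std; last exact: Ck_diff Cf (UW _ Ux).
  by rewrite fct_sumE; apply: eq_bigr => j _; rewrite derive_rV //; apply: dphi.
apply: (Ck_ext oU eqE).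
apply: Ck_sum => // j; apply: Ck_mul => //; first by have [_ pphi] := Cphi j; exact: pphi.
apply: IHk => //; first by move=> j'; apply: Ck_pred.
by have [_ pf] := Cf; exact: pf.
Qed.

Lemma Csmooth_ext U f g : open U -> (forall y, U y -> f y = g y) ->
  Csmooth U f -> Csmooth U g.
Proof. by move=> oU fg /CkP Cf; apply/CkP => k; apply: (Ck_ext oU fg). Qed.

Lemma Csmooth_cst U c : Csmooth U (fun=> c).
Proof. by apply/CkP => k; apply: Ck_cst. Qed.

Lemma Csmooth_add U f g : open U -> Csmooth U f -> Csmooth U g ->
  Csmooth U (fun y => f y + g y).
Proof. by move=> oU /CkP Cf /CkP Cg; apply/CkP => k; apply: Ck_add. Qed.

Lemma Csmooth_mul U f g : open U -> Csmooth U f -> Csmooth U g ->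
  Csmooth U (fun y => f y * g y : R^o).
Proof. by move=> oU /CkP Cf /CkP Cg; apply/CkP => k; apply: Ck_mul. Qed.

Lemma Csmooth_opp U f : open U -> Csmooth U f -> Csmooth U (fun y => - f y).
Proof.
move=> oU Cf; apply: (Csmooth_ext oU _ (Csmooth_mul oU (@Csmooth_cst U (-1)) Cf)) => y _.
exact: mulN1r.
Qed.

Lemma Csmooth_sum U I (r : seq I) (F : I -> V -> R^o) : open U ->
  (forall i, Csmooth U (F i)) -> Csmooth U (fun y => \sum_(i <- r) F i y).
Proof.
move=> oU CF; apply/CkP => k.
have -> : (fun y => \sum_(i <- r) F i y) = \sum_(i <- r) F i.
  by apply/funext => y; rewrite fct_sumE.
by apply: Ck_sum => // i; have /CkP := CF i.
Qed.

Lemma Csmooth_comp U W f (phi : V -> V) : open U ->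
  (forall j, Csmooth U (fun y => phi y 0 j)) -> (forall x, U x -> W (phi x)) ->
  Csmooth W f -> Csmooth U (f \o phi).
Proof.
move=> oU Cphi UW /CkP Cf; apply/CkP => k; apply: Ck_comp (Cf k) => // j.
by have /CkP := Cphi j.
Qed.

Lemma Csmooth_diff U f x : Csmooth U f -> U x -> differentiable f x.
Proof. by move=> /(_ [::]); apply. Qed.

Lemma Csmooth_partial U f i : Csmooth U f -> Csmooth U (partial i f).
Proof. by move=> /CkP Cf; apply/CkP => k; have [_] := Cf k.+1; apply. Qed.

Lemma Csmooth_sub U W f : (forall x, U x -> W x) -> Csmooth W f -> Csmooth U f.
Proof. by move=> UW Cf s x /UW; apply: Cf. Qed.

Lemma Csmooth_derive U f v : open U -> Csmooth U f -> Csmooth U (fun x => 'D_v f x).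
Proof.
move=> oU Cf; have : Csmooth U (fun x => \sum_j v 0 j * partial j f x).
  apply: Csmooth_sum => // j; apply: Csmooth_mul => //; first exact: Csmooth_cst.
  exact: Csmooth_partial.
apply: (Csmooth_ext oU) => x Ux; rewrite derive_std //; exact: (Csmooth_diff Cf Ux).
Qed.

End Calculus.

(** * Derivatives of form-valued maps *)

Section FormDerivative.
Context (R : realType) (n : nat).
Local Notation V := 'rV[R]_n.
Local Notation form := (seq V -> R^o).
Local Notation H := (int -> form).
Local Notation e_ := (std R).
Implicit Types (f : V -> R^o) (F K : V -> form) (u v x : V) (X : set V).

(** Differentiability value by value, as forms of unbounded degree are not given a
norm. *)
Definition diff_cform F x := forall s, differentiable (fun y => F y s : R^o) x.

Definition pder v F : V -> form := fun x s => 'D_v (fun y => F y s : R^o) x.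

Lemma diff_cform_D F K x : diff_cform F x -> diff_cform K x -> diff_cform (fun y => F y + K y) x.
Proof. by move=> dF dK s; apply: differentiableD. Qed.

Lemma diff_cform_Z f F x : differentiable f x -> diff_cform F x -> diff_cform (fun y => f y *: F y) x.
Proof. by move=> df dF s; apply: differentiableM. Qed.

Lemma diff_cform_N F x : diff_cform F x -> diff_cform (fun y => - F y) x.
Proof. by move=> dF s; apply: differentiableN. Qed.

Lemma diff_cform_contr u F x : diff_cform F x -> diff_cform (fun y => contr u (F y)) x.
Proof. by move=> dF s; apply: dF. Qed.

Lemma diff_cform_grinv F x : diff_cform F x -> diff_cform (fun y => grinv (F y)) x.
Proof. by move=> dF s; apply: differentiableM => //; exact: differentiable_cst. Qed.

Lemma diff_cform_sum I (r : seq I) (F : I -> V -> form) x : (forall i, diff_cform (F i) x) ->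
  diff_cform (fun y => \sum_(i <- r) F i y) x.
Proof.
move=> dF; elim: r => [|i r IHr] s.
  have -> : (fun y => (\sum_(i <- [::]) F i y) s) = cst 0.
    by apply/funext => y; rewrite big_nil.
  exact: differentiable_cst.
have -> : (fun y => (\sum_(i <- i :: r) F i y) s) = (fun y => (F i y + \sum_(i <- r) F i y) s).
  by apply/funext => y; rewrite big_cons.
exact: diff_cform_D.
Qed.

Lemma diff_cform_covmul l F x : diff_cform F x -> diff_cform (fun y => covmul l (F y)) x.
Proof.
move=> dF s; elim: s F dF => [|v s IHs] F dF /=; first exact: differentiable_cst.
apply: differentiableB; last exact/IHs/diff_cform_contr.
by apply: differentiableM => //; exact: differentiable_cst.
Qed.

Lemma diff_cform_wdg F K x : diff_cform F x -> diff_cform K x -> diff_cform (fun y => wdg (F y) (K y)) x.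
Proof.
move=> dF dK s; elim: s F K dF dK => [|v s IHs] F K dF dK.
  have -> : (fun y => wdg (F y) (K y) [::]) = (fun y => F y [::]) * (fun y => K y [::]).
    by apply/funext => y; rewrite wdg_nil.
  by apply: differentiableM.
have -> : (fun y => wdg (F y) (K y) (v :: s)) =
    (fun y => wdg (contr v (F y)) (K y) s) + (fun y => wdg (grinv (F y)) (contr v (K y)) s).
  by apply/funext => y; rewrite -[LHS]/(contr v (wdg _ _) s) contr_wdg.
by apply: differentiableD; apply: IHs => //; [exact: diff_cform_contr|exact: diff_cform_grinv|exact: diff_cform_contr].
Qed.

Lemma pder_contr v u F x : pder v (fun y => contr u (F y)) x = contr u (pder v F x).
Proof. by []. Qed.

Lemma pder_D v F K x : diff_cform F x -> diff_cform K x ->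
  pder v (fun y => F y + K y) x = pder v F x + pder v K x.
Proof.
by move=> dF dK; apply/funext => s; apply: deriveD; apply: diff_derivable.
Qed.

Lemma pder_Z v f F x : differentiable f x -> diff_cform F x ->
  pder v (fun y => f y *: F y) x = 'D_v f x *: F x + f x *: pder v F x.
Proof.
move=> df dF; apply/funext => s; rewrite addrC formD !formZ [_ * F x s]mulrC.
by apply: deriveM; apply: diff_derivable.
Qed.

Lemma pder_N v F x : diff_cform F x -> pder v (fun y => - F y) x = - pder v F x.
Proof. by move=> dF; apply/funext => s; apply: deriveN; apply: diff_derivable. Qed.

Lemma pder_const v (c : R) F x : diff_cform F x -> pder v (fun y => c *: F y) x = c *: pder v F x.
Proof.
move=> dF; have dc : differentiable (cst c : V -> R^o) x by exact: differentiable_cst.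
by rewrite (pder_Z v dc dF) derive_cst scale0r add0r.
Qed.

Lemma pder_sum v I (r : seq I) (F : I -> V -> form) x : (forall i, diff_cform (F i) x) ->
  pder v (fun y => \sum_(i <- r) F i y) x = \sum_(i <- r) pder v (F i) x.
Proof.
move=> dF; elim: r => [|i r IHr].
  rewrite big_nil; apply/funext => s; rewrite /pder.
  have -> : (fun y => (\sum_(i <- [::]) F i y) s) = cst 0.
    by apply/funext => y; rewrite big_nil.
  by rewrite derive_cst.
rewrite big_cons -IHr -pder_D //; last exact: diff_cform_sum.
by congr pder; apply/funext => y; rewrite big_cons.
Qed.

Lemma pder_grinv v F x : diff_cform F x -> pder v (fun y => grinv (F y)) x = grinv (pder v F x).
Proof. by move=> dF; apply/funext => s; apply: deriveZ; apply: diff_derivable. Qed.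

Lemma pder_covmul v l F x : diff_cform F x -> pder v (fun y => covmul l (F y)) x = covmul l (pder v F x).
Proof.
move=> dF; apply/funext => s; elim: s F dF => [|u s IHs] F dF /=.
  exact: derive_cst.
rewrite /pder -[LHS]/(pder v (fun y => l u *: F y - covmul l (contr u (F y))) x s).
rewrite pder_D ?pder_const ?pder_N //; try exact/diff_cform_covmul/diff_cform_contr.
- by rewrite formD formN formZ IHs //; exact: diff_cform_contr.
- by apply: diff_cform_Z => //; exact: differentiable_cst.
- exact/diff_cform_N/diff_cform_covmul/diff_cform_contr.
Qed.

Lemma pder_wdg v F K x : diff_cform F x -> diff_cform K x ->
  pder v (fun y => wdg (F y) (K y)) x = wdg (pder v F x) (K x) + wdg (F x) (pder v K x).
Proof.
move=> dF dK; apply/funext => s; elim: s F K dF dK => [|u s IHs] F K dF dK.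
  rewrite formD !wdg_nil /pder.
  have -> : (fun y => wdg (F y) (K y) [::]) = (fun y => F y [::]) * (fun y => K y [::]).
    by apply/funext => y; rewrite wdg_nil.
  rewrite deriveM; [|exact: diff_derivable|exact: diff_derivable].
  by rewrite addrC mulrC.
rewrite -[LHS]/(contr u (pder v (fun y => wdg (F y) (K y)) x) s) -pder_contr.
have -> : (fun y => contr u (wdg (F y) (K y))) =
    (fun y => wdg (contr u (F y)) (K y) + wdg (grinv (F y)) (contr u (K y))).
  by apply/funext => y; rewrite contr_wdg.
rewrite pder_D; [|exact/diff_cform_wdg/dK/diff_cform_contr|exact: (diff_cform_wdg (diff_cform_grinv dF) (diff_cform_contr u dK))].
rewrite formD !IHs //; try exact: diff_cform_contr; last exact: diff_cform_grinv.
rewrite pder_grinv // !pder_contr -[RHS]/(contr u (_ + _) s) contrD !contr_wdg !formD.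
by rewrite addrACA.
Qed.

Lemma pder_on X v F K x : open X -> (forall y, X y -> F y = K y) -> X x ->
  pder v F x = pder v K x.
Proof.
by move=> oX FK Xx; apply/funext => s; apply: (derive_on _ oX) => // y Xy; rewrite FK.
Qed.

Lemma pder_exterior X v F x : open X -> X x -> diff_cform F x ->
  (forall y, X y -> exterior (F y)) -> exterior (pder v F x).
Proof.
move=> oX Xx dF eF; split=> [s t c u u'|s t r u].
  rewrite /pder -[c * _ + _]/((c *: pder v F x _) + pder v F x _).
  rewrite /pder -deriveZ; last exact: diff_derivable.
  rewrite -deriveD; [|apply: derivableZ; exact: diff_derivable|exact: diff_derivable].
  by apply: (derive_on _ oX) => // y Xy; have [-> _] := eF y Xy.
rewrite /pder (@derive_on _ _ _ _ (cst 0) _ _ oX) ?derive_cst // => y Xy.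
by have [_ ->] := eF y Xy.
Qed.

End FormDerivative.

(** * The covariant derivative in coordinates *)

Section CoordinateConnection.
Context (R : realType) (n : nat).
Local Notation V := 'rV[R]_n.
Local Notation form := (seq V -> R^o).
Local Notation H := (int -> form).
Local Notation e_ := (std R).
Implicit Types (f : V -> R^o) (F K : V -> form) (u v x : V) (X : set V).
Implicit Types (g : 'M[R]_n) (w G : V -> 'M[R]_n).

Definition diff_cmx w x := forall i j, differentiable (fun y => w y i j : R^o) x.
Definition pderm v w x : 'M[R]_n := \matrix_(i, j) 'D_v (fun y => w y i j : R^o) x.

(** The covariant derivative along v in coordinates; the matrix g of u |-> nabla_v u
acts on row vectors. *)
Definition conn g v F x : form := pder v F x - der (mulmx^~ g) (F x).

(** The constant field e_i has covariant derivative e_i g. *)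
Lemma conn_contr g v F x (i : 'I_n) :
  conn g v (fun y => contr (e_ i) (F y)) x =
  contr (e_ i) (conn g v F x) + contr (e_ i *m g) (F x).
Proof.
rewrite /conn pder_contr linE contrN contr_der opprD.
by rewrite addrA addrAC addrNK.
Qed.

Lemma conn_grinv g v F x : diff_cform F x -> conn g v (fun y => grinv (F y)) x = grinv (conn g v F x).
Proof. by move=> dF; rewrite /conn pder_grinv // grinvD grinvN grinv_der. Qed.

Lemma conn_D g v F K x : diff_cform F x -> diff_cform K x ->
  conn g v (fun y => F y + K y) x = conn g v F x + conn g v K x.
Proof. by move=> dF dK; rewrite /conn pder_D // derD opprD addrACA. Qed.

Lemma conn_Z g v f F x : differentiable f x -> diff_cform F x ->
  conn g v (fun y => f y *: F y) x = 'D_v f x *: F x + f x *: conn g v F x.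
Proof. by move=> df dF; rewrite /conn pder_Z // derZ scalerBr addrA. Qed.

Lemma conn_const g v (c : R) F x : diff_cform F x ->
  conn g v (fun y => c *: F y) x = c *: conn g v F x.
Proof. by move=> dF; rewrite /conn pder_const // derZ scalerBr. Qed.

Lemma conn_sum g v I (r : seq I) (F : I -> V -> form) x : (forall i, diff_cform (F i) x) ->
  conn g v (fun y => \sum_(i <- r) F i y) x = \sum_(i <- r) conn g v (F i) x.
Proof. by move=> dF; rewrite /conn pder_sum // der_sum -sumrB. Qed.

Lemma conn_wdg g v F K x : diff_cform F x -> diff_cform K x ->
  conn g v (fun y => wdg (F y) (K y)) x = wdg (conn g v F x) (K x) + wdg (F x) (conn g v K x).
Proof.
move=> dF dK; rewrite /conn pder_wdg // der_wdg wdgDl wdgDr wdgNl wdgNr.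
by rewrite opprD addrACA.
Qed.

Lemma conn_on g v X F K x : open X -> (forall y, X y -> F y = K y) -> X x ->
  conn g v F x = conn g v K x.
Proof. by move=> oX FK Xx; rewrite /conn (pder_on _ oX FK) // FK. Qed.

Lemma conn_exterior g v X F x : open X -> X x -> diff_cform F x ->
  (forall y, X y -> exterior (F y)) -> exterior (conn g v F x).
Proof.
move=> oX Xx dF eF; apply: exteriorD; first exact: pder_exterior oX Xx dF eF.
by apply/exteriorN/exterior_der/eF.
Qed.

Lemma diff_cform_cwedge w m F K x : diff_cmx w x -> diff_cform F x -> diff_cform K x ->
  diff_cform (fun y => cwedge (w y) m (F y) (K y)) x.
Proof.
move=> dw; elim: m F K => [|m IHm] F K dF dK /=; first exact: diff_cform_wdg.
apply: (diff_cform_sum _ (F := fun i y => \sum_j w y i j *: cwedge (w y) m (grinv (contr (e_ i) (F y))) (contr (e_ j) (K y)))) => i.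
apply: (diff_cform_sum _ (F := fun j y => w y i j *: cwedge (w y) m (grinv (contr (e_ i) (F y))) (contr (e_ j) (K y)))) => j.
apply: (diff_cform_Z (f := fun y => w y i j)) => //.
by apply: IHm; [exact/diff_cform_grinv/diff_cform_contr|exact: diff_cform_contr].
Qed.

Lemma big2_split (A B : 'I_n -> 'I_n -> form) :
  \sum_i \sum_j (A i j + B i j) = \sum_i \sum_j A i j + \sum_i \sum_j B i j.
Proof. by rewrite -big_split; apply: eq_bigr => i _; rewrite -big_split. Qed.

(** Differentiating an index pair gives the covariant derivatives of the two
contractions and of the coefficient w^{ij}; the three contributions cancel when w is
parallel, which is the matrix equation in the hypothesis. *)
Lemma conn_cwedge g v w m F K x : diff_cmx w x -> diff_cform F x -> diff_cform K x ->
  exterior (F x) -> exterior (K x) ->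
  pderm v w x + w x *m g + g^T *m w x = 0 ->
  conn g v (fun y => cwedge (w y) m (F y) (K y)) x =
  cwedge (w x) m (conn g v F x) (K x) + cwedge (w x) m (F x) (conn g v K x).
Proof.
move=> dw dF dK eF eK cw; elim: m F K dF dK eF eK => [|m IHm] F K dF dK eF eK /=.
  exact: conn_wdg.
pose t i j y := cwedge (w y) m (grinv (contr (e_ i) (F y))) (contr (e_ j) (K y)).
have dt i j : diff_cform (t i j) x by apply: diff_cform_cwedge => //; [exact/diff_cform_grinv/diff_cform_contr|exact: diff_cform_contr].
have dwt i j : diff_cform (fun y => w y i j *: t i j y) x by apply: (diff_cform_Z (f := fun y => w y i j)).
have dwt1 i : diff_cform (fun y => \sum_j w y i j *: t i j y) x by apply: diff_cform_sum.
have ct i j : conn g v (t i j) x =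
   cwedge (w x) m (grinv (contr (e_ i) (conn g v F x))) (contr (e_ j) (K x)) +
   cwedge (w x) m (grinv (contr (e_ i) (F x))) (contr (e_ j) (conn g v K x)) +
   (cwedge (w x) m (grinv (contr (e_ i *m g) (F x))) (contr (e_ j) (K x)) +
    cwedge (w x) m (grinv (contr (e_ i) (F x))) (contr (e_ j *m g) (K x))).
  rewrite /t IHm; [|exact/diff_cform_grinv/diff_cform_contr|exact: diff_cform_contr|exact/exterior_grinv/contr_exterior|exact: contr_exterior].
  rewrite conn_grinv; last exact: diff_cform_contr.
  by rewrite !conn_contr grinvD cwedgeDl cwedgeDr addrACA.
have e_g i : e_ i *m g = \sum_k g i k *: e_ k.
  by rewrite [LHS]vec_std; apply: eq_bigr => k _; rewrite -rowE mxE.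
transitivity (\sum_i \sum_j (('D_v (fun y => w y i j : R^o) x) *: t i j x + w x i j *: conn g v (t i j) x)).
  rewrite (conn_sum g v _ dwt1); apply: eq_bigr => i _.
  rewrite (conn_sum g v _ (dwt i)); apply: eq_bigr => j _.
  exact: (conn_Z g v (dw i j) (dt i j)).
under [LHS]eq_bigr => i _ do under eq_bigr => j _ do rewrite ct !scalerDr addrC -!addrA.
rewrite !big2_split.
rewrite addrA -[RHS]addr0; congr (_ + _).
have S1 : \sum_i \sum_j w x i j *: cwedge (w x) m (grinv (contr (e_ i *m g) (F x))) (contr (e_ j) (K x)) =
   \sum_i \sum_j (g^T *m w x) i j *: t i j x.
  transitivity (\sum_i \sum_j \sum_k (w x i j * g i k) *: t k j x).
    apply: eq_bigr => i _; apply: eq_bigr => j _.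
    rewrite e_g contr_vsum // grinv_sum cwedge_suml scaler_sumr; apply: eq_bigr => k _.
    by rewrite grinvZ cwedgeZl scalerA.
  under [LHS]eq_bigr => i _ do rewrite exchange_big /=.
  rewrite exchange_big /=; apply: eq_bigr => k _.
  rewrite exchange_big /=; apply: eq_bigr => j _.
  by rewrite -scaler_suml mxE; congr (_ *: _); apply: eq_bigr => i _; rewrite mxE mulrC.
have S2 : \sum_i \sum_j w x i j *: cwedge (w x) m (grinv (contr (e_ i) (F x))) (contr (e_ j *m g) (K x)) =
   \sum_i \sum_j (w x *m g) i j *: t i j x.
  apply: eq_bigr => i _.
  transitivity (\sum_j \sum_k (w x i j * g j k) *: t i k x).
    apply: eq_bigr => j _.
    rewrite e_g contr_vsum // cwedge_sumr scaler_sumr; apply: eq_bigr => k _.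
    by rewrite cwedgeZr scalerA.
  rewrite exchange_big /=; apply: eq_bigr => k _.
  by rewrite -scaler_suml mxE.
rewrite S1 S2 -!big_split big1 //= => i _; rewrite -!big_split big1 //= => j _.
have := congr1 (fun M : 'M[R]_n => M i j) cw.
rewrite mxE [X in X + _]mxE [X in X + _ + _]mxE [RHS]mxE => cwij.
rewrite -!scalerDl -[RHS](scale0r (t i j x)) -cwij; congr (_ *: _).
by rewrite addrC; congr (_ + _); rewrite addrC.
Qed.

Lemma diff_cform_qcoef w k F K x : diff_cmx w x -> diff_cform F x -> diff_cform K x ->
  diff_cform (fun y => qcoef (w y) k (F y) (K y)) x.
Proof.
move=> dw dF dK; case: k => [m|m] /=; last by move=> s; exact: differentiable_cst.
apply: (diff_cform_Z (f := cst _)); first exact: differentiable_cst.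
exact: diff_cform_cwedge.
Qed.

Lemma conn_0 g v x : conn g v (fun=> 0) x = 0.
Proof.
rewrite /conn der0 subr0; apply/funext => s; exact: derive_cst.
Qed.

Lemma conn_qcoef g v w k F K x : diff_cmx w x -> diff_cform F x -> diff_cform K x ->
  exterior (F x) -> exterior (K x) ->
  pderm v w x + w x *m g + g^T *m w x = 0 ->
  conn g v (fun y => qcoef (w y) k (F y) (K y)) x =
  qcoef (w x) k (conn g v F x) (K x) + qcoef (w x) k (F x) (conn g v K x).
Proof.
move=> dw dF dK eF eK cw; case: k => [m|m] /=; last by rewrite conn_0 addr0.
by rewrite conn_const ?conn_cwedge ?scalerDr //; exact: diff_cform_cwedge.
Qed.

End CoordinateConnection.

(** * Smooth form-valued maps and commutators of covariant derivatives *)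

Section SmoothCoordinateForms.
Context (R : realType) (n : nat).
Local Notation V := 'rV[R]_n.
Local Notation form := (seq V -> R^o).
Local Notation H := (int -> form).
Local Notation e_ := (std R).
Implicit Types (f : V -> R^o) (F K : V -> form) (u v x : V) (X : set V).
Implicit Types (g : 'M[R]_n) (w G : V -> 'M[R]_n) (A : V -> H).

Definition smooth_cform X F := (forall y, X y -> exterior (F y)) /\
  forall s, Csmooth X (fun y => F y s).
Definition smooth_cmx X w := forall i j, Csmooth X (fun y => w y i j).

Lemma smooth_cform_diff_cform X F x : smooth_cform X F -> X x -> diff_cform F x.
Proof. by move=> [_ sF] Xx s; apply: Csmooth_diff (sF s) Xx. Qed.

Lemma smooth_cmx_diff_cmx X w x : smooth_cmx X w -> X x -> diff_cmx w x.
Proof. by move=> sw Xx i j; apply: Csmooth_diff (sw i j) Xx. Qed.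

Section Closure.
Context (X : set V) (oX : open X).

Lemma smooth_cform_on F K : (forall y, X y -> F y = K y) -> smooth_cform X F -> smooth_cform X K.
Proof.
move=> FK [eF sF]; split=> [y Xy|s]; first by rewrite -FK //; apply: eF.
by apply: (Csmooth_ext oX _ (sF s)) => y Xy; rewrite FK.
Qed.

Lemma smooth_cform_D F K : smooth_cform X F -> smooth_cform X K -> smooth_cform X (fun y => F y + K y).
Proof.
move=> [eF sF] [eK sK]; split=> [y Xy|s]; first by apply: exteriorD; [apply: eF|apply: eK].
exact: Csmooth_add.
Qed.

Lemma smooth_cform_Z f F : Csmooth X f -> smooth_cform X F -> smooth_cform X (fun y => f y *: F y).
Proof.
move=> sf [eF sF]; split=> [y Xy|s]; first by apply: exteriorZ; apply: eF.
exact: Csmooth_mul.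
Qed.

Lemma smooth_cform_N F : smooth_cform X F -> smooth_cform X (fun y => - F y).
Proof.
move=> sF; have := smooth_cform_Z (@Csmooth_cst _ _ X (-1)) sF; apply: smooth_cform_on => y _.
exact: scaleN1r.
Qed.

Lemma smooth_cform_0 : smooth_cform X (fun=> 0).
Proof. by split=> [y _|s]; [exact: exterior0|exact: Csmooth_cst]. Qed.

Lemma smooth_cform_sum I (r : seq I) (F : I -> V -> form) : (forall i, smooth_cform X (F i)) ->
  smooth_cform X (fun y => \sum_(i <- r) F i y).
Proof.
move=> sF; elim: r => [|i r IHr].
  by apply: smooth_cform_on smooth_cform_0 => y _; rewrite big_nil.
by apply: smooth_cform_on (smooth_cform_D (sF i) IHr) => y _; rewrite big_cons.
Qed.

Lemma smooth_cform_contr u F : smooth_cform X F -> smooth_cform X (fun y => contr u (F y)).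
Proof. by move=> [eF sF]; split=> [y Xy|s]; [exact/contr_exterior/eF|exact: sF]. Qed.

Lemma Csmooth_covmul l F s : (forall s, Csmooth X (fun y => F y s)) ->
  Csmooth X (fun y => covmul l (F y) s).
Proof.
elim: s F => [|v s IHs] F sF /=; first exact: Csmooth_cst.
apply: Csmooth_add => //; first by apply: Csmooth_mul => //; exact: Csmooth_cst.
apply: Csmooth_opp => //; apply: (IHs (fun y => contr v (F y))) => t; exact: sF.
Qed.

Lemma smooth_cform_emul i F : smooth_cform X F -> smooth_cform X (fun y => emul i (F y)).
Proof.
move=> [eF sF]; split=> [y Xy|s]; first exact/exterior_emul/eF.
exact: Csmooth_covmul.
Qed.

Lemma der_expand_std g (a : form) : exterior a ->
  der (mulmx^~ g) a = \sum_l \sum_m g l m *: emul l (contr (e_ m) a).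
Proof.
move=> ea; rewrite der_expand //; apply: eq_bigr => l _.
rewrite contr_std // covmul_sum; apply: eq_bigr => m _.
by rewrite covmulZ -rowE mxE.
Qed.

Lemma contr_row g i (a : form) : exterior a ->
  contr (row i g) a = \sum_j g i j *: contr (e_ j) a.
Proof. by move=> ea; rewrite contr_std //; apply: eq_bigr => j _; rewrite mxE. Qed.

Lemma smooth_cform_der G F : smooth_cmx X G -> smooth_cform X F -> smooth_cform X (fun y => der (mulmx^~ (G y)) (F y)).
Proof.
move=> sG sF; apply: (@smooth_cform_on (fun y => \sum_l \sum_m G y l m *: emul l (contr (e_ m) (F y)))).
  by move=> y Xy; rewrite der_expand_std //; apply: (proj1 sF).
apply: smooth_cform_sum => l; apply: smooth_cform_sum => m; apply: (smooth_cform_Z (sG l m)).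
exact/smooth_cform_emul/smooth_cform_contr.
Qed.

Lemma smooth_cform_row w i F : smooth_cmx X w -> smooth_cform X F -> smooth_cform X (fun y => contr (row i (w y)) (F y)).
Proof.
move=> sw sF; apply: (@smooth_cform_on (fun y => \sum_j w y i j *: contr (e_ j) (F y))).
  by move=> y Xy; rewrite contr_row //; apply: (proj1 sF).
by apply: smooth_cform_sum => j; apply: (smooth_cform_Z (sw i j)); apply: smooth_cform_contr.
Qed.

Lemma smooth_cform_pder v F : smooth_cform X F -> smooth_cform X (pder v F).
Proof.
move=> sF; have [eF cF] := sF; split=> [y Xy|s]; last exact: Csmooth_derive.
exact: (pder_exterior v oX Xy (smooth_cform_diff_cform sF Xy) eF).
Qed.

Lemma smooth_cform_conn G v F : smooth_cmx X G -> smooth_cform X F -> smooth_cform X (fun y => conn (G y) v F y).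
Proof. by move=> sG sF; apply: smooth_cform_D; [exact: smooth_cform_pder|exact/smooth_cform_N/smooth_cform_der]. Qed.

Definition smooth_chform A := forall k, smooth_cform X (fun y => A y k).
Definition connH g v A x : H := fun k => conn g v (fun y => A y k) x.
(** Gam x i is the matrix of nabla along the i-th coordinate field. *)
Definition local_dh w (Gam : V -> 'I_n -> 'M[R]_n) A x : H :=
  \sum_i qmul (w x) i (connH (Gam x i) (e_ i) A x).

Lemma smooth_chform_qmul w i A : smooth_cmx X w -> smooth_chform A -> smooth_chform (fun y => qmul (w y) i (A y)).
Proof. by move=> sw sA k; apply: smooth_cform_D; [exact: smooth_cform_emul|exact: smooth_cform_row]. Qed.

Lemma smooth_chform_connH G v A : smooth_cmx X G -> smooth_chform A -> smooth_chform (fun y => connH (G y) v A y).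
Proof. by move=> sG sA k; apply: smooth_cform_conn. Qed.

Lemma smooth_chform_local_dh w Gam A : smooth_cmx X w -> (forall i, smooth_cmx X (fun y => Gam y i)) -> smooth_chform A ->
  smooth_chform (local_dh w Gam A).
Proof.
move=> sw sG sA k.
apply: (@smooth_cform_on (fun y => \sum_i qmul (w y) i (connH (Gam y i) (e_ i) A y) k)).
  by move=> y _; rewrite /local_dh hseries_sum.
by apply: smooth_cform_sum => i; apply: smooth_chform_qmul => //; apply: smooth_chform_connH.
Qed.

End Closure.

(** The covariant derivative of e^p is - \sum_l g_{lp} e^l. *)
Lemma conn_emul g v (p : 'I_n) F x : diff_cform F x ->
  conn g v (fun y => emul p (F y)) x = emul p (conn g v F x) - \sum_l g l p *: emul l (F x).
Proof.
move=> dF; rewrite /conn pder_covmul // (@der_covmul_crd _ _ _ g) // /emul covmulD covmulN.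
by rewrite opprD addrA.
Qed.

(** The field w(e^k, .) is the image of e^k by a parallel tensor, so its covariant
derivative has the same coefficients as that of e^k. *)
Lemma conn_row g v w X (k : 'I_n) F x : open X -> X x -> smooth_cform X F -> diff_cmx w x ->
  pderm v w x + w x *m g + g^T *m w x = 0 ->
  conn g v (fun y => contr (row k (w y)) (F y)) x =
  contr (row k (w x)) (conn g v F x) - \sum_l g l k *: contr (row l (w x)) (F x).
Proof.
move=> oX Xx sF dw cw; have eF := (proj1 sF) x Xx.
have dF := smooth_cform_diff_cform sF Xx.
have edF : exterior (conn g v F x) by exact: conn_exterior oX Xx dF (proj1 sF).
rewrite (@conn_on _ _ g v X _ (fun y => \sum_j w y k j *: contr (e_ j) (F y))) //; last first.
  by move=> y Xy; rewrite contr_row //; apply: (proj1 sF).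
rewrite conn_sum => [|j]; last by apply: (diff_cform_Z (f := fun y => w y k j)) => //; exact: diff_cform_contr.
have dc j : diff_cform (fun y => contr (e_ j) (F y)) x by exact: diff_cform_contr.
transitivity (\sum_j (pderm v w x k j *: contr (e_ j) (F x) +
    (w x k j *: contr (e_ j) (conn g v F x) + w x k j *: contr (e_ j *m g) (F x)))).
  apply: eq_bigr => j _; rewrite (conn_Z g v (f := fun y => w y k j)) ?conn_contr //.
  by rewrite scalerDr [pderm _ _ _ _ _]mxE.
rewrite !big_split /= -contr_row // -contr_row //.
have -> : \sum_j w x k j *: contr (e_ j *m g) (F x) = contr (row k (w x *m g)) (F x).
  by rewrite row_mul vec_mul contr_vsum //; apply: eq_bigr => j _; rewrite mxE.
have -> : \sum_l g l k *: contr (row l (w x)) (F x) = contr (row k (g^T *m w x)) (F x).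
  rewrite row_mul mulmx_sum_row contr_vsum //.
  by apply: eq_bigr => j _; rewrite !mxE.
have contrD a b : contr (a + b) (F x) = contr a (F x) + contr b (F x).
  by have := contr_lin 1 a b eF; rewrite !scale1r.
have c0 : contr 0 (F x) = 0 by have /esym/eqP := contrD 0 0; rewrite addr0 -subr_eq0 addrK => /eqP.
have : contr (row k (pderm v w x)) (F x) + contr (row k (w x *m g)) (F x) +
    contr (row k (g^T *m w x)) (F x) = 0.
  by rewrite -!contrD -!linearD /= cw linear0.
by move=> /eqP; rewrite addr_eq0 => /eqP <-; rewrite addrCA addrA addrC.
Qed.

(** Both parts of L_k depend on e^k through a parallel tensor, so nabla_v commutes with L
up to nabla_v e^k. *)
Lemma conn_qmul g v w X k A x m : open X -> X x -> smooth_chform X A -> smooth_cmx X w ->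
  pderm v w x + w x *m g + g^T *m w x = 0 ->
  conn g v (fun y => qmul (w y) k (A y) m) x =
  (qmul (w x) k (connH g v A x) - \sum_l g l k *: qmul (w x) l (A x)) m.
Proof.
move=> oX Xx sA sw cw; have dw := smooth_cmx_diff_cmx sw Xx.
have dA k' := smooth_cform_diff_cform (sA k') Xx.
rewrite conn_D; [|exact: diff_cform_covmul|exact: smooth_cform_diff_cform (smooth_cform_row oX k sw (sA (m - 1))) Xx].
rewrite conn_emul // (conn_row _ oX Xx (sA _) dw cw).
rewrite -[RHS]/(qmul (w x) k (connH g v A x) m - (\sum_l g l k *: qmul (w x) l (A x)) m) hseries_sum.
under [in RHS]eq_bigr => l _ do rewrite -[(_ *: _) m]/(_ *: (emul l (A x m) + contr (row l (w x)) (A x (m - 1)))) scalerDr.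
by rewrite big_split /= opprD addrACA.
Qed.

Lemma pder_der X v G F x : open X -> X x -> smooth_cform X F -> smooth_cmx X G ->
  pder v (fun y => der (mulmx^~ (G y)) (F y)) x =
  der (mulmx^~ (pderm v G x)) (F x) + der (mulmx^~ (G x)) (pder v F x).
Proof.
move=> oX Xx sF sG; have [eF _] := sF; have dF := smooth_cform_diff_cform sF Xx.
have dG := smooth_cmx_diff_cmx sG Xx.
have epF : exterior (pder v F x) by exact: pder_exterior oX Xx dF eF.
rewrite (@pder_on _ _ X v _ (fun y => \sum_l \sum_m G y l m *: emul l (contr (e_ m) (F y)))) //; last first.
  by move=> y Xy; rewrite der_expand_std //; apply: eF.
have d2 l m : diff_cform (fun y => G y l m *: emul l (contr (e_ m) (F y))) x.
  by apply: (diff_cform_Z (f := fun y => G y l m)) => //; exact/diff_cform_covmul/diff_cform_contr.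
rewrite pder_sum => [|l]; last exact: diff_cform_sum.
rewrite (der_expand_std _ (eF x Xx)) (der_expand_std _ epF) -big_split; apply: eq_bigr => l _.
rewrite pder_sum //= -big_split; apply: eq_bigr => m _.
have dE : diff_cform (fun y => emul l (contr (e_ m) (F y))) x by exact/diff_cform_covmul/diff_cform_contr.
rewrite (pder_Z v (f := fun y => G y l m)) //.
by rewrite mxE /= pder_covmul //; exact: diff_cform_contr.
Qed.

(** The first derivatives of F cancel in the commutator, and second derivatives are
assumed to commute; what is left is the action of the curvature. *)
Lemma conn_comm X (u v x : V) (G K : V -> 'M[R]_n) F : open X -> X x -> smooth_cform X F ->
  smooth_cmx X G -> smooth_cmx X K -> pder u (pder v F) x = pder v (pder u F) x ->
  conn (G x) u (fun y => conn (K y) v F y) x - conn (K x) v (fun y => conn (G y) u F y) x =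
  - der (mulmx^~ (pderm u K x - pderm v G x - (G x *m K x - K x *m G x))) (F x).
Proof.
move=> oX Xx sF sG sK schwarz; have [eF _] := sF.
(* all the terms of a second covariant derivative *)
have conn2 (s t : V) (G' K' : V -> 'M[R]_n) : smooth_cmx X G' -> smooth_cmx X K' ->
    conn (G' x) s (fun y => conn (K' y) t F y) x =
    pder s (pder t F) x - (der (mulmx^~ (pderm s K' x)) (F x) + der (mulmx^~ (K' x)) (pder s F x))
    - (der (mulmx^~ (G' x)) (pder t F x) - der (mulmx^~ (G' x)) (der (mulmx^~ (K' x)) (F x))).
  move=> sG' sK'; have dd := smooth_cform_diff_cform (smooth_cform_der oX sK' sF) Xx.
  rewrite /conn pder_D; [|exact: smooth_cform_diff_cform (smooth_cform_pder oX t sF) Xx|exact: diff_cform_N].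
  by rewrite (pder_N s dd) (pder_der s oX Xx sF sK') derD derN.
rewrite (conn2 u v G K sG sK) (conn2 v u K G sK sG) schwarz.
have derB (a b : 'M[R]_n) : der (mulmx^~ (a - b)) (F x) = der (mulmx^~ a) (F x) - der (mulmx^~ b) (F x).
  rewrite !(der_expand_std _ (eF x Xx)) -sumrB.
  apply: eq_bigr => l _; rewrite -sumrB; apply: eq_bigr => m _.
  by rewrite !mxE scalerBl.
rewrite derB -(der_comm (G x) (K x) (eF x Xx)) derB.
apply/funext => s; rewrite !formE; ring.
Qed.

Lemma pderm_mul v (G K : V -> 'M[R]_n) x : diff_cmx G x -> diff_cmx K x ->
  pderm v (fun y => G y *m K y) x = pderm v G x *m K x + G x *m pderm v K x.
Proof.
move=> dG dK; apply/matrixP => i j; rewrite !mxE -big_split /=.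
have -> : (fun y => (G y *m K y) i j) = \sum_k ((fun y => G y i k) * (fun y => K y k j) : V -> R^o).
  by apply/funext => y; rewrite mxE fct_sumE.
rewrite derive_sum => [|k]; last by apply: derivableM; apply: diff_derivable.
apply: eq_bigr => k _; rewrite deriveM; [|exact: diff_derivable|exact: diff_derivable].
by rewrite !mxE addrC; congr (_ + _); rewrite mulrC.
Qed.

Lemma pderm_add v (G K : V -> 'M[R]_n) x : diff_cmx G x -> diff_cmx K x ->
  pderm v (fun y => G y + K y) x = pderm v G x + pderm v K x.
Proof.
move=> dG dK; apply/matrixP => i j; rewrite !mxE.
rewrite -deriveD; [|exact: diff_derivable|exact: diff_derivable].
by congr ('D_v _ x); apply/funext => y; rewrite mxE.
Qed.

Lemma pderm_opp v (G : V -> 'M[R]_n) x : diff_cmx G x ->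
  pderm v (fun y => - G y) x = - pderm v G x.
Proof.
move=> dG; apply/matrixP => i j; rewrite !mxE.
rewrite -deriveN; last exact: diff_derivable.
by congr ('D_v _ x); apply/funext => y; rewrite mxE.
Qed.

Lemma pderm_tr v (G : V -> 'M[R]_n) x : pderm v (fun y => (G y)^T) x = (pderm v G x)^T.
Proof.
apply/matrixP => i j; rewrite !mxE.
by congr ('D_v _ x); apply/funext => y; rewrite mxE.
Qed.

Lemma pderm_on X v (G K : V -> 'M[R]_n) x : open X -> (forall y, X y -> G y = K y) -> X x ->
  pderm v G x = pderm v K x.
Proof.
move=> oX GK Xx; apply/matrixP => i j; rewrite !mxE.
by apply: (derive_on _ oX) => // y Xy; rewrite GK.
Qed.

Lemma diff_cmx_mul (G K : V -> 'M[R]_n) x : diff_cmx G x -> diff_cmx K x -> diff_cmx (fun y => G y *m K y) x.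
Proof.
move=> dG dK i j.
have -> : (fun y => (G y *m K y) i j) = \sum_k ((fun y => G y i k) * (fun y => K y k j) : V -> R^o).
  by apply/funext => y; rewrite mxE fct_sumE.
by apply: differentiable_sum => k; apply: differentiableM.
Qed.

Lemma diff_cmx_tr (G : V -> 'M[R]_n) x : diff_cmx G x -> diff_cmx (fun y => (G y)^T) x.
Proof.
by move=> dG i j; have := dG j i; congr (differentiable _ x); apply/funext => y; rewrite mxE.
Qed.

End SmoothCoordinateForms.

(** * The square of the quantum differential in coordinates *)

Section CoordinateSquare.
Context (R : realType) (n : nat).
Local Notation V := 'rV[R]_n.
Local Notation form := (seq V -> R^o).
Local Notation H := (int -> form).
Local Notation e_ := (std R).
Implicit Types (f : V -> R^o) (F K : V -> form) (u v x : V) (X : set V).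
Implicit Types (g : 'M[R]_n) (w G : V -> 'M[R]_n) (A : V -> H).

Lemma qmulZ (w0 : 'M[R]_n) (i : 'I_n) c (B : H) : qmul w0 i (c *: B) = c *: qmul w0 i B.
Proof. exact: linearZ. Qed.

Section Square.
Context (X : set V) (oX : open X) (w : V -> 'M[R]_n) (Gam : V -> 'I_n -> 'M[R]_n).
Context (sw : smooth_cmx X w) (sG : forall i, smooth_cmx X (fun y => Gam y i)).
Context (wT : forall y, X y -> (w y)^T = - w y).
Context (parallel : forall y i, X y ->
  pderm (e_ i) w y + w y *m Gam y i + (Gam y i)^T *m w y = 0).
Context (Gsym : forall y (i l : 'I_n), X y -> row l (Gam y i) = row i (Gam y l)).
Context (schwarz : forall f, Csmooth X f -> forall (i k : 'I_n) y, X y ->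
  'D_(e_ i) (fun z => 'D_(e_ k) f z : R^o) y = 'D_(e_ k) (fun z => 'D_(e_ i) f z : R^o) y).

Lemma pderm_entry v (G : V -> 'M[R]_n) x i j :
  pderm v G x i j = 'D_v (fun y => G y i j : R^o) x.
Proof. by rewrite mxE. Qed.

(** The curvature on row vectors.  The products occur in the order opposite to the
customary one because matrices act from the right. *)
Definition curv x (i k : 'I_n) : 'M[R]_n :=
  pderm (e_ i) (fun y => Gam y k) x - pderm (e_ k) (fun y => Gam y i) x -
  (Gam x i *m Gam x k - Gam x k *m Gam x i).

(** Derivatives and products of the Gam cancel in pairs after exchanging their
lower indices. *)
Lemma curv_bianchi x (i k l : 'I_n) : X x ->
  row l (curv x i k) + row i (curv x k l) + row k (curv x l i) = 0.
Proof.
move=> Xx; apply/rowP => j; rewrite /curv.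
have Gs y (a b c : 'I_n) : X y -> Gam y a b c = Gam y b a c.
  by move=> Xy; have /rowP/(_ c) := Gsym a b Xy; rewrite !mxE.
have ds (a b c : 'I_n) : 'D_(e_ a) (fun y => Gam y b c j : R^o) x = 'D_(e_ a) (fun y => Gam y c b j : R^o) x.
  by apply: (derive_on _ oX) => // y Xy; apply: Gs.
(* the exchange of lower indices, for derivatives in ds, for products here *)
have ps (a b c : 'I_n) : (Gam x a *m Gam x b) c j = (Gam x c *m Gam x b) a j.
  by rewrite !mxE; apply: eq_bigr => q _; rewrite Gs.
have cE (a b c : 'I_n) : row c (curv x a b) 0 j =
    'D_(e_ a) (fun y => Gam y b c j : R^o) x - 'D_(e_ b) (fun y => Gam y a c j : R^o) x
    - ((Gam x a *m Gam x b) c j - (Gam x b *m Gam x a) c j).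
  have eqE (A1 A2 A3 A4 : 'M[R]_n) : row c (A1 - A2 - (A3 - A4)) 0 j = A1 c j - A2 c j - (A3 c j - A4 c j).
    by rewrite !mxE.
  by rewrite /curv eqE [pderm _ _ _ _ _]mxE [pderm (e_ b) _ _ _ _]mxE.
rewrite mxE [X in X + _]mxE [RHS]mxE !cE.
rewrite (ds k) (ds l) (ds i) (ps i k l) (ps k l i) (ps l i k).
by ring.
Qed.

(** The curvature is the obstruction to solving the parallelism equation for w:
differentiating that equation once more and using the symmetry of second derivatives of
w leaves the action of the curvature on w. *)
Lemma curv_parallel x i k : X x -> w x *m curv x i k + (curv x i k)^T *m w x = 0.
Proof.
move=> Xx.
have dw := smooth_cmx_diff_cmx sw Xx; have dG j := smooth_cmx_diff_cmx (sG j) Xx.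
have pw y j : X y -> pderm (e_ j) w y = - (w y *m Gam y j + (Gam y j)^T *m w y).
  by move=> Xy; apply/eqP; rewrite -addr_eq0 addrA parallel.
have p2 a b : pderm (e_ a) (pderm (e_ b) w) x =
   - ((- (w x *m Gam x a + (Gam x a)^T *m w x)) *m Gam x b + w x *m pderm (e_ a) (fun y => Gam y b) x
    + ((pderm (e_ a) (fun y => Gam y b) x)^T *m w x - (Gam x b)^T *m (w x *m Gam x a + (Gam x a)^T *m w x))).
  have dwG : diff_cmx (fun y => w y *m Gam y b) x by exact: diff_cmx_mul.
  have dT : diff_cmx (fun y => (Gam y b)^T) x by exact: diff_cmx_tr.
  have dGw : diff_cmx (fun y => (Gam y b)^T *m w y) x by exact: diff_cmx_mul.
  rewrite (pderm_on (e_ a) oX (fun y => pw y b) Xx).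
  rewrite (pderm_opp (e_ a) (G := fun y => w y *m Gam y b + (Gam y b)^T *m w y)); last first.
    move=> p q; have -> : (fun y => (w y *m Gam y b + (Gam y b)^T *m w y) p q) =
      (fun y => (w y *m Gam y b) p q) + (fun y => ((Gam y b)^T *m w y) p q).
      by apply/funext => y; rewrite mxE.
    exact: differentiableD.
  rewrite (pderm_add (e_ a) dwG dGw) (pderm_mul (e_ a) dw (dG b)) (pderm_mul (e_ a) dT dw) pderm_tr.
  by rewrite pw // mulmxN.
(* the symmetry of second derivatives, to be compared with the formula p2 *)
have p2s : pderm (e_ i) (pderm (e_ k) w) x = pderm (e_ k) (pderm (e_ i) w) x.
  apply/matrixP => p q.
  have eqE a b : 'D_(e_ a) (fun y => pderm (e_ b) w y p q : R^o) x =
      'D_(e_ a) (fun y => 'D_(e_ b) (fun z => w z p q : R^o) y : R^o) x.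
    by congr ('D_ _ _ x); apply/funext => y; rewrite pderm_entry.
  exact: (etrans (pderm_entry (e_ i) (pderm (e_ k) w) x p q) (etrans (eqE i k) (etrans (schwarz (sw p q) i k Xx) (etrans (esym (eqE k i)) (esym (pderm_entry (e_ k) (pderm (e_ i) w) x p q)))))).
move: p2s; rewrite !p2 /curv.
have addmxE (A1 A2 : 'M[R]_n) a b : (A1 + A2) a b = A1 a b + A2 a b by rewrite mxE.
have oppmxE (A1 : 'M[R]_n) a b : (- A1) a b = - A1 a b by rewrite mxE.
have zeromxE a b : (0 : 'M[R]_n) a b = 0 by rewrite mxE.
have trB (A1 A2 : 'M[R]_n) : (A1 - A2)^T = A1^T - A2^T by rewrite linearB.
rewrite !trB !trmx_mul.
rewrite !(mulmxDl, mulmxDr, mulmxBl, mulmxBr, mulNmx, mulmxN) !mulmxA => p2s.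
apply/matrixP => a b; have /matrixP/(_ a b) := p2s.
by rewrite !(addmxE, oppmxE, zeromxE); lra.
Qed.

Lemma curv_sym x i k : X x -> (w x *m curv x i k)^T = w x *m curv x i k.
Proof.
move=> Xx; have := curv_parallel i k Xx => /eqP; rewrite addr_eq0 => /eqP ->.
by rewrite linearN /= trmx_mul trmxK wT // mulNmx opprK -[RHS]opprK -mulNmx;
  have := curv_parallel i k Xx => /eqP; rewrite addr_eq0 => /eqP ->; rewrite mulNmx !opprK.
Qed.

(** The coefficients Gam i l k are symmetric in i and l, where L_i L_l is
antisymmetric. *)
Lemma qmul2_sym_eq0 x (B : 'I_n -> H) (k : 'I_n) : X x -> exteriorH (B k) ->
  \sum_i \sum_l qmul (w x) i (qmul (w x) l (Gam x i l k *: B k)) = 0.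
Proof.
move=> Xx eB; apply: (@qmul2_sum_eq0 _ _ (w x) (fun i l => Gam x i l k *: B k) (fun _ _ => 0)).
- exact: wT.
- by move=> i l m; apply: exteriorZ; exact: eB.
- move=> i l; have /rowP/(_ k) := Gsym i l Xx; rewrite !mxE => ->.
  by rewrite subrr.
- by rewrite big1 // => i _; rewrite big1 // => l _; rewrite !qmul0.
Qed.

(** Moving the outer derivative through L_k produces the first-order term that
[qmul2_sym_eq0] removes. *)
Lemma connH_local_dh x A (i : 'I_n) : X x -> smooth_chform X A ->
  connH (Gam x i) (e_ i) (local_dh w Gam A) x =
  \sum_k qmul (w x) k (connH (Gam x i) (e_ i) (fun y => connH (Gam y k) (e_ k) A y) x) -
  \sum_k \sum_l Gam x i l k *: qmul (w x) l (connH (Gam x k) (e_ k) A x).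
Proof.
move=> Xx sA; rewrite -sumrB; apply/funext => m; rewrite hseries_sum.
pose C k y := connH (Gam y k) (e_ k) A y.
have sC k : smooth_chform X (C k) by exact: (smooth_chform_connH oX (e_ k) (sG k) sA).
have dL k : diff_cform (fun y => qmul (w y) k (C k y) m) x.
  exact: smooth_cform_diff_cform (smooth_chform_qmul oX k sw (sC k) m) Xx.
transitivity (conn (Gam x i) (e_ i) (fun y => \sum_k qmul (w y) k (C k y) m) x).
  by congr (conn _ _ _ x); apply/funext => y; rewrite /local_dh hseries_sum.
rewrite (conn_sum _ _ _ dL); apply: eq_bigr => k _.
exact: (conn_qmul k m oX Xx (sC k) sw (parallel i Xx)).
Qed.

(** After the first-order term is gone, only the commutators of covariant derivatives
enter, and [curvature_qmul_eq0] removes them. *)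
Theorem local_dh_sq x A : X x -> smooth_chform X A -> local_dh w Gam (local_dh w Gam A) x = 0.
Proof.
move=> Xx sA.
pose C k y := connH (Gam y k) (e_ k) A y.
have sC k : smooth_chform X (C k) by exact: (smooth_chform_connH oX (e_ k) (sG k) sA).
have eA : exteriorH (A x) by move=> k; apply: (proj1 (sA k)).
have eC k : exteriorH (C k x) by move=> m; apply: (proj1 (sC k m)).
rewrite {1}/local_dh.
transitivity (\sum_i (\sum_k qmul (w x) i (qmul (w x) k (connH (Gam x i) (e_ i) (C k) x)) -
   \sum_k \sum_l qmul (w x) i (qmul (w x) l (Gam x i l k *: C k x)))).
  apply: eq_bigr => i _; rewrite connH_local_dh // qmulD qmulN !qmul_sum; congr (_ - _).
  apply: eq_bigr => k _; rewrite qmul_sum; apply: eq_bigr => l _.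
  by rewrite (qmulZ (w x) l).
rewrite sumrB [X in _ - X](_ : _ = 0) ?subr0.
  apply: (@qmul2_sum_eq0 _ _ (w x) (fun i k => connH (Gam x i) (e_ i) (C k) x)
    (fun i k => - derH (mulmx^~ (curv x i k)) (A x))).
  - exact: wT.
  - move=> i k m; apply: (conn_exterior _ _ oX Xx); last exact: (proj1 (sC k m)).
    exact: smooth_cform_diff_cform (sC k m) Xx.
  - move=> i k; apply/funext => m.
    apply: (@conn_comm _ _ X (e_ i) (e_ k) x (fun y => Gam y i) (fun y => Gam y k)
       (fun y => A y m) oX Xx (sA m) (sG i) (sG k)).
    by apply/funext => s; exact: (schwarz (proj2 (sA m) s) i k Xx).
  - transitivity (- \sum_i \sum_k qmul (w x) i (qmul (w x) k (derH (mulmx^~ (curv x i k)) (A x)))).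
      rewrite -sumrN; apply: eq_bigr => i _; rewrite -sumrN; apply: eq_bigr => k _.
      by rewrite !qmulN.
    rewrite (@curvature_qmul_eq0 _ _ _ (curv x)) ?oppr0 //; first exact: wT.
    + by move=> i k; apply: curv_sym.
    + by move=> i k l; apply: curv_bianchi.
rewrite exchange_big /= big1 // => k _; exact: (@qmul2_sym_eq0 x (fun k => C k x) k Xx (eC k)).
Qed.

End Square.
End CoordinateSquare.

(** * Charts and their transition maps *)

Section Charts.
Context (R : realType) (n : nat) (M : topologicalType) (A : manifold R n M).
Local Notation V := 'rV[R]_n.
Local Notation e_ := (std R).
Implicit Types (c : atlas A) (p q : M) (U W : set M) (u v x : V).

Definition chart_image c U : set V := chart c @` (dom c `&` U).
Definition transition c c' : V -> V := chart c' \o chart_inv c.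

Lemma chart_image_chart c U p : dom c p -> U p -> chart_image c U (chart c p).
Proof. by move=> cp Up; exists p. Qed.

Lemma chart_image_inv c U x : chart_image c U x ->
  [/\ dom c (chart_inv c x), U (chart_inv c x) & chart c (chart_inv c x) = x].
Proof. by move=> [p [cp Up] <-]; rewrite chartK. Qed.

Lemma chart_image_open c U : open U -> open (chart_image c U).
Proof.
move=> oU; rewrite openE => x cx; have [p [cp Up] px] := cx.
have xc : (chart c @` dom c) x by exists p.
have n1 : nbhs x (chart c @` dom c) by apply: open_nbhs_nbhs; split=> //; exact: codom_open.
have n2 : nbhs x (chart_inv c @^-1` U).
  apply: (chart_inv_continuous xc); apply: open_nbhs_nbhs; split => //.
  by rewrite -px chartK.
apply: filterS2 n1 n2 => y [q cq qy] /= Uy; exists q => //; split=> //.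
by rewrite -(chartK cq) qy.
Qed.

Lemma transition_Csmooth c c' j : Csmooth (chart_image c (dom c')) (fun x => transition c c' x 0 j).
Proof. exact: transition_smooth. Qed.

Lemma transition_diff c c' p : dom c p -> dom c' p -> differentiable (transition c c') (chart c p).
Proof.
move=> cp c'p; apply: differentiable_rV => j.
exact: Csmooth_diff (@transition_Csmooth c c' j) (chart_image_chart cp c'p).
Qed.

Lemma transitionE c c' p : dom c p -> transition c c' (chart c p) = chart c' p.
Proof. by move=> cp; rewrite /transition /= chartK. Qed.

Lemma jacE c c' p v : dom c p -> dom c' p ->
  v *m jac c c' p = 'D_v (transition c c') (chart c p).
Proof. by move=> cp c'p; rewrite -deriveEjacobian //; exact: transition_diff. Qed.

Lemma jac_entry c c' p (i j : 'I_n) : dom c p -> dom c' p ->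
  jac c c' p i j = 'D_(e_ i) (fun x => transition c c' x 0 j : R^o) (chart c p).
Proof.
move=> cp c'p; rewrite -derive_rV; last exact: transition_diff.
by rewrite -jacE // -rowE [RHS]mxE.
Qed.

Lemma derive_transition c c' (f : M -> R^o) p v : dom c p -> dom c' p ->
  differentiable (f \o chart_inv c') (chart c' p) ->
  'D_v (f \o chart_inv c : V -> R^o) (chart c p) =
  'D_(v *m jac c c' p) (f \o chart_inv c' : V -> R^o) (chart c' p).
Proof.
move=> cp c'p df; rewrite jacE // -[in RHS](transitionE c' cp).
rewrite -derive_chain; [|exact: transition_diff|by rewrite transitionE].
apply: (derive_on _ (chart_image_open (c:=c) (dom_open c'))); last exact: chart_image_chart.
by move=> y /chart_image_inv [cy c'y _]; rewrite /transition /= chartK.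
Qed.

Lemma derive_coord (x v : V) (j : 'I_n) : 'D_v (fun y : V => y 0 j : R^o) x = v 0 j.
Proof. by rewrite -(@derive_rV _ _ id) ?derive_id. Qed.

(** The chain rule, entry by entry. *)
Lemma jac_comp c c' c'' p : dom c p -> dom c' p -> dom c'' p ->
  jac c c' p *m jac c' c'' p = jac c c'' p.
Proof.
move=> cp c'p c''p; apply/matrixP => i j.
rewrite [RHS]jac_entry //.
rewrite (@derive_transition c c' (fun q => chart c'' q 0 j)) //; last first.
  exact: Csmooth_diff (@transition_Csmooth c' c'' j) (chart_image_chart c'p c''p).
rewrite derive_std; last first.
  exact: Csmooth_diff (@transition_Csmooth c' c'' j) (chart_image_chart c'p c''p).
rewrite [LHS]mxE; apply: eq_bigr => k _; rewrite -rowE [row i _ 0 k]mxE; congr (_ * _).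
by rewrite jac_entry.
Qed.

Lemma jac_id c p : dom c p -> jac c c p = 1%:M.
Proof.
move=> cp; apply/matrixP => i j; rewrite jac_entry //.
rewrite (@derive_on _ _ (chart_image c (dom c)) _ (fun y => y 0 j)); last exact: chart_image_chart.
- by rewrite derive_coord std_crd [RHS]mxE.
- exact/chart_image_open/dom_open.
- by move=> y /chart_image_inv [_ _ yy]; rewrite /transition /= yy.
Qed.

Lemma jacK c c' p : dom c p -> dom c' p -> jac c c' p *m jac c' c p = 1%:M.
Proof. by move=> cp c'p; rewrite jac_comp // jac_id. Qed.

Lemma jac_unit c c' p : dom c p -> dom c' p -> jac c c' p \in unitmx.
Proof. by move=> cp c'p; exact: (proj1 (mulmx1_unit (jacK cp c'p))). Qed.

Lemma dir_derivE c p v (f : M -> R) : dom c p ->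
  differentiable (f \o chart_inv (chart_at A p) : V -> R^o) (chart (chart_at A p) p) ->
  dir_deriv A p (v *m jac c (chart_at A p) p) f = 'D_v (f \o chart_inv c : V -> R^o) (chart c p).
Proof. by move=> cp df; rewrite (derive_transition v cp (dom_chart_at A p)). Qed.

(** On the domain of one chart smoothness in that chart suffices: the other
local expressions are compositions with transition maps. *)
Lemma smooth_fun_chart c U (f : M -> R) : open U -> (forall p, U p -> dom c p) ->
  Csmooth (chart_image c U) (f \o chart_inv c) -> smooth_fun A U f.
Proof.
move=> oU Uc sf c'.
apply: (@Csmooth_ext _ _ _ ((f \o chart_inv c) \o transition c' c)).
- exact: chart_image_open.
- by move=> y /chart_image_inv [c'y Uy yy]; rewrite /transition /= chartK //; apply: Uc.
- apply: (Csmooth_comp (W := chart_image c U)) => //; first exact: chart_image_open.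
    move=> j; apply: Csmooth_sub (@transition_Csmooth c' c j) => x [q [c'q Uq] <-].
    by apply: chart_image_chart => //; apply: Uc.
  by move=> x [q [c'q Uq] <-]; rewrite transitionE //; apply: chart_image_chart => //; apply: Uc.
Qed.

Lemma smooth_fun_diff c U (f : M -> R) p : smooth_fun A U f -> U p -> dom c p ->
  differentiable (f \o chart_inv c : V -> R^o) (chart c p).
Proof. by move=> sf Up cp; apply: Csmooth_diff (sf c) (chart_image_chart cp Up). Qed.

Lemma smooth_fun_on U (f g : M -> R) : open U -> (forall p, U p -> f p = g p) ->
  smooth_fun A U f -> smooth_fun A U g.
Proof.
move=> oU fg sf c; apply: (Csmooth_ext _ _ (sf c)); first exact: chart_image_open.
by move=> y /chart_image_inv [_ Uy _] /=; apply: fg.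
Qed.

Lemma smooth_fun_sub U W (f : M -> R) : (forall p, U p -> W p) ->
  smooth_fun A W f -> smooth_fun A U f.
Proof.
move=> UW sf c; apply: Csmooth_sub (sf c) => x [p [cp Up] <-].
by apply: chart_image_chart => //; apply: UW.
Qed.

Lemma smooth_fun_cst U (a : R) : smooth_fun A U (fun=> a).
Proof. by move=> c; apply: Csmooth_cst. Qed.

Lemma smooth_fun_add U (f g : M -> R) : open U -> smooth_fun A U f -> smooth_fun A U g ->
  smooth_fun A U (fun p => f p + g p).
Proof.
by move=> oU sf sg c; apply: (Csmooth_add (chart_image_open (c:=c) oU) (sf c) (sg c)).
Qed.

Lemma smooth_fun_mul U (f g : M -> R) : open U -> smooth_fun A U f -> smooth_fun A U g ->
  smooth_fun A U (fun p => f p * g p).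
Proof.
by move=> oU sf sg c; apply: (Csmooth_mul (chart_image_open (c:=c) oU) (sf c) (sg c)).
Qed.

Lemma smooth_fun_sum U I (r : seq I) (f : I -> M -> R) : open U ->
  (forall i, smooth_fun A U (f i)) -> smooth_fun A U (fun p => \sum_(i <- r) f i p).
Proof.
move=> oU sf; elim: r => [|i r IHr].
  by apply: (smooth_fun_on oU _ (@smooth_fun_cst U 0)) => p _; rewrite big_nil.
by apply: (smooth_fun_on oU _ (smooth_fun_add oU (sf i) IHr)) => p _; rewrite big_cons.
Qed.

Lemma smooth_coord c j : smooth_fun A (dom c) (fun p => chart c p 0 j).
Proof. by move=> c'; apply: transition_smooth. Qed.

Lemma smooth_jac c c' i j : smooth_fun A (dom c `&` dom c') (fun p => jac c c' p i j).
Proof.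
have oI : open (dom c `&` dom c') by apply: openI; exact: dom_open.
apply: (smooth_fun_chart (c := c)) => //; first by move=> p [].
apply: (Csmooth_ext (chart_image_open (c:=c) oI) _ (Csmooth_derive (e_ i) (chart_image_open (c:=c) oI) _)); last first.
  apply: Csmooth_sub (@transition_Csmooth c c' j) => x [p [cp [_ c'p]] <-].
  exact: chart_image_chart.
by move=> y /chart_image_inv [cy [_ c'y] yy] /=; rewrite jac_entry // yy.
Qed.

(** The vector field with constant components u in the chart c, a linear combination of
coordinate fields. *)
Definition cfield c u : M -> V := fun q => u *m jac c (chart_at A q) q.

(** Its components in any other chart are given by the chain rule. *)
Lemma cfield_jac c c' u p : dom c p -> dom c' p ->
  cfield c u p *m jac (chart_at A p) c' p = u *m jac c c' p.
Proof. by move=> cp c'p; rewrite -mulmxA jac_comp //; exact: dom_chart_at. Qed.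

Lemma smooth_cfield c u : smooth_vf A (dom c) (cfield c u).
Proof.
move=> c' i.
have oI : open (dom c' `&` dom c) by apply: openI; exact: dom_open.
apply: (@smooth_fun_on _ (fun p => \sum_k u 0 k * jac c c' p k i)) => //.
  by move=> p [c'p cp]; rewrite cfield_jac // mxE.
apply: smooth_fun_sum => // k; apply: smooth_fun_mul => //; first exact: smooth_fun_cst.
by apply: smooth_fun_sub (@smooth_jac c c' k i) => p [].
Qed.

End Charts.

(** * Vector fields, forms and tensoriality *)

Section FieldsAndForms.
Context (R : realType) (n : nat) (M : topologicalType) (A : manifold R n M).
Local Notation V := 'rV[R]_n.
Local Notation e_ := (std R).
Local Notation form := (seq V -> R^o).
Implicit Types (c : atlas A) (p q : M) (U W : set M) (u v x z : V).
Implicit Types (X Y Z : M -> V) (a b : M -> form).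

Lemma smooth_vf_sub U W Y : (forall p, U p -> W p) -> smooth_vf A W Y -> smooth_vf A U Y.
Proof. by move=> UW sY c i; apply: smooth_fun_sub (sY c i) => p [cp /UW]. Qed.

Lemma smooth_vf_on U Y Z : open U -> (forall p, U p -> Y p = Z p) ->
  smooth_vf A U Y -> smooth_vf A U Z.
Proof.
move=> oU YZ sY c i; apply: smooth_fun_on (sY c i).
  by apply: openI => //; exact: dom_open.
by move=> p [_ Up]; rewrite YZ.
Qed.

Lemma smooth_vf_scale U f Y : open U -> smooth_fun A U f -> smooth_vf A U Y ->
  smooth_vf A U (fun p => f p *: Y p).
Proof.
move=> oU sf sY c i; have oI : open (dom c `&` U) by apply: openI => //; exact: dom_open.
apply: (smooth_fun_on oI _ (smooth_fun_mul oI (smooth_fun_sub _ sf) (sY c i))).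
  by move=> p _; rewrite -scalemxAl [RHS]mxE.
by move=> p [].
Qed.

Lemma smooth_vf_add U Y Z : open U -> smooth_vf A U Y -> smooth_vf A U Z ->
  smooth_vf A U (Y \+ Z).
Proof.
move=> oU sY sZ c i; have oI : open (dom c `&` U) by apply: openI => //; exact: dom_open.
by apply: (smooth_fun_on oI _ (smooth_fun_add oI (sY c i) (sZ c i))) => p _; rewrite mulmxDl [RHS]mxE.
Qed.

Lemma smooth_vf_0 U : open U -> smooth_vf A U (fun=> 0).
Proof.
move=> oU c i; have oI : open (dom c `&` U) by apply: openI => //; exact: dom_open.
by apply: (smooth_fun_on oI _ (@smooth_fun_cst _ _ _ A _ 0)) => p _; rewrite mul0mx [RHS]mxE.
Qed.

Lemma smooth_vf_sum U I (r : seq I) (f : I -> M -> R) (Y : I -> M -> V) : open U ->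
  (forall i, smooth_fun A U (f i)) -> (forall i, smooth_vf A U (Y i)) ->
  smooth_vf A U (fun p => \sum_(i <- r) f i p *: Y i p).
Proof.
move=> oU sf sY; elim: r => [|i r IHr].
  by apply: (smooth_vf_on oU _ (smooth_vf_0 oU)) => p _; rewrite big_nil.
apply: (smooth_vf_on oU _ (smooth_vf_add oU (smooth_vf_scale oU (sf i) (sY i)) IHr)).
by move=> p _; rewrite big_cons.
Qed.

Lemma dir_deriv_on U p z f g : open U -> U p -> (forall q, U q -> f q = g q) ->
  dir_deriv A p z f = dir_deriv A p z g.
Proof.
move=> oU Up fg; apply: (derive_on z (chart_image_open (c := chart_at A p) oU)).
  by move=> x /chart_image_inv [_ Ux _] /=; apply: fg.
by apply: chart_image_chart => //; exact: dom_chart_at.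
Qed.

Lemma smooth_fun_diff_at U f p : smooth_fun A U f -> U p ->
  differentiable (f \o chart_inv (chart_at A p) : V -> R^o) (chart (chart_at A p) p).
Proof. by move=> sf Up; apply: smooth_fun_diff sf Up _; exact: dom_chart_at. Qed.

Lemma dir_deriv_cst p z k : dir_deriv A p z (fun=> k) = 0.
Proof. exact: derive_cst. Qed.

Lemma dir_deriv_add U p z f g : smooth_fun A U f -> smooth_fun A U g -> U p ->
  dir_deriv A p z (fun q => f q + g q) = dir_deriv A p z f + dir_deriv A p z g.
Proof.
move=> sf sg Up; have df := smooth_fun_diff_at sf Up; have dg := smooth_fun_diff_at sg Up.
by have eqE := deriveD (diff_derivable (v:=z) df) (diff_derivable (v:=z) dg); rewrite /dir_deriv -eqE.
Qed.

Lemma dir_deriv_mul U p z f g : smooth_fun A U f -> smooth_fun A U g -> U p ->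
  dir_deriv A p z (fun q => f q * g q) = dir_deriv A p z f * g p + f p * dir_deriv A p z g.
Proof.
move=> sf sg Up; have df := smooth_fun_diff_at sf Up; have dg := smooth_fun_diff_at sg Up.
have := deriveM (diff_derivable (v:=z) df) (diff_derivable (v:=z) dg) => eqE.
rewrite /dir_deriv; transitivity ('D_z ((f \o chart_inv (chart_at A p)) * (g \o chart_inv (chart_at A p)) : V -> R^o) (chart (chart_at A p) p)) => //.
rewrite eqE addrC /= chartK; last exact: dom_chart_at.
by rewrite /GRing.scale /= [_ * g p]mulrC.
Qed.

Lemma dir_deriv_sum U p z I (r : seq I) (f : I -> M -> R) : open U ->
  (forall i, smooth_fun A U (f i)) -> U p ->
  dir_deriv A p z (fun q => \sum_(i <- r) f i q) = \sum_(i <- r) dir_deriv A p z (f i).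
Proof.
move=> oU sf Up; elim: r => [|i r IHr].
  rewrite big_nil; transitivity (dir_deriv A p z (fun=> 0)); last exact: dir_deriv_cst.
  by apply: (dir_deriv_on z oU) => // q _; rewrite big_nil.
rewrite big_cons -IHr -(dir_deriv_add z (sf i) (smooth_fun_sum r oU sf) Up).
by apply: (dir_deriv_on z oU) => // q _; rewrite big_cons.
Qed.

Section Connection.
Context (nab : connection A).

Lemma nabla_sum U p z I (r : seq I) (f : I -> M -> R) (Y : I -> M -> V) : open U -> U p ->
  (forall i, smooth_fun A U (f i)) -> (forall i, smooth_vf A U (Y i)) ->
  nab p z (fun q => \sum_(i <- r) f i q *: Y i q) =
  \sum_(i <- r) (dir_deriv A p z (f i) *: Y i p + f i p *: nab p z (Y i)).
Proof.
move=> oU Up sf sY; elim: r => [|i r IHr].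
  rewrite big_nil; have s0 := smooth_vf_0 oU.
  have := nabla_leibniz nab z oU (@smooth_fun_cst _ _ _ A U 0) s0 Up.
  rewrite dir_deriv_cst !scale0r addr0 => eqE; rewrite -[RHS]eqE.
  apply: (nabla_local nab z oU) => //.
    by apply: (smooth_vf_on oU _ s0) => q _; rewrite big_nil.
  by move=> q _; rewrite big_nil.
rewrite big_cons -IHr -(nabla_leibniz nab z oU (sf i) (sY i) Up).
have s1 := smooth_vf_scale oU (sf i) (sY i).
have s2 := smooth_vf_sum r oU sf sY.
rewrite -(nabla_additive nab z oU s1 s2 Up).
apply: (nabla_local nab z oU) => //; last by move=> q _; rewrite big_cons.
exact: smooth_vf_sum.
Qed.

Lemma smooth_form_sub U W a : (forall p, U p -> W p) -> smooth_form A W a -> smooth_form A U a.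
Proof.
move=> UW [ea sa]; split=> [p /UW|c s]; first exact: ea.
by apply: smooth_fun_sub (sa c s) => p [cp /UW].
Qed.

End Connection.

Lemma cfield_components c p u : dom c p ->
  u = \sum_j (u *m jac (chart_at A p) c p) 0 j *: cfield c (e_ j) p.
Proof.
by move=> cp; rewrite -vec_mul -mulmxA jacK ?mulmx1 //; exact: dom_chart_at.
Qed.

Lemma exterior_slot_sum (b : form) s t I (r : seq I) (k : I -> R) (F : I -> V) :
  exterior b ->
  b (s ++ (\sum_(i <- r) k i *: F i) :: t) = \sum_(i <- r) k i * b (s ++ F i :: t).
Proof.
move=> [lb _]; elim: r => [|i r IHr]; last by rewrite !big_cons lb IHr.
rewrite !big_nil; have := lb s t (-1) 0 0.
by rewrite scaler0 addr0 mulN1r addNr.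
Qed.

(** Contraction by a field peels off one argument of a form, so that statements about several
arguments reduce to one. *)
Definition contr_field a X : M -> form := fun p => contr (X p) (a p).

Lemma smooth_contr_field U a X : open U -> smooth_form A U a -> smooth_vf A U X ->
  smooth_form A U (contr_field a X).
Proof.
move=> oU [ea sa] sX; split=> [p Up|c s]; first exact/contr_exterior/ea.
have oI : open (dom c `&` U) by apply: openI => //; exact: dom_open.
apply: (smooth_fun_on oI _ (smooth_fun_sum _ oI (fun j => smooth_fun_mul oI (sX c j) (sa c (j :: s))))).
move=> p [cp Up]; rewrite /contr_field {2}(cfield_components (X p) cp).
by rewrite contr_vsum ?form_sum //; exact: ea.
Qed.

Lemma smooth_fun_dom U f : (forall c, smooth_fun A (dom c `&` U) f) -> smooth_fun A U f.
Proof.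
move=> sf c; apply: Csmooth_sub (sf c c) => x [p [cp Up] <-].
by apply: chart_image_chart.
Qed.

Lemma smooth_eval U a (S : Type) (ts : seq S) (f : S -> M -> V) : open U ->
  smooth_form A U a -> (forall t, smooth_vf A U (f t)) ->
  smooth_fun A U (fun p => a p [seq f t p | t <- ts]).
Proof.
move=> oU sa sf; elim: ts a sa => [|t ts IHL] a sa.
  by apply: smooth_fun_dom => c; exact: (proj2 sa c [::]).
exact: (IHL _ (smooth_contr_field oU sa (sf t))).
Qed.

(** The sum \sum_i b (u_1, .., u_i', .., u_k) for a list of pairs (u_i, u_i'); unlike in
[der], u_i' need not be a function of u_i, as is the case for covariant derivatives of
fields at a point. *)
Fixpoint der_pairs (b : form) (l : seq (V * V)) : R :=
  if l is (u, u') :: l' then b (u' :: [seq y.1 | y <- l']) + der_pairs (contr u b) l' else 0.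

Lemma der_pairsE (b : form) (g : V -> V) s : der_pairs b [seq (u, g u) | u <- s] = der g b s.
Proof.
elim: s b => [|u s IHs] b; first by rewrite der_nil.
by rewrite der_cons /= IHs -map_comp map_id.
Qed.

Lemma der_pairs_pullback (b : form) G (g : V -> V) s :
  der_pairs b [seq (u *m G, g u *m G) | u <- s] = der g (pullback G b) s.
Proof.
elim: s b => [|u s IHs] b; first by rewrite der_nil.
by rewrite der_cons /= IHs -map_comp.
Qed.

Section Tensoriality.
Context (nab : connection A).

(** The covariant derivative of a form, by the Leibniz rule, on arbitrary fields f t
extending its arguments. *)
Definition nabla_fields q z a (S : Type) (ts : seq S) (f : S -> M -> V) : R :=
  dir_deriv A q z (fun p => a p [seq f t p | t <- ts]) -
  der_pairs (a q) [seq (f t q, nab q z (f t)) | t <- ts].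

Lemma nabla_fields_cons q z a (S : Type) (t : S) ts (f : S -> M -> V) :
  nabla_fields q z a (t :: ts) f =
  nabla_fields q z (contr_field a (f t)) ts f - a q (nab q z (f t) :: [seq f t q | t <- ts]).
Proof.
by rewrite /nabla_fields /= -map_comp opprD addrCA addrC.
Qed.

(** Expanding the field in coordinate fields, the derivatives of its components
contribute to both terms and cancel; what remains is linear in the components at q. *)
Lemma slot_tensorial U q z a X Y (S : Type) (ts : seq S) (f : S -> M -> V) : open U -> U q ->
  smooth_form A U a -> (forall t, smooth_vf A U (f t)) ->
  smooth_vf A U X -> smooth_vf A U Y -> X q = Y q ->
  dir_deriv A q z (fun p => a p (X p :: [seq f t p | t <- ts])) -
    a q (nab q z X :: [seq f t q | t <- ts]) =
  dir_deriv A q z (fun p => a p (Y p :: [seq f t p | t <- ts])) -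
    a q (nab q z Y :: [seq f t q | t <- ts]).
Proof.
move=> oU Uq sa sf.
pose c := chart_at A q; pose W := dom c `&` U.
have oW : open W by apply: openI => //; exact: dom_open.
have Wq : W q by split=> //; exact: dom_chart_at.
have WU p : W p -> U p by case.
pose k Z j p := (Z p *m jac (chart_at A p) c p) 0 j.
pose th j p := a p (cfield c (e_ j) p :: [seq f t p | t <- ts]).
pose K j := dir_deriv A q z (th j) - a q (nab q z (cfield c (e_ j)) :: [seq f t q | t <- ts]).
(* the right-hand side depends on the value of Z at q alone *)
suff main Z : smooth_vf A U Z ->
    dir_deriv A q z (fun p => a p (Z p :: [seq f t p | t <- ts])) -
    a q (nab q z Z :: [seq f t q | t <- ts]) = \sum_j k Z j q * K j.
  by move=> sX sY XY; rewrite !main // /k XY.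
move=> sZ; have sk j : smooth_fun A W (k Z j) by exact: sZ.
have sE j : smooth_vf A W (cfield c (e_ j)).
  by apply: (smooth_vf_sub _ (@smooth_cfield _ _ _ A c (e_ j))) => p [].
have sth j : smooth_fun A W (th j).
  apply: (@smooth_eval W (contr_field a (cfield c (e_ j))) S ts f oW).
    by apply: smooth_contr_field (sE j) => //; exact: smooth_form_sub sa.
  by move=> t; exact: smooth_vf_sub (sf t).
have ZE p : W p -> Z p = \sum_j k Z j p *: cfield c (e_ j) p.
  by move=> [cp _]; exact: cfield_components.
have -> : dir_deriv A q z (fun p => a p (Z p :: [seq f t p | t <- ts])) =
    \sum_j (dir_deriv A q z (k Z j) * th j q + k Z j q * dir_deriv A q z (th j)).
  transitivity (dir_deriv A q z (fun p => \sum_j (k Z j p * th j p))).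
    apply: (dir_deriv_on z oW) => // p Wp; rewrite (ZE p Wp).
    by rewrite (exterior_slot_sum [::]) //; apply: (proj1 sa); apply: WU.
  rewrite (dir_deriv_sum z _ oW _ Wq) => [|j]; last exact: smooth_fun_mul.
  by apply: eq_bigr => j _; exact: dir_deriv_mul (sk j) (sth j) Wq.
have -> : nab q z Z = \sum_j (dir_deriv A q z (k Z j) *: cfield c (e_ j) q + k Z j q *: nab q z (cfield c (e_ j))).
  rewrite -(nabla_sum nab z _ oW Wq sk sE).
  by apply: (nabla_local nab z oW) => //; exact: smooth_vf_sub sZ.
have eq_ : exterior (a q) by exact: (proj1 sa).
have aD u v : a q (u + v :: [seq f t q | t <- ts]) =
   a q (u :: [seq f t q | t <- ts]) + a q (v :: [seq f t q | t <- ts]).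
  by have := (proj1 eq_) [::] [seq f t q | t <- ts] 1 u v; rewrite scale1r mul1r.
have aS (h : 'I_n -> R) (F : 'I_n -> V) : a q ((\sum_j h j *: F j) :: [seq f t q | t <- ts]) =
    \sum_j h j * a q (F j :: [seq f t q | t <- ts]).
  exact: (exterior_slot_sum [::] _ _ _ _ eq_).
rewrite [X in a q (X :: _)]big_split /= aD !aS -big_split -sumrB.
apply: eq_bigr => j _ /=; rewrite /K /th; ring.
Qed.

(** The fields are exchanged one after the other, each exchange being
[slot_tensorial] for the form contracted by the remaining fields. *)
Lemma nabla_fields_tensorial U q z a (S : Type) (ts : seq S) (f g : S -> M -> V) : open U -> U q ->
  smooth_form A U a -> (forall t, smooth_vf A U (f t)) -> (forall t, smooth_vf A U (g t)) ->
  (forall t, f t q = g t q) ->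
  nabla_fields q z a ts f = nabla_fields q z a ts g.
Proof.
move=> oU Uq sa sf sg fg; elim: ts a sa => [|t ts IHL] a sa //.
have Lfg : [seq f t q | t <- ts] = [seq g t q | t <- ts] by apply: eq_map.
rewrite nabla_fields_cons IHL; last exact: smooth_contr_field.
rewrite nabla_fields_cons Lfg /nabla_fields {2 4}/contr_field fg.
rewrite -!addrA ![- der_pairs _ _ - _]addrC !addrA; congr (_ - _).
exact: (slot_tensorial z ts oU Uq sa sg (sf t) (sg t)).
Qed.
End Tensoriality.

End FieldsAndForms.

(** * Forms and connections read in a chart *)

Section LocalExpression.
Context (R : realType) (n : nat) (M : topologicalType) (A : manifold R n M).
Local Notation V := 'rV[R]_n.
Local Notation e_ := (std R).
Local Notation form := (seq V -> R^o).
Implicit Types (c : atlas A) (p q : M) (U W : set M) (u v x z : V).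
Implicit Types (X Y Z : M -> V) (a b : M -> form).

(** From components in the chart c to tangent vectors at q, expressed in the chart chosen there. *)
Definition jac_at c q := jac c (chart_at A q) q.

(** A form read in the chart c: its values on the tangent vectors with given components. *)
Definition local_form c a : V -> form := fun x => pullback (jac_at c (chart_inv c x)) (a (chart_inv c x)).

Lemma jac_atK c q : dom c q -> jac_at c q *m jac (chart_at A q) c q = 1%:M.
Proof. by move=> cq; apply: jacK => //; exact: dom_chart_at. Qed.

Lemma jac_atKV c q : dom c q -> jac (chart_at A q) c q *m jac_at c q = 1%:M.
Proof. by move=> cq; apply: jacK => //; exact: dom_chart_at. Qed.

Lemma local_form_chart c a q : dom c q -> local_form c a (chart c q) = pullback (jac_at c q) (a q).
Proof. by move=> cq; rewrite /local_form chartK. Qed.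

Lemma smooth_cform_local_form c U a : open U -> smooth_form A U a -> smooth_cform (chart_image c U) (local_form c a).
Proof.
move=> oU [ea sa]; split=> [x /chart_image_inv [_ Ux _]|s]; first exact/pullback_exterior/ea.
have oX : open (chart_image c U) := chart_image_open oU.
have ex x : chart_image c U x -> exterior (local_form c a x).
  by move=> /chart_image_inv [_ Ux _]; exact/pullback_exterior/ea.
suff H t : Csmooth (chart_image c U) (fun x => local_form c a x ([seq e_ i | i <- t] ++ s)) by exact: (H [::]).
elim: s t => [|u s IHs] t.
  have s1 : Csmooth (chart_image c U) ((fun p => a p [seq e_ i *m jac c (chart_at A p) p | i <- t]) \o chart_inv c).
    by apply: Csmooth_sub (sa c t c) => x [p [cp Up] <-]; apply: chart_image_chart.
  by apply: (Csmooth_ext oX _ s1) => x _; rewrite cats0 /local_form /pullback -map_comp.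
have s2 : Csmooth (chart_image c U) (fun x => \sum_j u 0 j * local_form c a x ([seq e_ i | i <- rcons t j] ++ s)).
  by apply: Csmooth_sum => // j; apply: Csmooth_mul => //; exact: Csmooth_cst.
apply: (Csmooth_ext oX _ s2) => x Xx; rewrite {2}[u]vec_std (exterior_slot_sum _ _ _ _ _ (ex x Xx)).
by apply: eq_bigr => j _; rewrite map_rcons cat_rcons.
Qed.

Lemma smooth_form_local_form U a : open U -> (forall p, U p -> exterior (a p)) ->
  (forall c, smooth_cform (chart_image c U) (local_form c a)) -> smooth_form A U a.
Proof.
move=> oU ea sa; split=> // c s.
have oI : open (dom c `&` U) by apply: openI => //; exact: dom_open.
apply: (smooth_fun_chart (c := c)) => //; first by move=> p [].
apply: (@Csmooth_ext _ _ _ (fun x => local_form c a x [seq e_ i | i <- s])); first exact: chart_image_open.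
  by move=> x _; rewrite /local_form /pullback -map_comp.
by apply: Csmooth_sub (proj2 (sa c) _) => x [p [cp [_ Up]] <-]; apply: chart_image_chart.
Qed.

Section Conn.
Context (nab : connection A).

(** Row l lists the components of nabla_{e_i} e_l for the coordinate fields of c. *)
Definition christoffel c x (i : 'I_n) : 'M[R]_n := \matrix_(l, j)
  (nab (chart_inv c x) (cfield c (e_ i) (chart_inv c x)) (cfield c (e_ l))
    *m jac (chart_at A (chart_inv c x)) c (chart_inv c x)) 0 j.

Lemma nabla_cfield c q z u : dom c q ->
  nab q z (cfield c u) = \sum_l u 0 l *: nab q z (cfield c (e_ l)).
Proof.
move=> cq.
have -> : cfield c u = fun p => \sum_l (fun=> u 0 l) p *: cfield c (e_ l) p.
  by apply/funext => p; rewrite /cfield vec_mul.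
rewrite (nabla_sum nab z _ (dom_open c) cq (f := fun l => fun=> u 0 l)).
- by apply: eq_bigr => l _; rewrite dir_deriv_cst scale0r add0r.
- by move=> l; exact: smooth_fun_cst.
- by move=> l; exact: smooth_cfield.
Qed.

Lemma nabla_christoffel c q i u : dom c q ->
  nab q (cfield c (e_ i) q) (cfield c u) = u *m christoffel c (chart c q) i *m jac_at c q.
Proof.
move=> cq; rewrite nabla_cfield // -mulmxA vec_mul; apply: eq_bigr => l _; congr (_ *: _).
rewrite mulmxA -rowE.
have -> : row l (christoffel c (chart c q) i) =
    nab q (cfield c (e_ i) q) (cfield c (e_ l)) *m jac (chart_at A q) c q.
  by apply/rowP => j; rewrite [LHS]mxE [LHS]mxE chartK.
by rewrite -mulmxA jac_atKV // mulmx1.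
Qed.

Lemma smooth_christoffel c i : smooth_cmx (chart_image c setT) (fun x => christoffel c x i).
Proof.
move=> l j.
have := nabla_smooth nab (dom_open c) (@smooth_cfield _ _ _ A c (e_ i)) (@smooth_cfield _ _ _ A c (e_ l)).
move=> /(_ c j c) s1.
apply: (@Csmooth_ext _ _ _ ((fun p => (nab p (cfield c (e_ i) p) (cfield c (e_ l)) *m
  jac (chart_at A p) c p) 0 j) \o chart_inv c)).
- exact/chart_image_open/openT.
- by move=> x _; rewrite [RHS]mxE.
- by apply: Csmooth_sub s1 => x [p [cp _] <-]; apply: chart_image_chart.
Qed.

(** The covariant derivative is defined with fields that are constant in the chart
chosen at q.  By [nabla_fields_tensorial] they may be replaced by the coordinate fields of
c, on which a form is differentiated componentwise. *)
Lemma local_form_nabla U a c q i : open U -> U q -> dom c q -> smooth_form A U a ->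
  pullback (jac_at c q) (nabla_form nab q (cfield c (e_ i) q) a) =
  conn (christoffel c (chart c q) i) (e_ i) (local_form c a) (chart c q).
Proof.
move=> oU Uq cq sa; apply/funext => s; set z := cfield c (e_ i) q.
pose c' := chart_at A q; have c'q : dom c' q by exact: dom_chart_at.
pose W := dom c `&` (dom c' `&` U).
have oW : open W by apply: openI; [exact: dom_open|apply: openI => //; exact: dom_open].
have Wq : W q by split.
have saW : smooth_form A W a by apply: smooth_form_sub sa => p [_ []].
have sc u : smooth_vf A W (cfield c u).
  by apply: (smooth_vf_sub _ (@smooth_cfield _ _ _ A c u)) => p [].
have sc' u : smooth_vf A W (cfield c' u).
  by apply: (smooth_vf_sub _ (@smooth_cfield _ _ _ A c' u)) => p [_ []].
transitivity (nabla_fields nab q z a s (fun u => ext_vec A q (u *m jac_at c q))).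
  rewrite /pullback /nabla_form /nabla_fields; congr (_ - _).
    by congr (dir_deriv A q z _); apply/funext => p; rewrite -map_comp.
  rewrite -[LHS]/(der (fun u => nab q z (ext_vec A q u)) (a q) [seq u *m jac_at c q | u <- s]).
  rewrite -(der_pairsE (a q) (fun u => nab q z (ext_vec A q u))) -map_comp.
  apply: (congr1 (der_pairs (a q))); apply: eq_map => u.
  by rewrite -[LHS]/(_, _) {2}/ext_vec jac_id // mulmx1.
transitivity (nabla_fields nab q z a s (fun u => cfield c u)).
  apply: (nabla_fields_tensorial nab z s oW Wq saW) => u; [exact: sc'|exact: sc|].
  by rewrite /ext_vec jac_id // mulmx1.
have E1 : dir_deriv A q z (fun p => a p [seq cfield c u p | u <- s]) =
    pder (e_ i) (local_form c a) (chart c q) s.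
  apply: (dir_derivE (f := fun p => a p [seq cfield c u p | u <- s]) (e_ i) cq).
  exact: smooth_fun_diff_at (smooth_eval s oW saW sc) Wq.
have E2 : der_pairs (a q) [seq (cfield c u q, nab q z (cfield c u)) | u <- s] =
    der (mulmx^~ (christoffel c (chart c q) i)) (local_form c a (chart c q)) s.
  have tlq := local_form_chart a cq.
  rewrite tlq -(der_pairs_pullback (a q) (jac_at c q) (mulmx^~ (christoffel c (chart c q) i)) s).
  apply: (congr1 (der_pairs (a q))); apply: eq_map => u.
  exact: (congr2 pair erefl (nabla_christoffel i u cq)).
exact: (congr2 (fun x y : R => x - y) E1 E2).
Qed.

End Conn.
End LocalExpression.

(** * Torsion, symmetry of second derivatives, parallel bivectors *)

Section LocalHypotheses.
Context (R : realType) (n : nat) (M : topologicalType) (A : manifold R n M).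
Local Notation V := 'rV[R]_n.
Local Notation e_ := (std R).
Local Notation form := (seq V -> R^o).
Implicit Types (c : atlas A) (p q : M) (U W : set M) (u v x z : V).
Implicit Types (X Y Z : M -> V) (a b : M -> form).
Context (nab : connection A) (w : M -> 'M[R]_n).

Lemma dir_deriv_coord c p v j : dom c p ->
  dir_deriv A p v (fun q => chart c q 0 j) = (v *m jac (chart_at A p) c p) 0 j.
Proof.
move=> cp; have vE : v = v *m jac (chart_at A p) c p *m jac_at c p.
  by rewrite -mulmxA jac_atKV // mulmx1.
rewrite {1}vE (dir_derivE _ cp); last first.
  exact: smooth_fun_diff_at (@smooth_coord _ _ _ A c j) cp.
rewrite (@derive_on _ _ (chart_image c setT) _ (fun y => y 0 j)) ?derive_coord //.
- exact/chart_image_open/openT.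
- by move=> y /chart_image_inv [_ _ yy] /=; rewrite yy.
- exact: chart_image_chart.
Qed.

Section Torsion.
Context (tf : torsion_free nab).

Lemma dir_cfield c q u (g : V -> R^o) : dom c q ->
  differentiable g (chart c q) -> smooth_fun A (dom c) (g \o chart c) ->
  dir_deriv A q (cfield c u q) (g \o chart c) = 'D_u g (chart c q).
Proof.
move=> cq dg sg; rewrite /cfield (dir_derivE _ cq); last exact: smooth_fun_diff_at sg cq.
apply: (derive_on u (chart_image_open (c := c) openT)); last exact: chart_image_chart.
by move=> y /chart_image_inv [_ _ yy] /=; rewrite yy.
Qed.

(** The j-th component of the torsion of two coordinate fields is obtained by
letting it act on the j-th coordinate function, whose first derivatives are constant. *)
Lemma christoffel_sym c y (i l : 'I_n) : chart_image c setT y ->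
  row l (christoffel nab c y i) = row i (christoffel nab c y l).
Proof.
move=> [p [cp _] <-].
have rowG (a b : 'I_n) : row b (christoffel nab c (chart c p) a) =
    nab p (cfield c (e_ a) p) (cfield c (e_ b)) *m jac (chart_at A p) c p.
  by apply/rowP => j; rewrite [LHS]mxE [LHS]mxE chartK.
rewrite !rowG; apply/eqP; rewrite -subr_eq0 -mulmxBl; apply/eqP/rowP => j.
rewrite -(dir_deriv_coord _ j cp).
have sE u := @smooth_cfield _ _ _ A c u.
rewrite (tf (dom_open c) (sE (e_ i)) (sE (e_ l)) (@smooth_coord _ _ _ A c j) cp).
(* first derivatives of a coordinate function along coordinate fields are constant *)
have dd0 (a b : 'I_n) : dir_deriv A p (cfield c (e_ a) p)
    (fun q => dir_deriv A q (cfield c (e_ b) q) (fun q' => chart c q' 0 j)) = 0.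
  rewrite -(dir_deriv_cst A p (cfield c (e_ a) p) ((e_ b : V) 0 j)).
  apply: (dir_deriv_on _ _ (dom_open c) cp) => q cq.
  by rewrite dir_deriv_coord // cfield_jac // jac_id // mulmx1.
by rewrite !dd0 subr0 mxE.
Qed.

(** Once coordinate fields have no torsion term, the torsion equation says that they
commute as derivations of functions. *)
Lemma schwarz_chart c (g : V -> R^o) : Csmooth (chart_image c setT) g ->
  forall (i k : 'I_n) y, chart_image c setT y ->
  'D_(e_ i) (fun z => 'D_(e_ k) g z : R^o) y = 'D_(e_ k) (fun z => 'D_(e_ i) g z : R^o) y.
Proof.
move=> sg i k y Xy; have [p [cp _] py] := Xy.
have oX : open (chart_image c setT) := chart_image_open openT.
have sE u := @smooth_cfield _ _ _ A c u.
have sm (h : V -> R^o) : Csmooth (chart_image c setT) h -> smooth_fun A (dom c) (h \o chart c).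
  move=> sh; apply: (smooth_fun_chart (c := c)) => //; first exact: dom_open.
  apply: (@Csmooth_ext _ _ _ h); first exact/chart_image_open/dom_open.
    by move=> x /chart_image_inv [_ _ xx] /=; rewrite xx.
  by apply: Csmooth_sub sh => x [q [cq _] <-]; apply: chart_image_chart.
have eqE (a b : 'I_n) : dir_deriv A p (cfield c (e_ a) p)
    (fun q => dir_deriv A q (cfield c (e_ b) q) (g \o chart c)) =
    'D_(e_ a) (fun z => 'D_(e_ b) g z : R^o) y.
  have sd : Csmooth (chart_image c setT) (fun z => 'D_(e_ b) g z : R^o) by exact: Csmooth_derive.
  transitivity (dir_deriv A p (cfield c (e_ a) p) ((fun z => 'D_(e_ b) g z : R^o) \o chart c)).
    apply: (dir_deriv_on _ _ (dom_open c) cp) => q cq.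
    apply: dir_cfield => //; last exact: sm.
    by apply: Csmooth_diff sg _; apply: chart_image_chart.
  rewrite -py; apply: dir_cfield => //; last exact: sm.
  by apply: Csmooth_diff sd _; apply: chart_image_chart.
rewrite -eqE -eqE; apply/eqP; rewrite -subr_eq0.
rewrite -(tf (dom_open c) (sE (e_ i)) (sE (e_ k)) (sm _ sg) cp).
have -> : nab p (cfield c (e_ i) p) (cfield c (e_ k)) - nab p (cfield c (e_ k) p) (cfield c (e_ i)) = 0.
  rewrite !nabla_christoffel // -!rowE py (christoffel_sym i k Xy) subrr //.
by rewrite /dir_deriv derive0.
Qed.

End Torsion.

(** The components of w in the chart c. *)
Definition local_biv c x : 'M[R]_n :=
  (jac (chart_at A (chart_inv c x)) c (chart_inv c x))^T *m w (chart_inv c x) *m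
  jac (chart_at A (chart_inv c x)) c (chart_inv c x).

Context (w_biv : bivector_field A w).

Lemma smooth_local_biv c : smooth_cmx (chart_image c setT) (local_biv c).
Proof.
move=> i j; apply: Csmooth_sub ((proj2 w_biv) c i j c) => x [p [cp _] <-].
exact: chart_image_chart.
Qed.

Lemma local_biv_anti c x : (local_biv c x)^T = - local_biv c x.
Proof. by rewrite /local_biv !trmx_mul trmxK (proj1 w_biv) mulNmx mulmxN mulmxA. Qed.

Lemma exterior_covector (l : V -> R) : scal_lin l -> exterior (covector l).
Proof.
move=> ll; split=> [[|u0 [|u1 s]] [|u2 t] x u v|[|u0 [|u1 s]] [|u2 t] r u] //=; by rewrite ?mulr0 ?addr0.
Qed.

(** The coordinate coframe of the chart c. *)
Definition coframe c i : M -> form :=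
  fun p => covector (fun u => (u *m jac (chart_at A p) c p) 0 i).

Lemma scal_lin_mul (P : 'M[R]_n) i : scal_lin (fun u : V => (u *m P) 0 i).
Proof. by move=> x u v; rewrite mulmxDl -scalemxAl [LHS]mxE [X in X + _]mxE. Qed.

Lemma smooth_coframe c i : smooth_form A (dom c) (coframe c i).
Proof.
split=> [p _|c' s]; first exact/exterior_covector/scal_lin_mul.
have oI : open (dom c' `&` dom c) by apply: openI; exact: dom_open.
have s0 := @smooth_fun_cst _ _ _ A (dom c' `&` dom c) 0.
case: s => [|k [|k' s]]; try exact: s0.
apply: (smooth_fun_on oI _ (@smooth_jac _ _ _ A c' c k i)) => p [c'p cp] /=.
rewrite -mulmxA jac_comp //; last exact: dom_chart_at.
by rewrite -rowE [RHS]mxE.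
Qed.

Lemma one_form_coframe c i : one_form A (dom c) (coframe c i).
Proof. by split; [exact: smooth_coframe|move=> p [|u [|u' s]]]. Qed.

Lemma local_form_coframe c i x s : chart_image c setT x -> local_form c (coframe c i) x s = covector (fun u : V => u 0 i) s.
Proof.
move=> /chart_image_inv [cx _ _]; case: s => [|u [|u' s]] //.
by rewrite /local_form /pullback /= -mulmxA jac_atK // mulmx1.
Qed.

Lemma biv_sum (W P S : 'M[R]_n) i j :
  \sum_a \sum_b W a b * (e_ a *m P) 0 i * (e_ b *m S) 0 j = (P^T *m W *m S) i j.
Proof.
rewrite [RHS]mxE exchange_big; apply: eq_bigr => b _ /=.
rewrite -mulr_suml -(rowE b S) [row b S 0 j]mxE [(_ *m W) i b]mxE; congr (_ * _).
by apply: eq_bigr => a _; rewrite -(rowE a P) [row a P 0 i]mxE [P^T i a]mxE mulrC.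
Qed.

(** Coordinate one-forms have constant components, so only the Christoffel term remains. *)
Lemma nabla_coframe c p (i k : 'I_n) u : dom c p ->
  nabla_form nab p (cfield c (e_ k) p) (coframe c i) [:: u] =
  - (u *m (jac (chart_at A p) c p *m christoffel nab c (chart c p) k)) 0 i.
Proof.
move=> cp.
have := congr1 (fun b : form => b [:: u *m jac (chart_at A p) c p])
  (local_form_nabla nab k (dom_open c) cp cp (smooth_coframe c i)).
rewrite {1}/pullback /= -mulmxA jac_atKV // mulmx1 => ->.
have Xp : chart_image c setT (chart c p) by exact: chart_image_chart.
rewrite /conn formD formN der_cons der_nil addr0 local_form_coframe //= -mulmxA.
rewrite [X in X - _](_ : _ = 0) ?sub0r // /pder.
set u' := u *m _.
have fg y : chart_image c setT y -> local_form c (coframe c i) y [:: u'] = (cst (u' 0 i) : V -> R^o) y.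
  by move=> Xy; rewrite local_form_coframe.
exact: (etrans (derive_on (e_ k) (chart_image_open openT) fg Xp) (derive_cst _ _ _)).
Qed.

(** The entry (i, j) is the parallelism of w tested on the i-th and j-th coordinate
one-forms. *)
Lemma parallel_chart c x (k : 'I_n) : preserves nab w -> chart_image c setT x ->
  pderm (e_ k) (local_biv c) x + local_biv c x *m christoffel nab c x k + (christoffel nab c x k)^T *m local_biv c x = 0.
Proof.
move=> nw [p [cp _] <-]; set G := christoffel _ _ _ _.
pose K q := jac (chart_at A q) c q.
have wE : local_biv c (chart c p) = (K p)^T *m w p *m K p by rewrite /local_biv chartK.
apply/matrixP => i j.
have := nw _ _ _ p (cfield c (e_ k) p) (dom_open c) (one_form_coframe c i) (one_form_coframe c j) cp.
have -> : dir_deriv A p (cfield c (e_ k) p) (fun q => bivector_eval (w q) (coframe c i q) (coframe c j q)) =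
    pderm (e_ k) (local_biv c) (chart c p) i j.
  rewrite [RHS]mxE /cfield.
  rewrite (_ : (fun q => _) = (fun q => ((K q)^T *m w q *m K q) i j)).
    apply: (dir_derivE (f := fun q => ((K q)^T *m w q *m K q) i j) _ cp).
    exact: (smooth_fun_diff_at ((proj2 w_biv) c i j) cp).
  by apply/funext => q; rewrite /bivector_eval biv_sum.
have -> : bivector_eval (w p) (nabla_form nab p (cfield c (e_ k) p) (coframe c i)) (coframe c j p) =
    - (G^T *m local_biv c (chart c p)) i j.
  rewrite /bivector_eval.
  transitivity (- \sum_a \sum_b w p a b * (e_ a *m (K p *m G)) 0 i * (e_ b *m K p) 0 j).
    rewrite -sumrN; apply: eq_bigr => a _; rewrite -sumrN; apply: eq_bigr => b _.
    by rewrite (nabla_coframe i k (e_ a) cp) mulrN mulNr.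
  by rewrite biv_sum trmx_mul wE !mulmxA.
have -> : bivector_eval (w p) (coframe c i p) (nabla_form nab p (cfield c (e_ k) p) (coframe c j)) =
    - (local_biv c (chart c p) *m G) i j.
  rewrite /bivector_eval.
  transitivity (- \sum_a \sum_b w p a b * (e_ a *m K p) 0 i * (e_ b *m (K p *m G)) 0 j).
    rewrite -sumrN; apply: eq_bigr => a _; rewrite -sumrN; apply: eq_bigr => b _.
    by rewrite (nabla_coframe j k (e_ b) cp) mulrN.
  by rewrite biv_sum wE !mulmxA.
rewrite !opprK => eqE.
have addmxE (A1 A2 : 'M[R]_n) : (A1 + A2) i j = A1 i j + A2 i j by rewrite mxE.
by rewrite !addmxE [RHS]mxE -eqE addrAC.
Qed.

End LocalHypotheses.

(** * The quantum differential and its expression in a chart *)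

Section Operator.
Context (R : realType) (n : nat) (M : topologicalType) (A : manifold R n M).
Local Notation V := 'rV[R]_n.
Local Notation e_ := (std R).
Local Notation form := (seq V -> R^o).
Local Notation H := (int -> form).
Local Notation hform := (hform R n M).
Implicit Types (c : atlas A) (p q : M) (U W : set M) (u v x z : V).
Implicit Types (X Y Z : M -> V).
Context (nab : connection A) (w : M -> 'M[R]_n).

Lemma der_linear_endo (g g' : V -> V) (k : R) (b : form) : exterior b ->
  der (fun u => k *: g u + g' u) b = k *: der g b + der g' b.
Proof.
move=> eb; apply/funext => s; elim: s b eb => [|u s IHs] b eb.
  by rewrite formD formZ !der_nil mulr0 addr0.
rewrite formD formZ !der_cons IHs; last exact: contr_exterior.
by rewrite formD formZ (proj1 eb [::]); ring.
Qed.

Lemma smooth_ext_vec q u : smooth_vf A (dom (chart_at A q)) (ext_vec A q u).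
Proof. exact: (@smooth_cfield _ _ _ A (chart_at A q) u). Qed.

Lemma nabla_form_lin U a q : open U -> U q -> smooth_form A U a ->
  form_lin (fun z => nabla_form nab q z a).
Proof.
move=> oU Uq sa k z z'; apply/funext => s; rewrite formD formZ.
set c := chart_at A q; have cq : dom c q by exact: dom_chart_at.
pose W := dom c `&` U.
have oW : open W by apply: openI => //; exact: dom_open.
have Wq : W q by split.
have saW : smooth_form A W a by apply: smooth_form_sub sa => p [].
have sv u : smooth_vf A W (ext_vec A q u).
  by apply: (smooth_vf_sub _ (@smooth_ext_vec q u)) => p [].
have sf := smooth_fun_diff_at (smooth_eval s oW saW sv) Wq.
pose g z u := nab q z (ext_vec A q u).
have gl u : g (k *: z + z') u = k *: g z u + g z' u.
  exact: (nabla_linear nab k z z' oW (sv u) Wq).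
pose d z1 : R := 'D_z1 ((fun p => a p [seq ext_vec A q u p | u <- s]) \o chart_inv c : V -> R^o) (chart c q).
have eqE z1 : nabla_form nab q z1 a s = d z1 - der (g z1) (a q) s by [].
have dl : d (k *: z + z') = k * d z + d z' by exact: (derive_lin k z z' sf).
have el : der (g (k *: z + z')) (a q) s = k * der (g z) (a q) s + der (g z') (a q) s.
  have -> : g (k *: z + z') = (fun u => k *: g z u + g z' u) by apply/funext.
  by rewrite der_linear_endo //; exact: (proj1 sa).
clearbody d g; rewrite !eqE dl el; by ring.
Qed.

Lemma pullback1 (b : form) : pullback 1%:M b = b.
Proof.
by apply/funext => s; rewrite /pullback; congr b; rewrite -[RHS]map_id; apply: eq_map => u; rewrite mulmx1.
Qed.

(** In the chart chosen at q the jacobian is the identity and the fields of the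
definition of [nabla_form] are coordinate fields. *)
Lemma nabla_conn q i a :
  nabla_form nab q (e_ i) a =
  conn (christoffel nab (chart_at A q) (chart (chart_at A q) q) i) (e_ i)
    (local_form (chart_at A q) a) (chart (chart_at A q) q).
Proof.
set c := chart_at A q; have cq : dom c q by exact: dom_chart_at.
have J1 : jac_at c q = 1%:M by exact: jac_id.
have e1 : cfield c (e_ i) q = e_ i by rewrite -[LHS]/(e_ i *m jac_at c q) J1 mulmx1.
have ge : (fun u => nab q (e_ i) (ext_vec A q u)) = mulmx^~ (christoffel nab c (chart c q) i).
  by apply/funext => u; have := nabla_christoffel nab i u cq; rewrite e1 J1 mulmx1.
have tq : local_form c a (chart c q) = a q.
  by rewrite local_form_chart // J1 pullback1.
apply/funext => s.
rewrite /conn tq -ge; by [].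
Qed.

Lemma nabla_form0 q z : nabla_form nab q z 0 = 0.
Proof.
apply/funext => s; rewrite /nabla_form.
have -> : dir_deriv A q z (fun q0 => (0 : M -> form) q0 [seq ext_vec A q u q0 | u <- s]) = 0.
  exact: dir_deriv_cst.
by rewrite sub0r big1 ?oppr0.
Qed.

Definition nablaH (a : hform) q i : H := fun m => nabla_form nab q (e_ i) (a m).

(** The operator d_h computed in the standard frame of each tangent space. *)
Definition dh (a : hform) : hform := fun k p => (\sum_i qmul (w p) i (nablaH a p i)) k.

Definition local_hform c (a : hform) : V -> H := fun x m => local_form c (a m) x.

Lemma pullback_contr_inv c q u (b : form) : dom c q ->
  pullback (jac_at c q) (contr u b) = contr (u *m jac (chart_at A q) c q) (pullback (jac_at c q) b).
Proof. by move=> cq; rewrite contr_pullback -mulmxA jac_atKV // mulmx1. Qed.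

Lemma smooth_chform_local_hform c (a : hform) : (forall k, smooth_form A setT (a k)) -> smooth_chform (chart_image c setT) (local_hform c a).
Proof. by move=> sa k; apply: smooth_cform_local_form => //; exact: openT. Qed.

(** Each of the two parts of d_h contracts a coframe, respectively w, with the
covariant derivative, which is linear in the direction; so the standard frame may be
replaced by the coordinate frame of c. *)
Lemma dh_chart c q (a : hform) k : dom c q -> (forall k, smooth_form A setT (a k)) ->
  pullback (jac_at c q) (dh a k q) = local_dh (local_biv w c) (christoffel nab c) (local_hform c a) (chart c q) k.
Proof.
move=> cq sa; rewrite /dh /local_dh !hseries_sum pullback_sum.
set K := jac (chart_at A q) c q.
have Xq : chart_image c setT (chart c q) by exact: chart_image_chart.
have lB m : form_lin (fun z => nabla_form nab q z (a m)).
  exact: (nabla_form_lin openT I (sa m)).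
pose B m i := pullback (jac_at c q) (nabla_form nab q (cfield c (e_ i) q) (a m)).
have BE m i : B m i = connH (christoffel nab c (chart c q) i) (e_ i) (local_hform c a) (chart c q) m.
  exact: (local_form_nabla nab i openT I cq (sa m)).
have eB m i : exterior (B m i).
  rewrite BE; apply: (conn_exterior _ _ (chart_image_open (c := c) openT) Xq).
    exact: smooth_cform_diff_cform (smooth_chform_local_hform c sa m) Xq.
  exact: (proj1 (smooth_chform_local_hform c sa m)).
have lB' m : form_lin (fun v => pullback (jac_at c q) (nabla_form nab q (v *m jac_at c q) (a m))).
  by move=> x u v; rewrite mulmxDl -scalemxAl lB pullbackD pullbackZ.
have uK : K \in unitmx by apply: jac_unit => //; exact: dom_chart_at.
have invK : invmx K = jac_at c q.
  by rewrite -[LHS]mulmx1 -(jac_atKV cq) mulKmx.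
have rowKJ i : row i K *m jac_at c q = e_ i by rewrite rowE -mulmxA jac_atKV // mulmx1.
have S0 m : \sum_i pullback (jac_at c q) (emul i (nablaH a q i m)) = \sum_i emul i (B m i).
  have := frame_covmul uK (lB' m); rewrite invK => <-.
  by apply: eq_bigr => i _; rewrite pullback_covmul rowKJ.
have S1 m : \sum_i pullback (jac_at c q) (contr (row i (w q)) (nablaH a q i m)) =
    \sum_i contr (row i (local_biv w c (chart c q))) (B m i).
  transitivity (\sum_i \sum_l K i l *: contr (row i (w q *m K)) (B m l)).
    apply: eq_bigr => i _; rewrite pullback_contr_inv // -/K row_mul.
    rewrite /nablaH -(rowKJ i) [row i K]vec_std mulmx_suml.
    under [X in nabla_form _ _ X]eq_bigr => l _ do rewrite -scalemxAl.
    rewrite (form_lin_sum _ _ _ (lB m)) pullback_sum contr_sum; apply: eq_bigr => l _.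
    by rewrite pullbackZ contrZ mxE.
  rewrite exchange_big /=; apply: eq_bigr => l _.
  rewrite -(contr_vsum _ _ _ _ (eB m l)); apply: (congr1 (fun v => contr v (B m l))).
  rewrite /local_biv chartK // -/K -mulmxA row_mul mulmx_sum_row.
  by apply: eq_bigr => i _; rewrite !mxE.
under [LHS]eq_bigr => i _ do rewrite /qmul pullbackD.
rewrite big_split /= S0 S1 -big_split; apply: eq_bigr => i _.
by rewrite /qmul !BE.
Qed.

End Operator.

(** * Smoothness, square, linearity and frame formula *)

Section OperatorProperties.
Context (R : realType) (n : nat) (M : topologicalType) (A : manifold R n M).
Local Notation V := 'rV[R]_n.
Local Notation e_ := (std R).
Local Notation form := (seq V -> R^o).
Local Notation H := (int -> form).
Local Notation hform := (hform R n M).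
Implicit Types (c : atlas A) (p q : M) (U W : set M) (u v x z : V).
Implicit Types (X Y Z : M -> V).
Context (nab : connection A) (w : M -> 'M[R]_n).
Context (w_biv : bivector_field A w) (tf : torsion_free nab) (nw : preserves nab w).

Definition smooth_hform (a : hform) := forall k, smooth_form A setT (a k).

Lemma local_form_dh c x (a : hform) k : chart_image c setT x -> smooth_hform a ->
  local_form c (dh nab w a k) x = local_dh (local_biv w c) (christoffel nab c) (local_hform c a) x k.
Proof. by move=> [q [cq _] <-] sa; rewrite local_form_chart // dh_chart. Qed.

Lemma smooth_dh (a : hform) : smooth_hform a -> smooth_hform (dh nab w a).
Proof.
move=> sa k.
have sD c : smooth_cform (chart_image c setT) (local_form c (dh nab w a k)).
  have oX : open (chart_image c setT) := chart_image_open openT.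
  apply: (smooth_cform_on oX _ (smooth_chform_local_dh oX (smooth_local_biv w_biv (c:=c)) (smooth_christoffel nab (c:=c)) (smooth_chform_local_hform c sa) k)).
  by move=> x Xx; rewrite local_form_dh.
apply: (smooth_form_local_form openT _ sD) => p _; have cp := dom_chart_at A p.
rewrite -[dh _ _ _ _ _]pullback1 -(jac_id cp) -/(jac_at (chart_at A p) p) -(local_form_chart _ cp).
by apply: (proj1 (sD (chart_at A p))); exact: chart_image_chart.
Qed.

(** A pointwise statement, reduced to [local_dh_sq] in a chart around the point. *)
Lemma dh_sq (a : hform) : smooth_hform a -> dh nab w (dh nab w a) = 0.
Proof.
move=> sa; apply/funext => k; apply/funext => p.
set c := chart_at A p; have cp : dom c p by exact: dom_chart_at.
have oX : open (chart_image c setT) := chart_image_open openT.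
have Xp : chart_image c setT (chart c p) by exact: chart_image_chart.
rewrite -[LHS]pullback1 -(jac_id cp) -/(jac_at c p) dh_chart //; last exact: smooth_dh.
have -> : local_dh (local_biv w c) (christoffel nab c) (local_hform c (dh nab w a)) (chart c p) =
    local_dh (local_biv w c) (christoffel nab c) (local_dh (local_biv w c) (christoffel nab c) (local_hform c a)) (chart c p).
  apply: eq_bigr => i _; congr (qmul _ _ _); apply/funext => m.
  by apply: (conn_on _ _ oX) => // y Xy; exact: local_form_dh.
have S : local_dh (local_biv w c) (christoffel nab c) (local_dh (local_biv w c) (christoffel nab c) (local_hform c a)) (chart c p) = 0.
  apply: (local_dh_sq oX (smooth_local_biv w_biv (c:=c)) (smooth_christoffel nab (c:=c)) _ _ _ _ Xp (smooth_chform_local_hform c sa)).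
  - by move=> y _; exact: local_biv_anti.
  - by move=> y i Xy; exact: parallel_chart.
  - by move=> y i l Xy; exact: christoffel_sym.
  - by move=> f sf i k' y Xy; exact: (schwarz_chart tf sf).
exact: (congr1 (fun h : H => h k) S).
Qed.

Lemma nabla_form_linear (r : R) (a b : M -> form) q i : smooth_form A setT a -> smooth_form A setT b ->
  nabla_form nab q (e_ i) (r *: a + b) =
  r *: nabla_form nab q (e_ i) a + nabla_form nab q (e_ i) b.
Proof.
move=> sa sb; rewrite !nabla_conn; set c := chart_at A q.
have Xq : chart_image c setT (chart c q) by apply: chart_image_chart => //; exact: dom_chart_at.
have da := smooth_cform_diff_cform (smooth_cform_local_form c openT sa) Xq; have db := smooth_cform_diff_cform (smooth_cform_local_form c openT sb) Xq.
rewrite -(conn_const _ _ _ da) -conn_D //.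
by apply: diff_cform_Z => //; exact: differentiable_cst.
Qed.

Lemma dh_linear (r : R) (a b : hform) : smooth_hform a -> smooth_hform b ->
  dh nab w (r *: a + b) = r *: dh nab w a + dh nab w b.
Proof.
move=> sa sb; apply/funext => k; apply/funext => p.
transitivity ((r *: (\sum_i qmul (w p) i (nablaH nab a p i)) + \sum_i qmul (w p) i (nablaH nab b p i)) k) => //.
rewrite /dh; apply: (congr1 (fun h : H => h k)).
rewrite scaler_sumr -big_split; apply: eq_bigr => i _ /=.
rewrite -qmulZ -qmulD; congr (qmul _ _ _); apply/funext => m.
exact: nabla_form_linear.
Qed.

Lemma dh_hmul m (a : hform) : dh nab w (hmul m a) = hmul m (dh nab w a).
Proof.
apply/funext => k; apply/funext => p; rewrite /hmul /dh !hseries_sum; apply: eq_bigr => i _.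
by rewrite /qmul /nablaH /hmul (_ : k - 1 - m = k - m - 1) // addrAC.
Qed.

Lemma dh_supp (a : hform) k : a k = 0 -> a (k - 1) = 0 -> dh nab w a k = 0.
Proof.
move=> ak ak1; apply/funext => p; rewrite /dh hseries_sum big1 // => i _.
by rewrite /qmul /nablaH ak ak1 nabla_form0 emul0 contr0 addr0.
Qed.

Lemma Omega_dh (a : hform) : Omega_laurent A a -> Omega_laurent A (dh nab w a).
Proof.
move=> [sa [N aN]]; split; first exact: smooth_dh.
exists N.+1 => k Nk; apply: dh_supp; apply: aN; lia.
Qed.

Lemma Omega_poly_dh (a : hform) : Omega_poly A a -> Omega_poly A (dh nab w a).
Proof.
move=> [oa a0]; split; first exact: Omega_dh.
by move=> k k0; apply: dh_supp; apply: a0 => //; lia.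
Qed.

Definition unit_form : form := fun s => if s is [::] then 1 else 0.

Lemma wdg_unit_form b : wdg unit_form b = b.
Proof.
apply/funext => s; elim: s b => [|v s IHs] b; first by rewrite wdg_nil mul1r.
rewrite -[LHS]/(contr v (wdg unit_form b) s) contr_wdg.
have -> : contr v unit_form = 0 by [].
have -> : grinv unit_form = unit_form by apply/funext => -[|u t]; rewrite /grinv /= ?mulr1 ?mulr0.
by rewrite wdg0l add0r IHs.
Qed.

Lemma contr_covector v (l : V -> R) : contr v (covector l) = l v *: unit_form.
Proof. by apply/funext => -[|u t]; rewrite formZ /contr /= ?mulr1 ?mulr0. Qed.

Lemma grinv_unit_form : grinv unit_form = unit_form.
Proof. by apply/funext => -[|u t]; rewrite /grinv /= ?mulr1 ?mulr0. Qed.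

(** A second contraction of a covector vanishes, so the series stops at h. *)
Lemma qcoef_covector (W : 'M[R]_n) (k : int) (l : V -> R) (b : form) :
  qcoef W k (covector l) b =
  if k == 0 then covmul l b
  else if k == 1 then \sum_i \sum_j (W i j * l (e_ i)) *: contr (e_ j) b else 0.
Proof.
case: k => [[|[|m]]|m] //.
- by rewrite /= invr1 scale1r wdg_covector.
- rewrite /= invr1 scale1r; apply: eq_bigr => i _; apply: eq_bigr => j _.
  by rewrite contr_covector grinvZ grinv_unit_form wdgZl wdg_unit_form scalerA.
rewrite /qcoef /= big1 ?scaler0 // => i _; rewrite big1 // => j _.
rewrite big1 ?scaler0 // => i' _; rewrite big1 // => j' _.
by rewrite contr_covector !linE grinv_unit_form (_ : contr _ unit_form = 0) // !linE scaler0 cwedge0l scaler0.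
Qed.

(** The part of degree 0 in h is [frame_covmul]; in the part of degree 1 the vectors of the
frame are recovered from their own coordinates. *)
Lemma dh_extends : extends_dh nab w (dh nab w).
Proof.
move=> a sa U e oU [_ fe] k p s Up.
set F := \matrix_i e i p; have uF : F \in unitmx by exact: fe.
have lB : form_lin (fun z => nabla_form nab p z a) := nabla_form_lin nab openT I sa.
have rowF i : row i F = e i p by rewrite rowK.
have eB z : exterior (nabla_form nab p z a).
  rewrite [z]vec_std (form_lin_sum _ _ _ lB); apply: exterior_sum => i _; apply: exteriorZ.
  rewrite nabla_conn; set c := chart_at A p.
  have Xp : chart_image c setT (chart c p) by apply: chart_image_chart => //; exact: dom_chart_at.
  apply: (conn_exterior _ _ (chart_image_open openT) Xp); last exact: (proj1 (smooth_cform_local_form c openT sa)).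
  exact: smooth_cform_diff_cform (smooth_cform_local_form c openT sa) Xp.
transitivity ((\sum_i qcoef (w p) k (dual_frame e i p) (nabla_form nab p (e i p) a)) s); last first.
  rewrite form_sum; apply: eq_bigr => i _; rewrite qwedge_coefE //.
  exact/exterior_covector/scal_lin_mul.
apply: (congr1 (fun b : form => b s)).
rewrite /dh hseries_sum.
pose B z := nabla_form nab p z a.
have hc m i : nablaH nab (hconst a) p i m = if m == 0 then B (e_ i) else 0.
  by rewrite /nablaH /hconst; case: eqP => // _; rewrite nabla_form0.
transitivity (\sum_i (emul i (if k == 0 then B (e_ i) else 0) +
    contr (row i (w p)) (if k == 1 then B (e_ i) else 0))).
  by apply: eq_bigr => i _; rewrite /qmul !hc subr_eq0.
pose l i (v : V) := (v *m invmx F) 0 i.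
transitivity (\sum_i (if k == 0 then covmul (l i) (B (e i p)) else if k == 1 then
    \sum_a0 \sum_b0 (w p a0 b0 * l i (e_ a0)) *: contr (e_ b0) (B (e i p)) else 0)); last first.
  by apply: eq_bigr => i _; rewrite -qcoef_covector.
have [->|k0] := eqVneq k 0.
  rewrite /=; under [LHS]eq_bigr => i _ do rewrite contr0 addr0.
  by rewrite -(frame_covmul uF lB); apply: eq_bigr => i _; rewrite rowF.
under [LHS]eq_bigr => i _ do rewrite emul0 add0r.
have [_|k1] := eqVneq k 1; last by rewrite !big1 // => i _; rewrite contr0.
rewrite [RHS]exchange_big; apply: eq_bigr => a0 _; rewrite [RHS]exchange_big /=.
rewrite contr_row; last exact: eB.
apply: eq_bigr => b0 _.
(* nabla along e_a0, expressed through the given frame *)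
have BE : B (e_ a0) = \sum_i l i (e_ a0) *: B (e i p).
  rewrite -{1}[e_ a0](frame_vec _ uF) /B (form_lin_sum _ _ _ lB).
  by apply: eq_bigr => i _; rewrite rowF.
rewrite BE contr_sum scaler_sumr; apply: eq_bigr => i _.
by rewrite contrZ scalerA.
Qed.

End OperatorProperties.

(** * The derivation property *)

Definition zrange (N : nat) : seq int := [seq i%:Z - N%:Z | i <- iota 0 N.*2.+1].

Lemma mem_zrange N (k : int) : (k \in zrange N) = (`|k| <= N)%N.
Proof.
apply/mapP/idP => [[i]|kN]; first by rewrite mem_iota => /andP[_ iN] ->; lia.
by exists (absz (k + N%:Z)); [rewrite mem_iota|]; lia.
Qed.

Lemma uniq_zrange N : uniq (zrange N).
Proof. by rewrite map_inj_uniq ?iota_uniq // => i j; lia. Qed.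

Lemma sum_zrange_shift (V : nmodType) N (G : int -> V) : (forall k : int, (N < `|k|)%N -> G k = 0) ->
  \sum_(x <- zrange N.+1) G (x - 1) = \sum_(x <- zrange N.+1) G x.
Proof.
move=> G0; have iE m : iota 0 m = index_iota 0 m by rewrite /index_iota subn0.
rewrite /zrange !big_map iE.
rewrite [LHS]big_nat_recl // [RHS]big_nat_recr //= [X in X + _]G0; last by lia.
rewrite [X in _ = _ + X]G0; last by lia.
rewrite add0r addr0; apply: eq_bigr => i _; congr G; lia.
Qed.

Section Derivation.
Context (R : realType) (n : nat) (M : topologicalType) (A : manifold R n M).
Local Notation V := 'rV[R]_n.
Local Notation e_ := (std R).
Local Notation form := (seq V -> R^o).
Local Notation H := (int -> form).
Local Notation hform := (hform R n M).
Implicit Types (c : atlas A) (p q : M).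
Context (nab : connection A) (w : M -> 'M[R]_n).
Context (w_biv : bivector_field A w) (nw : preserves nab w).

Lemma contr_qcoef (W : 'M[R]_n) k u (a b : form) : exterior a -> exterior b ->
  contr u (qcoef W k a b) = qcoef W k (contr u a) b + qcoef W k (grinv a) (contr u b).
Proof.
move=> ea eb; case: k => [m|m] /=; last by rewrite contr0 addr0.
by rewrite contrZ contr_cwedge // scalerDr.
Qed.

Lemma sum_contr_qcoef (W : 'M[R]_n) k i (a b : form) : exterior a -> exterior b ->
  \sum_j W i j *: contr (e_ j) (qcoef W k a b) = contr (row i W) (qcoef W k a b).
Proof.
move=> ea eb; rewrite contr_qcoef // !contr_row // qcoef_suml qcoef_sumr -big_split; apply: eq_bigr => j _.
by rewrite contr_qcoef // qcoefZl qcoefZr scalerDr.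
Qed.

(** The coefficient of h^k in L_i (a /\_h b) = (L_i a) /\_h b: [emul_qcoef_left] with
the contractions collected along a row of w. *)
Lemma qmul_qcoef_left (W : 'M[R]_n) k i (a b : form) : exterior a -> exterior b ->
  emul i (qcoef W k a b) + contr (row i W) (qcoef W (k - 1) a b) =
  qcoef W k (emul i a) b + qcoef W (k - 1) (contr (row i W) a) b.
Proof.
move=> ea eb; rewrite -sum_contr_qcoef // emul_qcoef_left // contr_row // qcoef_suml.
by congr (_ + _); apply: eq_bigr => j _; rewrite qcoefZl.
Qed.

(** Likewise for L_i (a /\_h b) = a' /\_h (L_i b), where a' is the grading involution
of a. *)
Lemma qmul_qcoef_right (W : 'M[R]_n) k i (a b : form) : W^T = - W -> exterior a -> exterior b ->
  emul i (qcoef W k a b) + contr (row i W) (qcoef W (k - 1) a b) =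
  qcoef W k (grinv a) (emul i b) + qcoef W (k - 1) (grinv a) (contr (row i W) b).
Proof.
move=> WT ea eb; rewrite -sum_contr_qcoef // (emul_qcoef_right _ _ WT) // contr_row // qcoef_sumr.
by congr (_ + _); apply: eq_bigr => j _; rewrite qcoefZr.
Qed.

Lemma exterior_nablaH (a : hform) p i k : smooth_hform A a -> exterior (nablaH nab a p i k).
Proof.
move=> sa; rewrite /nablaH nabla_conn; set c := chart_at A p.
have Xp : chart_image c setT (chart c p) by apply: chart_image_chart => //; exact: dom_chart_at.
apply: (conn_exterior _ _ (chart_image_open openT) Xp); last exact: (proj1 (smooth_cform_local_form c openT (sa k))).
exact: smooth_cform_diff_cform (smooth_cform_local_form c openT (sa k)) Xp.
Qed.

(** In a chart the product is [qcoef] for the local expression of w, for which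
the Leibniz rule is [conn_qcoef]. *)
Lemma nabla_hwedge (a b : hform) p i k (r : seq int) : smooth_hform A a -> smooth_hform A b ->
  nabla_form nab p (e_ i)
    (fun q => \sum_(x <- r) \sum_(y <- r) qcoef (w q) (k - x - y) (a x q) (b y q)) =
  \sum_(x <- r) \sum_(y <- r) (qcoef (w p) (k - x - y) (nablaH nab a p i x) (b y p) +
    qcoef (w p) (k - x - y) (a x p) (nablaH nab b p i y)).
Proof.
move=> sa sb; rewrite nabla_conn; set c := chart_at A p.
have cp : dom c p by exact: dom_chart_at.
have oX : open (chart_image c setT) := chart_image_open openT.
have Xp : chart_image c setT (chart c p) by exact: chart_image_chart.
have J1 : jac_at c p = 1%:M by exact: jac_id.
have tp (a0 : M -> form) : local_form c a0 (chart c p) = a0 p by rewrite local_form_chart // J1 pullback1.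
have wp : local_biv w c (chart c p) = w p.
  by rewrite /local_biv chartK // -/c -[jac _ _ _]/(jac_at c p) J1 trmx1 mul1mx mulmx1.
have dw : diff_cmx (local_biv w c) (chart c p) := smooth_cmx_diff_cmx (smooth_local_biv w_biv (c:=c)) Xp.
have dF (a0 : hform) x : smooth_hform A a0 -> diff_cform (local_form c (a0 x)) (chart c p).
  by move=> sa0; exact: smooth_cform_diff_cform (smooth_cform_local_form c openT (sa0 x)) Xp.
pose t x y z := qcoef (local_biv w c z) (k - x - y) (local_form c (a x) z) (local_form c (b y) z).
rewrite (conn_on _ _ oX (K := fun z => \sum_(x <- r) \sum_(y <- r) t x y z) _ Xp); last first.
  move=> z /chart_image_inv [cz _ _]; rewrite /local_form pullback_sum; apply: eq_bigr => x _.
  rewrite pullback_sum; apply: eq_bigr => y _.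
  apply: pullback_qcoef; [|exact: (proj1 (sa x))|exact: (proj1 (sb y))].
  rewrite /local_biv !mulmxA -mulmxA jac_atKV // mulmx1 -trmx_mul jac_atKV // trmx1 mul1mx //.
have dt x y : diff_cform (t x y) (chart c p) by apply: diff_cform_qcoef => //; exact: dF.
rewrite conn_sum => [|x]; last exact: diff_cform_sum.
apply: eq_bigr => x _; rewrite conn_sum //; apply: eq_bigr => y _.
rewrite /t conn_qcoef //.
- by rewrite /nablaH !nabla_conn -/c wp !tp.
- exact: dF.
- exact: dF.
- by rewrite tp; exact: (proj1 (sa x)).
- by rewrite tp; exact: (proj1 (sb y)).
- exact: parallel_chart.
Qed.

(** Laurent polynomials with exponents in a common finite range have a product that is a
finite double sum. *)
Lemma hwedge_zrange N (a b : hform) : smooth_hform A a -> smooth_hform A b ->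
  (forall k : int, (N < `|k|)%N -> a k = 0) -> (forall k : int, (N < `|k|)%N -> b k = 0) ->
  forall k, hwedge w a b k =
    (fun p => \sum_(x <- zrange N) \sum_(y <- zrange N) qcoef (w p) (k - x - y) (a x p) (b y p)).
Proof.
move=> sa sb a0 b0 k; apply/funext => p; apply/funext => s; rewrite /hwedge.
have ea x : exterior (a x p) by exact: (proj1 (sa x)).
have eb x : exterior (b x p) by exact: (proj1 (sb x)).
rewrite (fsbigE [seq (x, y) | x <- zrange N, y <- zrange N]) //; first last.
- move=> [x y] _ xy; rewrite qwedge_coefE //.
  have : (x \notin zrange N) || (y \notin zrange N).
    rewrite -negb_and; apply: contra xy => /andP[xr yr].
    exact: (allpairs_f (fun x y => (x, y)) xr yr).
  by rewrite !mem_zrange -!ltnNge => /orP[/a0 ->|/b0 ->]; rewrite ?qcoef0l ?qcoef0r.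
- by apply: allpairs_uniq; rewrite ?uniq_zrange // => -[x y] [x' y'] _ _ [-> ->].
rewrite form_sum (eq_bigl xpredT) => [|x]; last by rewrite in_setT.
rewrite big_allpairs; apply: eq_bigr => x _; rewrite form_sum; apply: eq_bigr => y _ /=.
by rewrite qwedge_coefE.
Qed.

(** The parts of d_h of degree 0 and 1 in h, the second without its factor h ([dh_split]). *)
Definition dh0 (a : hform) p k : form := \sum_i emul i (nablaH nab a p i k).
Definition dh1 (a : hform) p k : form := \sum_i contr (row i (w p)) (nablaH nab a p i k).

Lemma dh_split a p k : dh nab w a k p = dh0 a p k + dh1 a p (k - 1).
Proof. by rewrite /dh hseries_sum -big_split. Qed.

Lemma dh1_supp (a : hform) p k : a k = 0 -> dh1 a p k = 0.
Proof. by move=> ak; rewrite /dh1 big1 // => i _; rewrite /nablaH ak nabla_form0 contr0. Qed.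

Lemma sum2_split (r : seq int) (F G : int -> int -> form) :
  \sum_(x <- r) \sum_(y <- r) (F x y + G x y) =
  \sum_(x <- r) \sum_(y <- r) F x y + \sum_(x <- r) \sum_(y <- r) G x y.
Proof. by rewrite -big_split; apply: eq_bigr => x _; rewrite -big_split. Qed.

(** For each i and each pair of coefficients, L_i is moved to the factor that
nabla_i differentiates. *)
Lemma dh_hwedge N (a b : hform) k p : smooth_hform A a -> smooth_hform A b ->
  (forall k : int, (N < `|k|)%N -> a k = 0) -> (forall k : int, (N < `|k|)%N -> b k = 0) ->
  dh nab w (hwedge w a b) k p =
  \sum_(x <- zrange N) \sum_(y <- zrange N)
     (qcoef (w p) (k - x - y) (dh0 a p x) (b y p) + qcoef (w p) (k - x - y - 1) (dh1 a p x) (b y p)) +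
  \sum_(x <- zrange N) \sum_(y <- zrange N)
     (qcoef (w p) (k - x - y) (grinv (a x p)) (dh0 b p y) + qcoef (w p) (k - x - y - 1) (grinv (a x p)) (dh1 b p y)).
Proof.
move=> sa sb a0 b0; rewrite /dh hseries_sum -sum2_split.
have ea x : exterior (a x p) by exact: (proj1 (sa x)).
have eb x : exterior (b x p) by exact: (proj1 (sb x)).
have wT : (w p)^T = - w p by exact: (proj1 w_biv).
pose T1 i x y := qcoef (w p) (k - x - y) (emul i (nablaH nab a p i x)) (b y p) +
  qcoef (w p) (k - x - y - 1) (contr (row i (w p)) (nablaH nab a p i x)) (b y p).
pose T2 i x y := qcoef (w p) (k - x - y) (grinv (a x p)) (emul i (nablaH nab b p i y)) +
  qcoef (w p) (k - x - y - 1) (grinv (a x p)) (contr (row i (w p)) (nablaH nab b p i y)).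
transitivity (\sum_i \sum_(x <- zrange N) \sum_(y <- zrange N) (T1 i x y + T2 i x y)).
  apply: eq_bigr => i _; rewrite /qmul /nablaH !(hwedge_zrange sa sb a0 b0) !nabla_hwedge //.
  rewrite emul_sum contr_sum -big_split; apply: eq_bigr => x _ /=.
  rewrite emul_sum contr_sum -big_split; apply: eq_bigr => y _ /=.
  have -> : k - 1 - x - y = k - x - y - 1 by lia.
  rewrite emulD contrD addrACA qmul_qcoef_left ?qmul_qcoef_right //; exact: exterior_nablaH.
rewrite exchange_big; apply: eq_bigr => x _; rewrite exchange_big; apply: eq_bigr => y _ /=.
by rewrite /dh0 /dh1 !qcoef_suml !qcoef_sumr -!big_split.
Qed.

(** As h has even degree, the parity of the total degree is that of the form degree of
every coefficient. *)
Lemma grinv_degree (d : int) (a : hform) k p : hdegree d a ->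
  grinv (a k p) = (-1 : R) ^ d *: a k p.
Proof.
move=> da; apply/funext => s; rewrite formZ /grinv.
have [sd|sd] := eqVneq (size s)%:Z (d - 2 * k); last by rewrite da ?mulr0.
congr (_ * _); rewrite -[LHS]/((-1 : R) ^ (size s)%:Z) sd expfzDr ?oppr_eq0 ?oner_eq0 //.
by rewrite -mulrN -exprz_exp -[(-1) ^ 2]/((-1) ^+ 2) sqrrN expr1n exp1rz mulr1.
Qed.

Lemma dh_derivation : hderivation w (Omega_laurent A) (dh nab w).
Proof.
move=> d a b [sa [Na a0]] [sb [Nb b0]] da.
pose N := maxn Na Nb.
have {}a0 (k : int) : (N < `|k|)%N -> a k = 0 by move=> kN; apply: a0; rewrite /N in kN; lia.
have {}b0 (k : int) : (N < `|k|)%N -> b k = 0 by move=> kN; apply: b0; rewrite /N in kN; lia.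
(* d_h raises the exponents of h by at most one; N.+1 bounds those of a, b and their images *)
have a1 (k : int) : (N.+1 < `|k|)%N -> a k = 0 by move=> kN; apply: a0; lia.
have b1 (k : int) : (N.+1 < `|k|)%N -> b k = 0 by move=> kN; apply: b0; lia.
have sDa := smooth_dh nab w_biv sa; have sDb := smooth_dh nab w_biv sb.
have Da1 (k : int) : (N.+1 < `|k|)%N -> dh nab w a k = 0.
  by move=> kN; apply: dh_supp; apply: a0; lia.
have Db1 (k : int) : (N.+1 < `|k|)%N -> dh nab w b k = 0.
  by move=> kN; apply: dh_supp; apply: b0; lia.
apply/funext => k; apply/funext => p; rewrite (dh_hwedge k p sa sb a1 b1).
transitivity (hwedge w (dh nab w a) b k p + (-1 : R) ^ d *: hwedge w a (dh nab w b) k p) => //.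
rewrite (hwedge_zrange sDa sb Da1 b1) (hwedge_zrange sa sDb a1 Db1).
congr (_ + _).
  under [RHS]eq_bigr => x _ do under eq_bigr => y _ do rewrite dh_split qcoefDl.
  rewrite !sum2_split; congr (_ + _).
  pose G x := \sum_(y <- zrange N.+1) qcoef (w p) (k - x - y - 1) (dh1 a p x) (b y p).
  rewrite -[LHS]/(\sum_(x <- zrange N.+1) G x) -(sum_zrange_shift (G := G)).
    apply: eq_bigr => x _; apply: eq_bigr => y _.
    by congr (qcoef _ _ _ _); lia.
  by move=> j jN; rewrite /G big1 // => y _; rewrite dh1_supp ?qcoef0l // a0.
rewrite scaler_sumr; apply: eq_bigr => x _.
rewrite scaler_sumr; transitivity (\sum_(y <- zrange N.+1)
    ((-1 : R) ^ d *: qcoef (w p) (k - x - y) (a x p) (dh0 b p y) +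
     (-1 : R) ^ d *: qcoef (w p) (k - x - y) (a x p) (dh1 b p (y - 1)))); last first.
  by apply: eq_bigr => y _; rewrite dh_split qcoefDr scalerDr.
rewrite !big_split; congr (_ + _).
  by apply: eq_bigr => y _; rewrite (grinv_degree x p da) qcoefZl.
pose G y := qcoef (w p) (k - x - y - 1) (grinv (a x p)) (dh1 b p y).
rewrite -[LHS]/(\sum_(y <- zrange N.+1) G y) -(sum_zrange_shift (G := G)).
  apply: eq_bigr => y _; rewrite /G (grinv_degree x p da) qcoefZl.
  by congr (_ *: qcoef _ _ _ _); lia.
by move=> j jN; rewrite /G dh1_supp ?qcoef0r // b0.
Qed.

End Derivation.

Theorem theorem2p1 (R : realType) (n : nat) (M : topologicalType)
    (A : manifold R n M) (w : M -> 'M[R]_n) (nab : connection A)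
    (w_bivector : bivector_field A w)
    (nab_torsion_free : torsion_free nab)
    (nab_w : preserves nab w) :
  (exists D : hform R n M -> hform R n M,
     [/\ forall a, Omega_poly A a -> Omega_poly A (D a),
         hlinear [set m | 0 <= m] (Omega_poly A) D,
         extends_dh nab w D,
         hderivation w (Omega_poly A) D
       & forall a, Omega_poly A a -> D (D a) = 0]) /\
  (exists D : hform R n M -> hform R n M,
     [/\ forall a, Omega_laurent A a -> Omega_laurent A (D a),
         hlinear setT (Omega_laurent A) D,
         extends_dh nab w D,
         hderivation w (Omega_laurent A) D
       & forall a, Omega_laurent A a -> D (D a) = 0]).
Proof.
have der := dh_derivation w_bivector nab_w.
have sq (a : hform R n M) : Omega_laurent A a -> dh nab w (dh nab w a) = 0.
  by move=> [sa _]; exact: dh_sq.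
split; exists (dh nab w); split.
- by move=> a; exact: Omega_poly_dh.
- split=> [x a b [[sa _] _] [[sb _] _]|m a _ _]; [exact: dh_linear|exact: dh_hmul].
- exact: dh_extends.
- by move=> d a b [oa _] [ob _]; exact: der.
- by move=> a [oa _]; exact: sq.
- by move=> a; exact: Omega_dh.
- split=> [x a b [sa _] [sb _]|m a _ _]; [exact: dh_linear|exact: dh_hmul].
- exact: dh_extends.
- exact: der.
- exact: sq.
Qed.
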